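(* Let $k\ge 2$ be a fixed integer. There is a randomized algorithm which, for every integer $N\ge 1$, after a pre-processing phase taking $O(N^{k})$ time and $O(N^{k})$ space, generates a random $k$-noncrossing partition of $[N]$ with uniform probability (i.e. each $k$-noncrossing partition of $[N]$ is output with probability $1/|\mathcal{P}_k(N)|$) in linear time: once the pre-processing has been carried out, each $k$-noncrossing partition is generated with $O(N)$ time and $O(N)$ space complexity. (The constants implied by $O(\cdot)$ may depend on $k$.)
   Context: $[N]=\{1,2,\dots,N\}$. A set partition of $[N]$ is a collection of nonempty, mutually disjoint subsets (blocks) of $[N]$ whose union is $[N]$. Its standard representation is the graph on the vertex set $[N]$ whose arcs $(i,j)$, $i<j$, connect consecutive elements (in numerical order) of each block. A $k$-crossing is a set of $k$ arcs $(i_1,j_1),\dots,(i_k,j_k)$ of the standard representation with $i_1<i_2<\dots<i_k<j_1<j_2<\dots<j_k$. A $k$-noncrossing partition is a set partition whose standard representation contains no $k$-crossing. $\mathcal{P}_k(N)$ denotes the set of $k$-noncrossing partitions of $[N]$. Complexity convention: time is counted in the unit-cost model, in which an arithmetic operation on integers, a table look-up, and drawing one of a bounded (depending only on $k$) number of outcomes with prescribed rational probabilities each take $O(1)$ time; space is the number of stored integers. The space used in the generation phase does not include the stored pre-processed tables. *)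

(* Defs.v *)
From Stdlib Require List.
From mathcomp Require Import all_boot all_order all_algebra.
From mathcomp Require Import finmap.

Set Implicit Arguments.
Unset Strict Implicit.
Unset Printing Implicit Defensive.

Local Open Scope fset_scope.
Local Open Scope fmap_scope.
Local Open Scope ring_scope.

(** * Set partitions of [N]

    ['I_N] stands for {1, ..., N}: the ordinal [i] is the element [i.+1].  A
    set partition is a [P] such that [partition P [set: 'I_N]]. *)

Definition arc (N : nat) (P : {set {set 'I_N}}) (i j : 'I_N) : bool :=
  [exists B in P, [&& i \in B, j \in B, (i < j)%N &
     [forall l in B, ~~ ((i < l)%N && (l < j)%N)]]].

Definition crossing (N k : nat) (P : {set {set 'I_N}})
    (t : k.-tuple ('I_N * 'I_N)) : bool :=
  all (fun a => arc P a.1 a.2) t &&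
  sorted ltn ([seq nat_of_ord a.1 | a <- t] ++ [seq nat_of_ord a.2 | a <- t]).

Definition noncrossing (N k : nat) (P : {set {set 'I_N}}) : bool :=
  ~~ [exists t : k.-tuple ('I_N * 'I_N), crossing P t].

Definition noncrossing_partitions (k N : nat) : {set {set {set 'I_N}}} :=
  [set P | partition P [set: 'I_N] && noncrossing k P].

(** * Finitely supported distributions with rational weights

    A list of (weight, value) pairs; values may be repeated, and weights may
    be zero. *)

Definition dist (T : Type) := seq (rat * T).

Definition dret (T : Type) (x : T) : dist T := [:: (1, x)].

Definition dbind (T U : Type) (d : dist T) (f : T -> dist U) : dist U :=
  [seq (a.1 * b.1, b.2) | a <- d, b <- f a.2].

Definition prob (T : Type) (d : dist T) (E : pred T) : rat :=
  \sum_(a <- d | E a.2) a.1.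

Definition possible (T : Type) (d : dist T) (x : T) : Prop :=
  exists2 w : rat, 0 < w & List.In (w, x) d.

(** * Randomized unit-cost random access machine

    Programs are finite while-programs.  The memory consists of countably many
    arrays, named by natural numbers fixed in the program text, and indexed by
    computed integers; each cell holds an integer of arbitrary size, and 0 if
    it was never written.  The scalar variable [x] is the cell [(x, 0)].

    Besides its memory, a program has a second, read-only store, the tables. *)

Definition cell : Type := (nat * int)%type.
Definition store : Type := {fmap cell -> int}.

Definition get (s : store) (c : cell) : int := odflt 0 s.[? c].
Definition put (s : store) (c : cell) (v : int) : store := s.[c <- v].

Inductive operand :=
| Const of int
| Var of nat.

Inductive binop := Add | Sub | Mul | Div | Mod.

Inductive comparison := Eq | Le | Lt.

Inductive rvalue :=
| Atom of operand
| Bin of binop & operand & operand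
| Read of nat & operand    (* memory array, index *)
| Lookup of nat & operand. (* table array, index *)

(* [Draw x ws] sets [x] to [j < size ws] with probability proportional to the
   value of the [j]-th operand of [ws]; the number of outcomes is therefore
   bounded by the program text. *)
Inductive instr :=
| Assign of nat & rvalue
| Write of nat & operand & operand (* array, index, value *)
| Draw of nat & seq operand
| If of comparison & operand & operand & seq instr & seq instr
| While of comparison & operand & operand & seq instr.

Definition program : Type := seq instr.

Definition eval_operand (s : store) (o : operand) : int :=
  match o with
  | Const z => z
  | Var x => get s (x, 0)
  end.

Definition eval_binop (op : binop) (a b : int) : int :=
  match op with
  | Add => a + b
  | Sub => a - b
  | Mul => a * b
  | Div => (a %/ b)%Z
  | Mod => (a %% b)%Z
  end.

Definition eval_comparison (c : comparison) (a b : int) : bool :=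
  match c with
  | Eq => a == b
  | Le => a <= b
  | Lt => a < b
  end.

Definition eval_rvalue (tables s : store) (r : rvalue) : int :=
  match r with
  | Atom o => eval_operand s o
  | Bin op a b => eval_binop op (eval_operand s a) (eval_operand s b)
  | Read A i => get s (A, eval_operand s i)
  | Lookup A i => get tables (A, eval_operand s i)
  end.

(* What remains to be executed, and the current memory. *)
Definition config : Type := (program * store)%type.

Definition halted (c : config) : bool := nilp c.1.

(* Every instruction and every test takes one unit of time.  A draw whose
   weights are not a nonnegative nonzero vector is stuck: it never halts. *)
Definition step (tables : store) (c : config) : dist config :=
  let: (p, s) := c in
  match p with
  | [::] => dret c
  | Assign x r :: q => dret (q, put s (x, 0) (eval_rvalue tables s r))
  | Write A i o :: q =>
      dret (q, put s (A, eval_operand s i) (eval_operand s o))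
  | Draw x ws :: q =>
      let vs := [seq eval_operand s o | o <- ws] in
      let total := \sum_(v <- vs) v in
      if all (fun v => 0 <= v) vs && (0 < total) then
        [seq ((nth 0 vs j)%:~R / total%:~R, (q, put s (x, 0) j%:Z))
           | j <- iota 0 (size vs)]
      else dret c
  | If cmp a b p1 p2 :: q =>
      if eval_comparison cmp (eval_operand s a) (eval_operand s b)
      then dret (p1 ++ q, s) else dret (p2 ++ q, s)
  | While cmp a b p1 :: q =>
      if eval_comparison cmp (eval_operand s a) (eval_operand s b)
      then dret (p1 ++ p, s) else dret (q, s)
  end.

(* The input [N] is initially in variable 0, and nothing else is stored. *)
Definition initial (p : program) (N : nat) : config :=
  (p, put [fmap] (0%N, 0) N%:Z).

Definition run (p : program) (tables : store) (N time : nat) : dist config :=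
  iter time (fun d => dbind d (step tables)) (dret (initial p N)).

(* The set of written cells only grows along a run, so its final size is the
   largest number of integers stored at any time. *)
Definition space (s : store) : nat := #|` domf s|.

Definition runs_within (p : program) (tables : store)
    (N time bound : nat) : Prop :=
  forall c, possible (run p tables N time) c ->
    halted c /\ (space c.2 <= bound)%N.

(* The output partition is read off array 1: two elements of [N] are in the
   same block if and only if they carry the same label. *)
Definition output (N : nat) (s : store) : {set {set 'I_N}} :=
  preim_partition (fun i : 'I_N => get s (1%N, i.+1%:Z)) [set: 'I_N].

(* Main.v *)
(** Idea.  Scan the vertices from left to right and keep the open arcs in a
    standard tableau.  Closing an arc at a vertex deletes a corner of the tableau
    by inverse row insertion, which ejects the opener of the arc; opening an arc
    adds the vertex, the largest entry, at a corner (vacillating tableaux, after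
    Chen, Deng, Du, Stanley and Yan).  Reading the closers from right to left
    and inserting their openers recovers the tableaux, so a partition
    is the same thing as a walk on shapes; by Schensted's theorem it is
    k-noncrossing if and only if the shapes have fewer than k rows.  The number
    of ways to complete a walk depends only on the time and on the shape, hence
    fits in a table of size O(N^k); sampling each step with probability
    proportional to the number of completions yields the uniform distribution.

    A deletion has to find the predecessor of an entry in each of at most k - 1
    rows.  Its rank is found in O(1) arithmetic operations: with B = N + 2 and
    S the sum of the B^v over the entries v of the row, the number of entries
    below x is (S mod B^x) mod (B - 1). *)

(* Insertion commutes with the restriction to small entries, so the tableau before a vertex is a
   function of the tableau after it and of the arc that closes there. A left-to-right walk is
   therefore determined by the arcs that it records, and counting walks is counting arc sequences.
   The arcs of a crossing are all open just before its first closer, so a crossing is visible in a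
   single tableau. Here [k = K.+1], and the tableaux have at most [K] rows.

   A shape is a number in base [M = N.+1] whose digit 0 is fixed to [N]. The codes are thus
   [N + M * x] with [x < M ^ K], and only these cells are written: about [2 N] half-steps times
   [M ^ K] codes is O(N^k), although the addresses grow like N^(k+1). Every digit sequence is
   tabulated, whether or not it is a shape, so that filling is a plain loop.

   In the rank formula [B - 1 = N + 1] exceeds the length of any row, so the second reduction loses
   nothing.

   Uniformity is proved one event at a time: the sampling loop keeps the probability of the event
   equal to the number of successful completions over the number of completions. *)
Require Import Defs.
From mathcomp Require Import all_boot all_order all_algebra.
From mathcomp Require Import finmap.
From mathcomp Require Import zify ring.

Set Implicit Arguments.
Unset Strict Implicit.
Unset Printing Implicit Defensive.

Local Open Scope fmap_scope.
Local Open Scope ring_scope.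

Local Open Scope nat_scope.
Local Notation arc := Defs.arc.

(** * Insertion and deletion in tableaux *)

(* The pairs (entry, row), by decreasing entries.  The bumping path of a row
   insertion visits increasing entries, so an insertion or a deletion takes one
   pass over the list. *)
Definition tableau := seq (nat * nat).

(* The new tableau, with the row in which the shape grows. *)
Fixpoint ins (y : nat) (L : tableau) : nat * tableau :=
  if L is (v, r) :: L' then
    if v < y then (0, (y, 0) :: L)
    else let b := (ins y L').1 in let L1 := (ins y L').2 in
         if r == b then (b.+1, (v, b.+1) :: L1) else (b, (v, r) :: L1)
  else (0, [:: (y, 0)]).

(* The entry ejected by the deletion of the last cell of row [b], with the new
   tableau. *)
Fixpoint del (b : nat) (L : tableau) : option (nat * tableau) :=
  if L is (v, r) :: L' then
    if r == b then
      if b is b'.+1 then omap (fun z => (z.1, (v, b') :: z.2)) (del b' L')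
      else Some (v, L')
    else omap (fun z => (z.1, (v, r) :: z.2)) (del b L')
  else None.

Definition vals (L : tableau) := [seq z.1 | z <- L].
Definition desc (L : tableau) := sorted gtn (vals L).
Definition cnt (L : tableau) (r : nat) := count (fun z : nat * nat => z.2 == r) L.
Arguments cnt : simpl never.
Definition addable (L : tableau) (r : nat) := (r == 0) || (cnt L r < cnt L r.-1).

(** A standard tableau seen as a growing chain of shapes: each entry occupies a corner of the shape
    formed by itself and the smaller entries. *)
Fixpoint standard (L : tableau) :=
  if L is z :: L' then addable L' z.2 && standard L' else true.

Lemma desc_cons z L : desc (z :: L) = all (fun v => v < z.1) (vals L) && desc L.
Proof.
rewrite /desc /= path_sortedE //.
by move=> a b c /= h1 h2; apply: ltn_trans h2 h1.
Qed.

Lemma insK y L : del (ins y L).1 (ins y L).2 = Some (y, L).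
Proof.
elim: L => [|[v r] L IH] //=; case: ifP => //= _.
case: ifP => [/eqP-> | hr] /=; first by rewrite eqxx IH.
by rewrite hr IH.
Qed.

Lemma vals_ins y L z : (z \in vals (ins y L).2) = (z == y) || (z \in vals L).
Proof.
elim: L => [|[v r] L IH] /=; first by rewrite inE in_nil orbF.
case: ifP => _ /=; first by rewrite !inE.
by case: ifP => _ /=; rewrite !inE IH; case: (z == v); rewrite ?orbT.
Qed.

Lemma desc_ins y L : y \notin vals L -> desc L -> desc (ins y L).2.
Proof.
elim: L => [|[v r] L IH] //=; rewrite inE negb_or => /andP[yv yL].
rewrite desc_cons => /andP[/= av dL]; case: ifP => vy /=.
  rewrite !desc_cons /= vy av dL /= andbT.
  by apply: sub_all av => u; move/ltn_trans; apply.
case: ifP => _ /=; rewrite desc_cons IH // andbT /=; apply/allP => z;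
  rewrite vals_ins => /orP[/eqP->|/(allP av)//]; by rewrite ltn_neqAle yv leqNgt vy.
Qed.

Lemma del_vals b L y L1 : del b L = Some (y, L1) -> y \in vals L.
Proof.
elim: L b y L1 => [|[v r] L IH] //= b y L1.
case: ifP => _.
  case: b => [[<- _]|b]; first by rewrite mem_head.
  by case E: (del b L) => [[u M]|] //= [<- _]; rewrite inE (IH _ _ _ E) ?orbT.
case E: (del b L) => [[u M]|] //= [<- _]; by rewrite inE (IH _ _ _ E) orbT.
Qed.

(** The order of the entries matters: the ejected [y] is at most every entry passed on the way, so
    the reinsertion descends to the same place before it starts to bump. *)
Lemma delK b L y L1 : desc L -> del b L = Some (y, L1) -> ins y L1 = (b, L).
Proof.
elim: L b y L1 => [|[v r] L IH] //= b y L1.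
rewrite desc_cons => /andP[/= /allP av dL].
case: ifP => [/eqP rb|rb].
  case: b rb => [|b] rb.
    case=> <- <-; rewrite rb.
    case: L av {dL IH} => [|[v' r'] L] //= av.
    by have -> : v' < v by apply: av; apply: mem_head.
  case E: (del b L) => [[u M]|] //= [<- <-] /=.
  have /av/ltnW := del_vals E; rewrite leqNgt => /negbTE->.
  by rewrite (IH _ _ _ dL E) /= eqxx rb.
case E: (del b L) => [[u M]|] //= [<- <-] /=.
have /av/ltnW := del_vals E; rewrite leqNgt => /negbTE->.
by rewrite (IH _ _ _ dL E) /= rb.
Qed.

Lemma cnt_cons v q L r : cnt ((v, q) :: L) r = (q == r) + cnt L r.
Proof. by []. Qed.

Lemma cnt_ins y L r : cnt (ins y L).2 r = cnt L r + (r == (ins y L).1).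
Proof.
elim: L => [|[v q] L IH] /=; first by rewrite cnt_cons /=; lia.
case: ifP => _ /=; first by rewrite !cnt_cons; lia.
by case: ifP => [/eqP->|_] /=; rewrite !cnt_cons IH; lia.
Qed.

Lemma del_cnt b L y L1 r :
  del b L = Some (y, L1) -> cnt L r = cnt L1 r + (r == b).
Proof.
elim: L b y L1 => [|[v q] L IH] //= b y L1.
case: ifP => [/eqP->|qb].
  case: b => [[_ <-]|b]; first by rewrite cnt_cons /=; lia.
  case E: (del b L) => [[u M]|] //= [_ <-] /=.
  by rewrite !cnt_cons (IH _ _ _ E); lia.
case E: (del b L) => [[u M]|] //= [_ <-] /=.
by rewrite !cnt_cons (IH _ _ _ E); lia.
Qed.

Lemma standard_cnt L r : standard L -> cnt L r.+1 <= cnt L r.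
Proof.
elim: L => [|[v q] L IH] //= /andP[+ /IH le]; rewrite /addable !cnt_cons /=.
case: (eqVneq q r.+1) => [->|]; first by rewrite /=; lia.
by lia.
Qed.

Lemma standard_ins y L : standard L -> standard (ins y L).2.
Proof.
elim: L => [|[v q] L IH] //= /andP[aq sL]; case: ifP => _ /=; first by rewrite aq sL.
case: ifP => [_|/negbT qb] /=; rewrite IH // andbT /addable /= !cnt_ins.
  by rewrite eqxx; have := standard_cnt (ins y L).1 sL; lia.
by rewrite (negbTE qb) addn0; case/orP: aq => [->//|]; lia.
Qed.

(** If the largest entry ends row [b.+1], standardness makes row [b] of the remaining tableau longer
    than its row [b.+1]. So row [b] ends in a corner too, and the deletion can continue there. *)
Lemma del_standard b L : standard L -> cnt L b.+1 < cnt L b ->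
  exists y L1, del b L = Some (y, L1) /\ standard L1.
Proof.
elim: L b => [|[v q] L IH] //= b /andP[aq sL]; rewrite !cnt_cons.
case: ifP => [/eqP eqb|qb] h.
  case: b eqb h => [|b] eqb h; first by exists v, L.
  have hb: cnt L b.+1 < cnt L b by move: aq; rewrite /addable eqb.
  have [y [L1 [E s1]]] := IH b sL hb.
  rewrite E /=; exists y, ((v, b) :: L1); split=> //=; rewrite s1 andbT /addable.
  case: b E {hb h eqb} => [//|b] E /=.
  have := del_cnt b.+1 E; have := del_cnt b E; have := standard_cnt b sL.
  by rewrite eqxx; lia.
have hb: cnt L b.+1 < cnt L b by lia.
have [y [L1 [E s1]]] := IH b sL hb.
rewrite E /=; exists y, ((v, q) :: L1); split=> //=; rewrite s1 andbT /addable.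
case: q aq qb h => [//|q]; rewrite {1}/addable /= => aq qb h.
have := del_cnt q.+1 E; have := del_cnt q E.
by case: (eqVneq q b) h aq hb => [->|]; lia.
Qed.

Definition below (i : nat) (L : tableau) := [seq z <- L | z.1 < i].

Lemma below_id i L : all (fun v => v < i) (vals L) -> below i L = L.
Proof. by rewrite all_map => /all_filterP. Qed.

(** Large entries never influence where smaller ones go. This is what relates the tableaux of
    consecutive vertices, whose words differ by a restriction. *)
Lemma below_ins i y L : desc L -> 
  below i (ins y L).2 = if y < i then (ins y (below i L)).2 else below i L.
Proof.
elim: L => [|[v r] L IH] /=; first by case: ifP.
rewrite desc_cons => /andP[/= av dL].
case: (ltnP v y) => vy /=.
  case: (ltnP y i) => yi /=; rewrite ?(ltn_trans vy yi) //=; by rewrite vy.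
have E (vi : v < i) : below i L = L.
  apply: below_id; apply: sub_all av => u; move/ltn_trans; exact.
case: (ltnP v i) => vi /=.
  rewrite (leq_ltn_trans vy vi) /= ltnNge vy /= E //.
  move: {IH}(IH dL); rewrite (leq_ltn_trans vy vi) E // => IH.
  by case: ifP => _ /=; rewrite vi IH.
by case: ifP => _ /=; rewrite [v < i]ltnNge vi /= IH.
Qed.

Definition insw (L : tableau) (w : seq nat) := foldl (fun L y => (ins y L).2) L w.

Lemma vals_insw L w z : (z \in vals (insw L w)) = (z \in w) || (z \in vals L).
Proof.
elim: w L => //= y w IH L; rewrite IH vals_ins inE.
by case: (z == y); rewrite ?orbT.
Qed.

Lemma desc_insw L w : uniq w -> {in w, forall y, y \notin vals L} -> desc L ->
  desc (insw L w).
Proof.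
elim: w L => //= y w IH L /andP[yw uw] hw dL; apply: IH => //.
  move=> z zw; rewrite vals_ins negb_or hw ?inE ?zw ?orbT // andbT.
  by apply: contraNneq yw => <-.
by apply: desc_ins => //; apply: hw; rewrite mem_head.
Qed.

Lemma insw_cat L w1 w2 : insw L (w1 ++ w2) = insw (insw L w1) w2.
Proof. exact: foldl_cat. Qed.

Lemma below_insw i w : uniq w -> below i (insw [::] w) = insw [::] [seq y <- w | y < i].
Proof.
elim/last_ind: w => // w y IH; rewrite rcons_uniq => /andP[yw uw].
rewrite -cats1 insw_cat filter_cat /= below_ins ?desc_insw // IH //.
by case: ifP => _; rewrite ?cats0 // insw_cat.
Qed.

Lemma standard_insw L w : standard L -> standard (insw L w).
Proof. by elim: w L => //= y w IH L /(standard_ins y)/IH. Qed.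

(** * Schensted's theorem for decreasing subsequences *)

Definition row0 (L : tableau) := [seq z.1 | z <- L & z.2 == 0].
Definition lower (L : tableau) := [seq (z.1, z.2.-1) | z <- L & z.2 != 0].

Arguments lower : simpl never.

Lemma lower_cons v r L :
  lower ((v, r) :: L) = if r is r'.+1 then (v, r') :: lower L else lower L.
Proof. by rewrite /lower; case: r. Qed.

(** The entry that [y] displaces from the first row, that is, the smallest one that is at least [y];
    [None] means that [y] is appended to that row. *)
Fixpoint bump (y : nat) (L : tableau) : option nat :=
  if L is (v, r) :: L' then
    if v < y then None
    else if bump y L' is Some b then Some b
    else if r == 0 then Some v else None
  else None.

Fixpoint bumps (L : tableau) (w : seq nat) : seq nat :=
  if w is y :: w' then
    if bump y L is Some b then b :: bumps (ins y L).2 w'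
    else bumps (ins y L).2 w'
  else [::].

Lemma bump_mem y L b : bump y L = Some b -> b \in row0 L.
Proof.
rewrite /row0; elim: L => [|[v r] L IH] //=; case: ifP => // _.
case: (bump y L) IH => [c|] IH.
  by move/IH; case: ifP => _ //= cL; rewrite inE cL orbT.
by case: ifP => // _ [<-] /=; rewrite mem_head.
Qed.

Lemma row0_vals L z : z \in row0 L -> z \in vals L.
Proof. by case/mapP => u; rewrite mem_filter => /andP[_ uL] ->; apply: map_f. Qed.

Lemma bump_ge y L b : bump y L = Some b -> y <= b.
Proof.
elim: L => [|[v r] L IH] //=; case: ltnP => // yv.
case: (bump y L) IH => [c|] IH; first by move/IH.
by case: ifP => // _ [<-].
Qed.

Lemma bump_min y L z : desc L -> z \in row0 L -> y <= z ->
  exists2 b, bump y L = Some b & b <= z.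
Proof.
elim: L => [|[v r] L IH] //=; rewrite desc_cons => /andP[/= /allP av dL] zL yz.
have zv: z <= v.
  by move: (row0_vals zL); rewrite inE => /orP[/eqP->//|/av/ltnW].
rewrite ltnNge (leq_trans yz zv) /=.
case E: (bump y L) => [b|].
  exists b => //.
  move: zL; rewrite /row0 /=; case: ifP => _ /=; last first.
    by move=> zL; have [b' + ?] := IH dL zL yz; rewrite E => -[->].
  rewrite inE => /orP[/eqP->|zL]; first by apply/ltnW/av/row0_vals/(bump_mem E).
  by have [b' + ?] := IH dL zL yz; rewrite E => -[->].
move: zL; rewrite /row0 /=; case: ifP => r0 /=; last first.
  by move=> zL; have [b'] := IH dL zL yz; rewrite E.
by rewrite inE => /orP[/eqP->|zL]; [exists v|have [b'] := IH dL zL yz; rewrite E].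
Qed.

(** Below the first row, an insertion is just the insertion of the displaced letter, or nothing.
    Peeling off the first row in this way drives the induction on the number of rows. *)
Lemma ins_bump y L : desc L ->
  if bump y L is Some b then
    (ins y L).1 = (ins b (lower L)).1.+1 /\
    lower (ins y L).2 = (ins b (lower L)).2
  else (ins y L).1 = 0 /\ lower (ins y L).2 = lower L.
Proof.
elim: L => [|[v r] L IH] //=; rewrite desc_cons => /andP[/= /allP av dL].
case: ltnP => // yv; move: {IH}(IH dL).
case E: (bump y L) => [b|] [E1 E2] /=.
  have bv: b < v by apply/av/row0_vals/(bump_mem E).
  rewrite E1 lower_cons; case: r => [|r] /=; first by rewrite lower_cons E2.
  rewrite ltnNge (ltnW bv) /= eqSS.
  by case: eqP => _ /=; rewrite lower_cons E2.
rewrite E1 lower_cons; case: r => [|r] /=; rewrite lower_cons E2 //.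
case EL: (lower L) => [|[u q] M] //=.
have -> // : u < v.
apply: av; have : (u, q) \in lower L by rewrite EL mem_head.
by case/mapP => z; rewrite mem_filter => /andP[_ zL] [-> _]; apply: map_f.
Qed.

Lemma row0_ins y L z : desc L -> y \notin vals L ->
  (z \in row0 (ins y L).2) = (z == y) || (z \in row0 L) && (bump y L != Some z).
Proof.
rewrite /row0; elim: L => [|[v r] L IH] /=; first by rewrite !inE orbF.
rewrite desc_cons => /andP[/= /allP av dL]; rewrite inE negb_or => /andP[yv yL].
case: ltnP => vy; first by rewrite /= inE; case: (z == y); rewrite //= andbT.
move: {IH}(IH dL yL) (ins_bump y dL).
case E: (bump y L) => [b|] IH [E1 _] /=.
  have bv: b < v by apply/av/row0_vals/(bump_mem E).
  rewrite E1; case: r => [|r] /=; last by case: ifP => _ /=.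
  rewrite !inE IH; case: (eqVneq z v) => [->|] //=.
  by have -> : Some b != Some v; [apply/eqP => -[h]; rewrite h ltnn in bv|rewrite orbT].
rewrite E1; case: r => [|r] /=; last by rewrite IH.
rewrite IH inE; case: (eqVneq z v) => [->|zv] /=.
  rewrite eqxx /= andbT; case: eqP => //= _.
  apply/negP => h; have /av : v \in vals L by apply: row0_vals.
  by rewrite ltnn.
have -> : Some v != Some z by apply: contraNneq zv => -[->].
by rewrite andbT.
Qed.

Lemma lower_insw L w : desc L -> uniq w -> {in w, forall y, y \notin vals L} ->
  lower (insw L w) = insw (lower L) (bumps L w).
Proof.
elim: w L => //= y w IH L dL /andP[yw uw] h.
have yL: y \notin vals L by apply: h; rewrite mem_head.
have h' : {in w, forall z, z \notin vals (ins y L).2}.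
  move=> z zw; rewrite vals_ins negb_or h ?inE ?zw ?orbT // andbT.
  by apply: contraNneq yw => <-.
rewrite IH //; last exact: desc_ins.
by move: (ins_bump y dL); case: (bump y L) => [b|] [_ ->].
Qed.

(* A strictly decreasing subsequence of length [m] with all entries below [z]. *)
Fixpoint dsub (m z : nat) (w : seq nat) : bool :=
  if w is u :: w' then
    if m is m'.+1 then dsub m z w' || (u < z) && dsub m' u w' else true
  else m == 0.

(** The first letter is prescribed to be [y] and is not counted in [m]: the subsequence has [m.+1]
    letters. Fixing it makes the converse comparison inductive. *)
Fixpoint dsub_from (m y : nat) (w : seq nat) : bool :=
  if w is u :: w' then dsub_from m y w' || (u == y) && dsub m y w' else false.

Lemma dsub0 z w : dsub 0 z w. Proof. by case: w. Qed.

Lemma dsub_le m z z' w : z <= z' -> dsub m z w -> dsub m z' w.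
Proof.
move=> zz'; elim: w m => [|u w IH] [|m] //= /orP[/IH->//|/andP[uz ->]].
by rewrite (leq_trans uz zz') orbT.
Qed.

Lemma dsub_cons m z u w : dsub m z w -> dsub m z (u :: w).
Proof. by case: m => [|m] //= ->. Qed.

Lemma dsub_fromP m z w :
  reflect (exists2 y, y < z & dsub_from m y w) (dsub m.+1 z w).
Proof.
apply: (iffP idP).
  elim: w => //= u w IH /orP[/IH[y yz h]|/andP[uz h]].
    by exists y => //; rewrite h.
  by exists u => //; rewrite eqxx h orbT.
case=> y yz; elim: w => //= u w IH /orP[/IH->//|/andP[/eqP-> ->]].
by rewrite yz orbT.
Qed.

Lemma fresh_ins y w L : y \notin w -> {in y :: w, forall z, z \notin vals L} ->
  {in w, forall z, z \notin vals (ins y L).2}.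
Proof.
move=> yw h z zw; rewrite vals_ins negb_or h ?inE ?zw ?orbT // andbT.
by apply: contraNneq yw => <-.
Qed.

(* In the first row, a letter [u] below an entry [z] bumps an entry at most [z]:
   between two letters of a decreasing subsequence something is bumped. *)
Lemma dsub_bumps L w : desc L -> uniq w -> {in w, forall y, y \notin vals L} ->
  (forall m z, z \in row0 L -> dsub m z w -> dsub m z.+1 (bumps L w)) /\
  (forall m z, dsub m.+1 z w -> dsub m z (bumps L w)).
Proof.
elim: w L => [|u w IH] L dL /=; first by move=> _ _; split=> [[]|].
move=> /andP[uw uqw] fr; have uL: u \notin vals L by apply: fr; rewrite mem_head.
have [IHA IHB] := IH _ (desc_ins uL dL) uqw (fresh_ins uw fr).
have u0 : u \in row0 (ins u L).2 by rewrite row0_ins // eqxx.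
have C m z : dsub m z (bumps (ins u L).2 w) ->
  dsub m z (if bump u L is Some b then b :: bumps (ins u L).2 w
    else bumps (ins u L).2 w).
  by case: (bump u L) => // b; apply: dsub_cons.
split=> m z; last first.
  case/orP => [/IHB/C//|/andP[uz /(IHA _ _ u0) h]].
  by apply: C; apply: dsub_le h.
case: m => [|m] z0; first by rewrite !dsub0.
case/orP=> [h|/andP[uz h]]; last first.
  have [b Eb bz] := bump_min dL z0 (ltnW uz); rewrite Eb /= ltnS bz /=.
  have ub: u < b.
    rewrite ltn_neqAle (bump_ge Eb) andbT; apply: contraNneq uL => ->.
    exact: row0_vals (bump_mem Eb).
  by apply/orP; right; apply: dsub_le (IHA _ _ u0 h).
have [Eb|nb] := eqVneq (bump u L) (Some z); last first.
  by apply/C/IHA => //; rewrite row0_ins // z0 nb orbT.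
by rewrite Eb /= ltnSn (IHB _ _ h) orbT.
Qed.

(* Conversely, either the letter that bumps [y] or a letter inserted between the
   bumps of [y] and [y'], where [y > y'], is below [y] and at least [y']. *)
Lemma bumps_dsub L w : desc L -> uniq w -> {in w, forall y, y \notin vals L} ->
  (forall m z, dsub m z.+1 (bumps L w) -> dsub m z w) /\
  (forall m y, y \notin row0 L -> dsub_from m y (bumps L w) -> dsub_from m.+1 y w).
Proof.
elim: w L => [|u w IH] L dL /=; first by move=> _ _; split=> [[]|].
move=> /andP[uw uqw] fr; have uL: u \notin vals L by apply: fr; rewrite mem_head.
have [IH1 IH2] := IH _ (desc_ins uL dL) uqw (fresh_ins uw fr).
split=> [m z|m y y0].
  case: m => [|m]; first by rewrite ?dsub0.
  case Eb: (bump u L) => [b|] => [|/IH1->//].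
  case/orP => [/IH1->//|/andP[]]; rewrite ltnS => bz.
  have ub: u < b.
    rewrite ltn_neqAle (bump_ge Eb) andbT; apply: contraNneq uL => ->.
    exact: row0_vals (bump_mem Eb).
  have uz := leq_trans ub bz.
  case: m => [|m] h; first by rewrite uz dsub0 orbT.
  have [y yb hy] := dsub_fromP _ _ _ h.
  have [yu|uy] := leqP y u.
    by rewrite uz (IH1 m.+1 u) ?orbT //; apply/dsub_fromP; exists y.
  apply/orP; left; apply/dsub_fromP; exists y; first exact: leq_trans yb bz.
  (* [y] lies strictly between [u] and [b], and [b] is the least entry of the first row that is at
     least [u]; hence [y] is not in that row. *)
  apply: IH2 => //; rewrite row0_ins // negb_or negb_and neq_ltn uy orbT /=.
  apply/orP; left; apply/negP => /(bump_min dL) /(_ (ltnW uy)).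
  by rewrite Eb => -[_ [<-]]; rewrite leqNgt yb.
have {}IH2 : dsub_from m y (bumps (ins u L).2 w) ->
  dsub_from m.+1 y w || (u == y) && dsub m.+1 y w.
  have [<- h|uy h] := eqVneq u y; last first.
    by rewrite IH2 // row0_ins // negb_or eq_sym uy (negbTE y0).
  apply/orP; right; rewrite /=; apply: IH1; apply/dsub_fromP; by exists u.
case Eb: (bump u L) => [b|] //= /orP[//|/andP[/eqP be _]].
by rewrite -be (bump_mem Eb) in y0.
Qed.

(** A displaced letter leaves the first row for good, because the letters still to be inserted are
    fresh. So the bumped word is again a legitimate word for the induction. *)
Lemma bumps_uniq L w : desc L -> uniq w -> {in w, forall y, y \notin vals L} ->
  uniq (bumps L w) /\ {subset bumps L w <= row0 L ++ w}.
Proof.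
elim: w L => [|u w IH] L dL /=; first by [].
move=> /andP[uw uqw] fr; have uL: u \notin vals L by apply: fr; rewrite mem_head.
have [IH1 IH2] := IH _ (desc_ins uL dL) uqw (fresh_ins uw fr).
have sub z : z \in bumps (ins u L).2 w -> z \in row0 L ++ u :: w.
  move/IH2; rewrite !mem_cat inE row0_ins //.
  by case: (z == u); case: (z \in row0 L); case: (z \in w); rewrite ?orbT ?andbT.
case Eb: (bump u L) => [b|] //=; have b0 := bump_mem Eb; split.
  rewrite IH1 andbT; apply: contraTN isT => /IH2.
  rewrite mem_cat row0_ins // Eb eqxx andbF orbF => /orP[/eqP bu|bw].
    by rewrite -bu (row0_vals b0) in uL.
  by have := fr b; rewrite inE bw orbT (row0_vals b0) => /(_ isT).
by move=> z; rewrite inE => /orP[/eqP->|/sub//]; rewrite mem_cat b0.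
Qed.

(* Schensted: the number of rows of the insertion tableau is the length of a
   longest decreasing subsequence, by comparing a word with the word of the
   letters that it bumps out of the first row. *)
Lemma schensted m z w : uniq w -> all (fun y => y < z) w ->
  has (fun c => m <= c.2) (insw [::] w) = dsub m.+1 z w.
Proof.
elim: m z w => [|m IH] z w uw /allP wz.
  have -> : has (fun c => 0 <= c.2) (insw [::] w) = (w != [::]).
    case: w {uw wz} => //= y w.
    have : y \in vals (insw (ins y [::]).2 w) by rewrite vals_insw inE eqxx orbT.
    by case: (insw _ _).
  apply/esym/idP; case: w {uw} wz => //= y w wz.
  by rewrite wz ?mem_head // dsub0 orbT.
have fr : {in w, forall y, y \notin vals [::]} by [].
have [B1 B2] := bumps_dsub (isT : desc [::]) uw fr.
have [_ D2] := dsub_bumps (isT : desc [::]) uw fr.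
have -> : has (fun c => m.+1 <= c.2) (insw [::] w) =
          has (fun c => m <= c.2) (lower (insw [::] w)).
  by elim: (insw [::] w) => //= -[v [|r]] M IHM; rewrite lower_cons /= IHM.
rewrite lower_insw //.
have [ub sb] := bumps_uniq (isT : desc [::]) uw fr.
have ab : all (fun y => y < z) (bumps [::] w) by apply/allP => y /sb/wz.
rewrite (IH z) //; apply/idP/idP; last exact: D2.
by case/dsub_fromP => y yz /B2 => /(_ isT) h; apply/dsub_fromP; exists y.
Qed.

(** * Walks of tableaux and arc sequences *)

(* The steps of a vacillating tableau at the vertex [i]: an optional deletion
   closes an arc [(y, i)], then an optional addition opens an arc at [i]. *)
Definition delete (r : nat) (L : tableau) := odflt (0, [::]) (del r L).

Definition closes (K : nat) (L : tableau) : seq (option nat * tableau) :=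
  (None, L) :: [seq (Some (delete r L).1, (delete r L).2)
               | r <- iota 0 K & cnt L r.+1 < cnt L r].

(* The bound [N] on the first row is never reached by the tableaux of the walks,
   whose entries are below [i < N]; it is the digit 0 of the shape codes. *)
Definition openable (N : nat) (L : tableau) (r : nat) : bool :=
  cnt L r < (if r is r'.+1 then cnt L r' else N).

Definition opens (K N i : nat) (L : tableau) : seq tableau :=
  L :: [seq (i, r) :: L | r <- iota 0 K & openable N L r].

Definition steps (K N i : nat) (L : tableau) : seq (option nat * tableau) :=
  [seq (c.1, M) | c <- closes K L, M <- opens K N i c.2].

(* The arcs of a partition, read at their closers: the [j]-th entry is the
   opener of the arc that ends in [j], if there is one. *)
Definition arcseq := seq (option nat).

Fixpoint walks (K N n i : nat) (L : tableau) : seq arcseq :=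
  if n is n'.+1 then
    [seq x.1 :: a | x <- steps K N i L, a <- walks K N n' i.+1 x.2]
  else if L is [::] then [:: [::]] else [::].

(* The openers below [i] of the arcs that close in [i] or later, by decreasing
   closers. *)
Fixpoint openers (i : nat) (a : arcseq) : seq nat :=
  if a is x :: a' then
    [seq y <- openers i.+1 a' | y < i] ++ (if x is Some y then [:: y] else [::])
  else [::].

Definition tab (i : nat) (a : arcseq) : tableau := insw [::] (openers i a).

Fixpoint wf (i : nat) (a : arcseq) : bool :=
  if a is x :: a' then
    wf i.+1 a' && (if x is Some y then (y < i) && (y \notin openers i.+1 a') else true)
  else true.

Definition height (K : nat) (L : tableau) := all (fun z : nat * nat => z.2 < K) L.

Fixpoint narrow (K i : nat) (a : arcseq) : bool :=
  height K (tab i a) && (if a is x :: a' then narrow K i.+1 a' else true).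

Definition legit (K i : nat) (L : tableau) :=
  [&& desc L, standard L, all (fun v => v < i) (vals L) & height K L].

Lemma perm_del b L y L1 : del b L = Some (y, L1) -> perm_eq (vals L) (y :: vals L1).
Proof.
elim: L b y L1 => [|[v r] L IH] //= b y L1.
have sw (u y' : nat) s t : perm_eq s (y' :: t) -> perm_eq (u :: s) [:: y', u & t].
  by move/permP => h; apply/permP => p /=; rewrite h /=; lia.
case: ifP => _.
  case: b => [[<- <-]//|b].
  by case E: (del b L) => [[u M]|] //= [<- <-] /=; apply/sw/(IH _ _ _ E).
by case E: (del b L) => [[u M]|] //= [<- <-] /=; apply/sw/(IH _ _ _ E).
Qed.

Lemma subseq_del b L y L1 : del b L = Some (y, L1) -> subseq (vals L1) (vals L).
Proof.
elim: L b y L1 => [|[v r] L IH] //= b y L1.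
case: ifP => _.
  case: b => [[_ <-]|b]; first exact: subseq_cons.
  by case E: (del b L) => [[u M]|] //= [_ <-] /=; rewrite eqxx (IH _ _ _ E).
by case E: (del b L) => [[u M]|] //= [_ <-] /=; rewrite eqxx (IH _ _ _ E).
Qed.

Lemma desc_uniq L : desc L -> uniq (vals L).
Proof.
by apply: sorted_uniq => [a b c /= h1 h2|a /=]; [apply: ltn_trans h2 h1|rewrite ltnn].
Qed.

Lemma desc_del b L y L1 : desc L -> del b L = Some (y, L1) ->
  desc L1 /\ y \notin vals L1.
Proof.
move=> dL E; split.
  apply: subseq_sorted (subseq_del E) dL.
  by move=> u v w /= h1 h2; apply: ltn_trans h2 h1.
by have := desc_uniq dL; rewrite (perm_uniq (perm_del E)) => /andP[].
Qed.

Lemma heightP K L : reflect (forall r, K <= r -> cnt L r = 0) (height K L).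
Proof.
apply: (iffP idP) => [|h].
  elim: L => [|[v r] L IH] //= /andP[rK /IH h] q Kq.
  by rewrite cnt_cons h //; lia.
elim: L h => [|[v r] L IH] //= h; apply/andP; split.
  by rewrite ltnNge; apply/negP => /h; rewrite cnt_cons eqxx.
by apply: IH => q /h; rewrite cnt_cons; lia.
Qed.

Lemma legit_del K i r L : legit K i L -> cnt L r.+1 < cnt L r ->
  exists y L1, [/\ del r L = Some (y, L1), y < i, y \notin vals L1 & legit K i L1].
Proof.
case/and4P => dL sL vL hL gr; have [y [L1 [E s1]]] := del_standard sL gr.
have [d1 yL1] := desc_del dL E; exists y, L1.
have pE := perm_all (fun v => v < i) (perm_del E).
move: vL; rewrite pE /= => /andP[yi vL1]; split=> //.
rewrite /legit d1 s1 vL1 /=; apply/heightP => q Kq.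
by have := heightP _ _ hL q Kq; rewrite (del_cnt q E); lia.
Qed.

Lemma cnt_size L r : cnt L r <= size L.
Proof. exact: count_size. Qed.

Lemma desc_size i L : desc L -> all (fun v => v < i) (vals L) -> size L <= i.
Proof.
move=> /desc_uniq uL /allP vL; rewrite -(size_map fst) -(size_iota 0 i).
by apply: uniq_leq_size => // v /vL; rewrite mem_iota.
Qed.

Lemma legit_below K i M : legit K i.+1 M ->
  legit K i (below i M) /\ (M = below i M \/ exists r, M = (i, r) :: below i M).
Proof.
case/and4P; case: M => [|[v r] M] //; first by move=> *; split; [|left].
rewrite desc_cons => /andP[/= aM dM] /andP[ar sM] /andP[vi _] /andP[rK hM].
rewrite ltnS leq_eqVlt in vi; case/orP: vi => [/eqP vi|vi].
  rewrite vi in aM *; rewrite /= ltnn below_id //; split; last by right; exists r.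
  by apply/and4P.
have aMi : all (fun u => u < i) (vals M).
  by apply: sub_all aM => u /ltn_trans; apply.
rewrite /= vi below_id //; split; last by left.
by rewrite /legit desc_cons /= aM dM ar sM vi aMi rK hM.
Qed.

Lemma opens_legit K N i L M : legit K i L -> i < N -> 
  (M \in opens K N i L) = legit K i.+1 M && (below i M == L).
Proof.
move=> lL iN; have /and4P[dL sL vL hL] := lL.
have vL' : all (fun v => v < i.+1) (vals L) by apply: sub_all vL => u /ltnW.
have szL : size L < N by apply: leq_ltn_trans iN; apply: desc_size.
apply/idP/andP.
  rewrite inE => /orP[/eqP->|]; first by rewrite /legit below_id // dL sL vL' hL.
  case/mapP => r; rewrite mem_filter mem_iota add0n /= => /andP[op rK] ->.
  rewrite /= ltnn below_id // eqxx; split=> //.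
  rewrite /legit desc_cons /= vL dL sL vL' rK hL ltnSn !andbT.
  by move: op; rewrite /openable /addable; case: r {rK}.
case=> lM /eqP bM; case: (legit_below lM) => _; rewrite bM => -[->|[r E]].
  exact: mem_head.
move: lM; rewrite E => /and4P[_ /andP[/= ar _] _ /andP[/= rK _]].
rewrite inE; apply/orP; right; apply/mapP; exists r => //.
rewrite mem_filter mem_iota rK !andbT /openable; case: r ar {rK E} => [_|r] //.
exact: leq_ltn_trans (cnt_size _ _) szL.
Qed.

Definition closed_by (y : option nat) (L1 : tableau) : tableau :=
  if y is Some y then (ins y L1).2 else L1.

Definition closable (i : nat) (y : option nat) (L1 : tableau) : bool :=
  if y is Some y then (y < i) && (y \notin vals L1) else true.

Lemma closes_spec K i L x L1 : legit K i L ->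
  reflect [/\ legit K i L1, closable i x L1 & closed_by x L1 = L]
    ((x, L1) \in closes K L).
Proof.
move=> lL; have /and4P[dL sL vL hL] := lL; rewrite /closes in_cons.
apply: (iffP idP) => [/orP[/eqP[-> ->]//|]|].
  case/mapP => r; rewrite mem_filter => /andP[gr _] [-> ->].
  have [y [M [E yi yM lM]]] := legit_del lL gr.
  by rewrite /delete E /=; split; rewrite // ?yi // (delK dL E).
case; case: x => [y|] lL1 /=; last by move=> _ ->; rewrite eqxx.
case/andP => yi yL1 EL; apply/mapP.
exists (ins y L1).1; last by rewrite /delete -EL insK.
have /and4P[_ s1 _ _] := lL1.
have c1 := cnt_ins y L1 (ins y L1).1.
have c2 := cnt_ins y L1 (ins y L1).1.+1.
have c3 := standard_cnt (ins y L1).1 s1.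
rewrite EL in c1 c2; rewrite mem_filter mem_iota /= add0n; apply/andP; split; first lia.
rewrite ltnNge; apply/negP => /(heightP _ _ hL); lia.
Qed.

(** Read backwards, a step is deterministic: [L] is a function of [x] and [M], by the very formula
    of [tab_cons]. Both facts rest on [del] being the inverse of [ins]. *)
Lemma steps_spec K N i L x M : legit K i L -> i < N ->
  reflect [/\ legit K i.+1 M, closable i x (below i M) & closed_by x (below i M) = L]
    ((x, M) \in steps K N i L).
Proof.
move=> lL iN; apply: (iffP idP) => [|[lM cx EL]].
  case/allpairsPdep => -[x' L1] [M' [/= hc ho [-> ->]]].
  have [l1 c1 E1] := closes_spec _ _ lL hc.
  by move: ho; rewrite (opens_legit _ l1 iN) => /andP[lM' /eqP->].
have [lb _] := legit_below lM.
apply/allpairsPdep; exists (x, below i M), M; split=> //.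
  by apply/(closes_spec _ _ lL).
by rewrite (opens_legit _ lb iN) lM eqxx.
Qed.

Lemma closes_uniq K i L : legit K i L -> uniq (closes K L).
Proof.
move=> lL; have /and4P[dL _ _ _] := lL; rewrite /= map_inj_in_uniq.
  by rewrite filter_uniq ?iota_uniq // andbT; apply/mapP => -[].
move=> r r'; rewrite !mem_filter => /andP[/(legit_del lL)[y [M [E _ _ _]]] _].
case/andP => /(legit_del lL)[y' [M' [E' _ _ _]]] _; rewrite /delete E E' => -[/= yy MM].
by have := delK dL E; rewrite yy MM (delK dL E') => -[].
Qed.

Lemma opens_uniq K N i L : uniq (opens K N i L).
Proof.
rewrite /= map_inj_uniq; last by move=> r r' [].
rewrite filter_uniq ?iota_uniq // andbT; apply/mapP => -[r _ /(congr1 size)] /=.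
lia.
Qed.

Lemma steps_uniq K N i L : legit K i L -> i < N -> uniq (steps K N i L).
Proof.
move=> lL iN; apply: allpairs_uniq_dep; first exact: closes_uniq lL.
  by move=> c _; apply: opens_uniq.
move=> u v hu hv; case/allpairsPdep: hu => -[x L1] [M [/= hc ho ->]].
case/allpairsPdep: hv => -[x' L1'] [M' [/= hc' ho' ->]].
move=> [/= xx MM]; rewrite -{}xx -{}MM in hc' ho' *.
have [l1 _ _] := closes_spec _ _ lL hc.
have [l1' _ _] := closes_spec _ _ lL hc'.
move: ho ho'; rewrite !opens_legit // => /andP[_ /eqP b] /andP[_ /eqP b'].
by rewrite -b' -b.
Qed.

Lemma wf_openers i a : wf i a ->
  uniq (openers i a) && all (fun y => y < i) (openers i a).
Proof.
elim: a i => [|x a IH] i //= /andP[/IH/andP[u1 /allP a1]].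
case: x => [y|] => [/andP[yi yn]|_]; last first.
  by rewrite cats0 filter_uniq //= filter_all.
rewrite cats1 rcons_uniq mem_filter yi yn filter_uniq //= all_rcons yi.
by rewrite filter_all.
Qed.

Lemma vals_tab i a : vals (tab i a) =i openers i a.
Proof. by move=> z; rewrite vals_insw orbF. Qed.

Lemma desc_tab i a : wf i a -> desc (tab i a).
Proof. by case/wf_openers/andP => u _; apply: desc_insw. Qed.

Lemma tab_cons i x a : wf i.+1 a ->
  tab i (x :: a) = closed_by x (below i (tab i.+1 a)).
Proof.
move=> /wf_openers/andP[u _]; rewrite /tab /= insw_cat -below_insw //.
by case: x.
Qed.

Lemma wf_cons i x a : wf i (x :: a) = wf i.+1 a && closable i x (below i (tab i.+1 a)).
Proof.
rewrite /=; case: (wf i.+1 a) => //=; case: x => // y /=.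
case: ltnP => //= yi; congr (~~ _).
rewrite -vals_tab; apply/mapP/mapP => -[z].
  by move=> h E; exists z => //; rewrite mem_filter h -E yi.
by rewrite mem_filter => /andP[_ h] ->; exists z.
Qed.

Lemma legit_tab K i a : wf i a -> height K (tab i a) -> legit K i (tab i a).
Proof.
move=> w h; rewrite /legit desc_tab // h standard_insw //= andbT.
have /andP[_ /allP al] := wf_openers w.
by apply/allP => v; rewrite vals_tab => /al.
Qed.

(** By [steps_spec] and [tab_cons], the step relation and the recursion of [tab] agree, so the
    tableaux along a walk that records [a] are forced to be those of [a]. *)
Lemma mem_walks K N n i L a : legit K i L -> i + n <= N ->
  (a \in walks K N n i L) =
  [&& size a == n, wf i a, narrow K i a & tab i a == L].
Proof.
elim: n i L a => [|n IH] i L a lL iN.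
  case: a => [|x a] //=; last by case: L lL.
  by case: L {lL}.
have iN' : i < N by lia.
have iN'' : i.+1 + n <= N by lia.
apply/allpairsPdep/and4P.
  case=> -[x M] [a' [hs ha ->]] /=.
  have [lM cx EL] := steps_spec _ _ lL iN' hs.
  move: ha; rewrite /= IH // => /and4P[sa wa na /eqP Ea].
  rewrite -[_ && _]/(wf i (x :: a')) wf_cons tab_cons // Ea EL na cx wa.
  by have /and4P[_ _ _ ->] := lL.
case; case: a => [|x a] //=; rewrite eqSS => sa.
rewrite -[_ && _]/(wf i (x :: a)) wf_cons => /andP[wa cx] /andP[h na] /eqP EL.
rewrite tab_cons // in EL.
have lM : legit K i.+1 (tab i.+1 a).
  by apply: legit_tab => //; move: na; case: (a) => [|? ?] //= /andP[].
exists (x, tab i.+1 a), a; split=> //; first exact/steps_spec.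
by rewrite IH // sa wa na eqxx.
Qed.

(** Two walks with the same record coincide, since the tableau after the first step is [tab i.+1] of
    the rest of the record. *)
Lemma walks_uniq K N n i L : legit K i L -> i + n <= N -> uniq (walks K N n i L).
Proof.
elim: n i L => [|n IH] i L lL iN; first by case: L {lL}.
have iN' : i < N by lia.
have iN'' : i.+1 + n <= N by lia.
apply: allpairs_uniq_dep; first exact: steps_uniq.
  move=> [x M] /(steps_spec _ _ lL iN')[lM _ _]; exact: IH.
move=> u v hu hv; case/allpairsPdep: hu => -[x M] [a [/= hs ha ->]].
case/allpairsPdep: hv => -[x' M'] [a' [/= hs' ha' ->]].
move=> [/= xx aa]; rewrite -{}xx -{}aa in hs' ha' *.
have [lM _ _] := steps_spec _ _ lL iN' hs.
have [lM' _ _] := steps_spec _ _ lL iN' hs'.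
move: ha ha'; rewrite !mem_walks //= => /and4P[_ _ _ /eqP<-] /and4P[_ _ _ /eqP E].
by rewrite E.
Qed.

(** * Set partitions and arc sequences *)

Lemma dsubP m z w :
  reflect (exists s, [/\ subseq s w, path gtn z s & size s = m]) (dsub m z w).
Proof.
apply: (iffP idP) => [|[s []]].
  elim: w m z => [|u w IH] m z /=; first by move/eqP->; exists [::].
  case: m => [|m]; first by exists [::].
  case/orP => [/IH[s [h1 h2 h3]]|/andP[uz /IH[s [h1 h2 h3]]]].
    by exists s; split=> //; apply: subseq_trans h1 (subseq_cons _ _).
  by exists (u :: s); rewrite /= eqxx h1 uz h2 h3.
elim: w m z s => [|u w IH] m z [|v s] //=; first by move=> _ _ <-.
  by move=> _ _ <-.
case: ifP => [/eqP-> h1 /andP[uz h2] <-|_ h1 h2 <-].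
  by apply/orP; right; apply/andP; split=> //; apply: (IH _ _ s).
by apply/orP; left; apply: (IH _ _ (v :: s)).
Qed.

(** Reversal lists the openers by increasing closers. A subsequence is then a choice of arcs open
    just before vertex [i], kept in [t] as pairs (opener, closer). *)
Lemma subseq_openers i a s : wf i a ->
  subseq s (rev (openers i a)) <->
  exists t : seq (nat * nat), [/\ [seq z.1 | z <- t] = s,
    sorted ltn [seq z.2 | z <- t] &
    all (fun z => [&& z.1 < i, i <= z.2 & nth None a (z.2 - i) == Some z.1]) t].
Proof.
elim: a i s => [|x a IH] i s /=.
  move=> _; split; first by case: s => // _; exists [::].
  by case=> -[|[u v] t] [<- //= _]; rewrite nth_nil !andbF.
case/andP => wa xy.
have shift (t : seq (nat * nat)) : all (fun z => i < z.2) t ->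
  all (fun z => [&& z.1 < i, i <= z.2 & nth None (x :: a) (z.2 - i) == Some z.1]) t
  = all (fun z => z.1 < i) t &&
    all (fun z => [&& z.1 < i.+1, i < z.2 & nth None a (z.2 - i.+1) == Some z.1]) t.
  move=> h; rewrite -all_predI; apply: eq_in_all => z /(allP h) /= iz.
  have -> : z.2 - i = (z.2 - i.+1).+1 by rewrite subnS prednK // subn_gt0.
  by rewrite /= iz (ltnW iz); case: (ltnP z.1 i) => //= zi; rewrite ltnS (ltnW zi).
have tailsub s' : subseq s' [seq y <- rev (openers i.+1 a) | y < i] <->
  exists t : seq (nat * nat), [/\ [seq z.1 | z <- t] = s', sorted ltn [seq z.2 | z <- t],
    all (fun z => i < z.2) t & all (fun z =>
      [&& z.1 < i, i <= z.2 & nth None (x :: a) (z.2 - i) == Some z.1]) t].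
  rewrite subseq_filter; split.
    case/andP => al /(IH _ _ wa)[t [E st at_]]; exists t; split=> //.
      by apply: sub_all at_ => z /and3P[].
    rewrite shift; last by apply: sub_all at_ => z /and3P[].
    by rewrite at_ andbT; move: al; rewrite -E all_map.
  case=> t [E st it]; rewrite shift // => /andP[a1 a2].
  by rewrite -E all_map a1 /=; apply/(IH _ _ wa); exists t.
rewrite rev_cat filter_rev in tailsub *.
split.
  (* Either the choice starts with the arc that closes in [i], or it comes from arcs that close
     later. *)
  move=> h; have : (exists2 y, x = Some y & exists2 s', s = y :: s' &
     subseq s' (rev [seq y <- openers i.+1 a | y < i])) \/
     subseq s (rev [seq y <- openers i.+1 a | y < i]).
    case: x h {xy shift tailsub} => [y|]; last by right.
    case: s => [|u s] /=; first by right; apply: sub0seq.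
    case: ifP => [/eqP-> h|_]; last by right.
    by left; exists y => //; exists s.
  case=> [[y Ex [s' -> /tailsub[t [E st it at_]]]]|/tailsub[t [E st it at_]]].
    exists ((y, i) :: t); rewrite /= E at_ leqnn subnn Ex eqxx /=.
    rewrite path_sortedE ?st; last exact: ltn_trans.
    by rewrite all_map it; move: xy; rewrite Ex => /andP[->].
  by exists t.
case=> -[|[u j] t] [<- st at_]; first exact: sub0seq.
move: (st) (at_) => /=; rewrite path_sortedE; last exact: ltn_trans.
case/andP; rewrite all_map => jt st' /andP[/and3P[ui ij /eqP nu] at'].
have it : all (fun z => i < z.2) t by apply: sub_all jt => z /=; apply: leq_ltn_trans.
have [ij'|] := ltnP i j.
  apply: subseq_trans (suffix_subseq _ _).
  by apply/(tailsub (u :: _)); exists ((u, j) :: t); rewrite /= ij' it.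
move=> ji; have Ej : j = i by lia.
move: nu; rewrite Ej subnn /= => ->; rewrite /= eqxx.
by apply/tailsub; exists t.
Qed.

Lemma narrowP K i a :
  narrow K i a <-> forall j, height K (tab (i + j) (drop j a)).
Proof.
elim: a i => [|x a IH] i /=; first by split=> // _ [|j].
split=> [/andP[h /IH ha] [|j]|h]; first by rewrite addn0.
  by rewrite addnS -addSn; apply: ha.
have := h 0; rewrite addn0 /= => ->; apply/IH => j.
by have := h j.+1; rewrite addnS -addSn.
Qed.

Lemma mem_openers i a y : wf i a -> (y \in openers i a) = (y < i) && (Some y \in a).
Proof.
elim: a i => [|x a IH] i /=; first by rewrite andbF.
case/andP => wa xy; rewrite mem_cat mem_filter IH // inE.
case: x xy => [z /andP[zi _]|_] /=; rewrite ?inE ?orbF; last lia.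
have -> : (Some y == Some z) = (y == z) by [].
case: eqP => [->|_]; rewrite ?orbT ?zi //=; lia.
Qed.

Lemma wfP i a : wf i a <->
  (forall j y, nth None a j = Some y -> y < i + j) /\
  (forall j j' y, nth None a j = Some y -> nth None a j' = Some y -> j = j').
Proof.
elim: a i => [|x a IH] i /=.
  by split=> // _; split=> [j y|j j' y]; rewrite nth_nil.
split=> [/andP[wa xy]|[h1 h2]].
  have [h1 h2] := (IH _).1 wa.
  have xa y : x = Some y -> Some y \notin a.
    move=> E; move: xy; rewrite E => /andP[yi]; rewrite mem_openers //.
    by rewrite (ltnW yi : y < i.+1).
  have abs j y : x = Some y -> nth None a j = Some y -> False.
    move=> /xa /negP h E; apply: h; rewrite -E; apply: mem_nth.
    by rewrite ltnNge; apply/negP => /(nth_default None); rewrite E.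
  split=> [[|j] y /=|[|j] [|j'] y //=].
  - by move=> E; move: xy; rewrite E addn0 => /andP[].
  - by move/h1; rewrite addSnnS.
  - by move=> E /(abs _ _ E).
  - by move=> E E'; case: (abs _ _ E' E).
  - by move=> E /(h2 _ _ _ E)->.
have wa : wf i.+1 a.
  apply/IH; split=> [j y E|j j' y E E'].
    by rewrite addSnnS; apply: h1.
  by have [] := h2 j.+1 j'.+1 y E E'.
rewrite wa; case: x h1 h2 => [y|] //= h1 h2.
have yi : y < i by have := h1 0 y erefl; rewrite addn0.
rewrite yi mem_openers // negb_and; apply/orP; right.
by apply/negP => /nthP-/(_ None)[j _ E]; have := h2 0 j.+1 y erefl E.
Qed.

(** On a well-formed sequence the label of a vertex is the least element of its block, so it is
    final as soon as the vertex is reached. *)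
Definition relabel (l : seq nat) (x : option nat) : seq nat :=
  rcons l (if x is Some y then nth 0 l y else size l).

Definition labels (a : arcseq) : seq nat := foldl relabel [::] a.

Definition label_partition (N : nat) (l : seq nat) : {set {set 'I_N}} :=
  preim_partition (fun i : 'I_N => nth 0 l i) [set: 'I_N].

Lemma labels_rcons a x : labels (rcons a x) = relabel (labels a) x.
Proof. by rewrite /labels foldl_rcons. Qed.

Lemma size_labels a : size (labels a) = size a.
Proof.
by elim/last_ind: a => // a x IH; rewrite labels_rcons !size_rcons IH.
Qed.

Lemma nth_labels a j : (forall j y, nth None a j = Some y -> y < j) -> j < size a ->
  nth 0 (labels a) j = if nth None a j is Some y then nth 0 (labels a) y else j.
Proof.
elim/last_ind: a => // a x IH h; rewrite size_rcons ltnS => js.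
have h' j' y : nth None a j' = Some y -> y < j'.
  move=> E; apply: h; rewrite nth_rcons; case: ltnP => // js'.
  by move: E; rewrite nth_default.
rewrite labels_rcons /relabel !nth_rcons size_labels.
case: ltngtP js => [js _|//|Ej _].
  rewrite IH //; case E: (nth None a j) => [y|] //.
  by rewrite nth_rcons size_labels (ltn_trans (h' _ _ E) js).
case: x h {IH} => [y|] h //.
have ys : y < size a by apply: h; rewrite nth_rcons ltnn eqxx.
by rewrite nth_rcons size_labels ys.
Qed.

Lemma arc_pblock N (P : {set {set 'I_N}}) (i j : 'I_N) : partition P [set: 'I_N] ->
  arc P i j = [&& j \in pblock P i, i < j &
                  [forall l in pblock P i, ~~ ((i < l) && (l < j))]].
Proof.
case/and3P => /eqP cP tP _; apply/existsP/idP.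
  by case=> B /and5P[BP iB jB ij h]; rewrite (def_pblock tP BP iB) jB ij h.
case/and3P => jB ij h; exists (pblock P i).
have iP : i \in cover P by rewrite cP inE.
by rewrite pblock_mem // mem_pblock iP jB ij h.
Qed.

Lemma pblock_label N l (i j : 'I_N) :
  (j \in pblock (label_partition N l) i) = (nth 0 l i == nth 0 l j).
Proof.
rewrite pblock_equivalence_partition ?inE // => x y z _ _ _; split=> //.
by move/eqP->.
Qed.

Lemma label_partitionP N l : partition (label_partition N l) [set: 'I_N].
Proof. exact: preim_partitionP. Qed.

Lemma label_le a j : (forall j y, nth None a j = Some y -> y < j) -> j < size a ->
  nth 0 (labels a) j <= j.
Proof.
move=> h; elim/ltn_ind: j => j IH ja; rewrite nth_labels //.
case E: (nth None a j) => [y|] //; have yj := h _ _ E.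
by apply: leq_trans (ltnW yj); apply: IH => //; apply: ltn_trans yj ja.
Qed.

(** Strong induction on [j], comparing [y] with the opener [u] of the arc into [j]. If [y < u], the
    claim for [u] suffices; if [u < y], the induction would give [u] a second arc. If no arc ends in
    [j], its label is [j] itself, which exceeds the label of [y]. *)
Lemma label_chain a j y : wf 0 a -> j < size a -> y < j ->
  nth 0 (labels a) y = nth 0 (labels a) j ->
  exists z, [/\ y < z, z <= j & nth None a z = Some y].
Proof.
move=> /wfP[h inj]; elim/ltn_ind: j y => j IH y ja yj Ey.
have ya := ltn_trans yj ja.
have := nth_labels h ja; case E: (nth None a j) => [u|] Eu.
  have uj := h _ _ E; have ua := ltn_trans uj ja.
  case: (ltngtP u y) => [uy|yu|uy].
  - have [|z [uz zy Ez]] := IH y yj u ya uy; first by rewrite Ey Eu.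
    by have := inj _ _ _ E Ez; lia.
  - have [|z [uz zy Ez]] := IH u uj y ua yu; first by rewrite Ey Eu.
    by exists z; split=> //; lia.
  - by exists j; rewrite -uy.
by have := label_le h ya; lia.
Qed.

Lemma arc_label N a (i j : 'I_N) : size a = N -> wf 0 a ->
  arc (label_partition N (labels a)) i j = (nth None a j == Some (val i)).
Proof.
move=> sa; case: N / sa i j => i j w; have [h inj] := (wfP _ _).1 w.
rewrite arc_pblock; last exact: label_partitionP.
rewrite pblock_label; apply/and3P/eqP.
  case=> /eqP Eij ij /forall_inP nb.
  have [z [iz zj Ez]] := label_chain w (ltn_ord j) ij Eij.
  have za : z < size a by apply: leq_ltn_trans zj (ltn_ord j).
  have := nb (Ordinal za); rewrite pblock_label /= (nth_labels h za) Ez eqxx iz /= => /(_ isT).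
  by rewrite -leqNgt => jz; have -> : val j = z by apply/eqP; rewrite eqn_leq jz zj.
move=> E; have ij := h _ _ E; split=> //; first by rewrite (nth_labels h (ltn_ord j)) E.
apply/forall_inP => l; rewrite pblock_label => /eqP El; apply/negP => /andP[il lj].
have [z [iz zl Ez]] := label_chain w (ltn_ord l) il El.
have := inj _ _ _ E Ez => jz; move: zl; rewrite -jz leqNgt lj //.
Qed.

Definition arcs_of (N : nat) (P : {set {set 'I_N}}) : arcseq :=
  [seq omap val [pick i | arc P i j] | j <- enum 'I_N].

Lemma size_arcs_of N (P : {set {set 'I_N}}) : size (arcs_of P) = N.
Proof. by rewrite size_map size_enum_ord. Qed.

Lemma arc_ltn N (P : {set {set 'I_N}}) (i j : 'I_N) : arc P i j -> i < j.
Proof. by case/existsP => B /and5P[]. Qed.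

Lemma arc_injr N (P : {set {set 'I_N}}) (i j j' : 'I_N) : partition P [set: 'I_N] ->
  arc P i j -> arc P i j' -> j = j'.
Proof.
move=> pP; rewrite !arc_pblock // => /and3P[jB ij /forall_inP h].
case/and3P => jB' ij' /forall_inP h'.
have := h _ jB'; have := h' _ jB; rewrite ij ij' /= -!leqNgt => h1 h2.
by apply/val_inj/eqP; rewrite /= eqn_leq h1 h2.
Qed.

Lemma arc_injl N (P : {set {set 'I_N}}) (i i' j : 'I_N) : partition P [set: 'I_N] ->
  arc P i j -> arc P i' j -> i = i'.
Proof.
move=> pP; have /and3P[/eqP cP tP _] := pP.
have jc (x : 'I_N) : x \in cover P by rewrite cP inE.
rewrite !arc_pblock // => /and3P[jB ij /forall_inP h].
case/and3P => jB' ij' /forall_inP h'.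
have E := same_pblock tP jB; have E' := same_pblock tP jB'.
have iB' : i \in pblock P i' by rewrite -E' E mem_pblock.
have i'B : i' \in pblock P i by rewrite -E E' mem_pblock.
have := h _ i'B; have := h' _ iB'; rewrite ij ij' /= !andbT -!leqNgt => h1 h2.
by apply/val_inj/eqP; rewrite /= eqn_leq h1 h2.
Qed.

Lemma nth_arcs_of N (P : {set {set 'I_N}}) (i j : 'I_N) : partition P [set: 'I_N] ->
  (nth None (arcs_of P) j == Some (val i)) = arc P i j.
Proof.
move=> pP; rewrite (nth_map j) ?size_enum_ord // nth_ord_enum.
case: pickP => [x ax|na] /=; last by rewrite na.
apply/eqP/idP => [[/val_inj<-]//|ai].
by rewrite (arc_injl pP ax ai).
Qed.

Lemma nth_arcs_ofP N (P : {set {set 'I_N}}) j y : partition P [set: 'I_N] ->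
  nth None (arcs_of P) j = Some y ->
  exists (i' j' : 'I_N), [/\ j = j', y = i' & arc P i' j'].
Proof.
move=> pP E.
have jN : j < N.
  by rewrite ltnNge; apply/negP => h; move: E; rewrite nth_default // size_arcs_of.
move: (E); rewrite (nth_map (Ordinal jN)) ?size_enum_ord //.
case: pickP => [x ax|na] //= [Ex]; exists x, (Ordinal jN); split=> //.
by rewrite -(nth_arcs_of _ _ pP) /= E Ex.
Qed.

Lemma wf_arcs_of N (P : {set {set 'I_N}}) : partition P [set: 'I_N] -> wf 0 (arcs_of P).
Proof.
move=> pP; apply/wfP; split=> [j y|j j' y].
  by case/(nth_arcs_ofP pP) => x [z [-> -> /arc_ltn]].
case/(nth_arcs_ofP pP) => x [z [-> -> axz]] /(nth_arcs_ofP pP)[x' [z' [-> /val_inj E]]].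
by rewrite -E => /(arc_injr pP axz) ->.
Qed.

Lemma label_arcs_of N (P : {set {set 'I_N}}) : partition P [set: 'I_N] ->
  label_partition N (labels (arcs_of P)) = P.
Proof.
move=> pP; have /and3P[/eqP cP tP _] := pP.
have cov (x : 'I_N) : x \in cover P by rewrite cP inE.
set l := labels _.
have [h inj] := (wfP _ _).1 (wf_arcs_of pP).
have sa := size_arcs_of P.
have nl (j : 'I_N) := nth_labels h (etrans (congr1 _ sa) (ltn_ord j)).
(* The label of a vertex is a member of its block: follow the arc into the vertex backwards.
   Vertices with equal labels therefore share a block. *)
have root (j : 'I_N) : exists2 m : 'I_N, nth 0 l j = m & m \in pblock P j.
  case: j => j jN; elim/ltn_ind: j jN => j IH jN.
  rewrite nl /=; case E: (nth None (arcs_of P) j) => [y|].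
    have [x [z [Ej Ey axz]]] := nth_arcs_ofP pP E.
    have [m Em mx] := IH y (h _ _ E) (ltn_trans (h _ _ E) jN).
    exists m => //; move: axz; rewrite arc_pblock // => /and3P[xz _ _].
    have -> : Ordinal jN = z by apply: val_inj.
    rewrite (same_pblock tP xz); congr (_ \in pblock P _): mx.
    by apply: val_inj.
  by exists (Ordinal jN); rewrite // mem_pblock.
rewrite -[RHS](equivalence_partition_pblock pP).
apply: eq_in_imset => x _; apply/setP => y; rewrite !inE /=.
have step (i j : 'I_N) : i \in pblock P j -> i <= j -> nth 0 l i = nth 0 l j.
  case: j => j jN; elim/ltn_ind: j jN => j IH jN ij /=.
  rewrite leq_eqVlt => /orP[/eqP<-//|lij].
  pose Q (y : 'I_N) := (y \in pblock P (Ordinal jN)) && (y < j).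
  have Qi : Q i by rewrite /Q ij lij.
  (* The largest element of the block below [j] is joined to [j] by an arc and passes its label
     on. *)
  have [m /andP[mj lmj] mmax] := arg_maxnP (fun y : 'I_N => val y) Qi.
  have am : arc P m (Ordinal jN).
    rewrite arc_pblock // (same_pblock tP mj) mem_pblock cov lmj /=.
    apply/forall_inP => u uj; apply/negP => /andP[mu ul].
    have /mmax : Q u by rewrite /Q uj ul.
    by rewrite /= leqNgt mu.
  rewrite (nl (Ordinal jN)) /=.
  have := nth_arcs_of m (Ordinal jN) pP; rewrite am => /eqP->.
  case: m mj lmj mmax am => m mN /= mj lmj mmax _.
  by apply: (IH m lmj mN) (mmax i Qi); rewrite (same_pblock tP mj).
apply/eqP/idP => [E|yx].
  have [m Em mx] := root x; have [m' Em' my] := root y.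
  have Em2 : m = m' by apply: val_inj; rewrite /= -Em -Em'.
  rewrite Em2 in mx; rewrite -(same_pblock tP mx) (same_pblock tP my) mem_pblock //.
have xy : x \in pblock P y by rewrite (same_pblock tP yx) mem_pblock.
case: (leqP x y) => [|/ltnW] le; first exact: step.
by apply/esym/step.
Qed.

Lemma height_dsub K i a : wf i a ->
  height K (tab i a) = ~~ dsub K.+1 i (openers i a).
Proof.
case/wf_openers/andP => u al; rewrite -schensted // -all_predC.
by apply: eq_all => z /=; rewrite ltnNge.
Qed.

Lemma wf_drop a j : wf 0 a -> wf j (drop j a).
Proof.
move=> /wfP[h inj]; apply/wfP; split=> [m y|m m' y]; rewrite !nth_drop; first exact: h.
by move=> E /(inj _ _ _ E)/addnI.
Qed.

(** Among arcs open at a common position, a crossing is a choice whose openers increase with the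
    closers. In the word [openers], sorted by decreasing closers, this is a decreasing subsequence,
    which [height_dsub] turns into a tall tableau. *)
Lemma noncrossing_narrow K N a (P : {set {set 'I_N.+1}}) :
  size a = N.+1 -> wf 0 a ->
  (forall i j : 'I_N.+1, arc P i j = (nth None a j == Some (val i))) ->
  noncrossing K.+1 P = narrow K 0 a.
Proof.
move=> sa wa aE; apply/idP/idP => [/existsPn nc|/narrowP h].
  apply/narrowP => j; rewrite add0n (height_dsub _ (wf_drop j wa)).
  apply/negP => /dsubP[s [sub ps sz]].
  have : subseq (rev s) (rev (openers j (drop j a))) by rewrite subseq_rev.
  case/(subseq_openers _ (wf_drop j wa)) => t [E st /allP at_].
  have sizet : size t == K.+1 by rewrite -(size_map fst) E size_rev sz.
  have f_size : size [seq ((inord z.1 : 'I_N.+1), (inord z.2 : 'I_N.+1)) | z <- t] == K.+1.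
    by rewrite size_map.
  have bound z : z \in t -> [/\ z.1 < j, j <= z.2, z.2 < N.+1 & nth None a z.2 = Some z.1].
    move/at_ => /and3P[z1 z2 /eqP]; rewrite nth_drop subnKC // => Ez; split=> //.
    by rewrite -sa ltnNge; apply/negP => /(nth_default None); rewrite Ez.
  case/negP: (nc (Tuple f_size)); apply/andP; split.
    rewrite /= all_map; apply/allP => z zt; have [z1 z2 zN Ez] := bound z zt.
    rewrite /= aE /= !inordK ?Ez //; apply: leq_ltn_trans zN; exact: leq_trans (ltnW z1) z2.
  rewrite /= -!map_comp.
  have -> : [seq ((fun b => val b.1) \o
     (fun z => ((inord z.1 : 'I_N.+1), (inord z.2 : 'I_N.+1)))) z | z <- t] = [seq z.1 | z <- t].
    apply/eq_in_map => z zt /=; have [z1 z2 zN _] := bound z zt.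
    by rewrite inordK //; apply: leq_ltn_trans zN; exact: leq_trans (ltnW z1) z2.
  have -> : [seq ((fun b => val b.2) \o
     (fun z => ((inord z.1 : 'I_N.+1), (inord z.2 : 'I_N.+1)))) z | z <- t] = [seq z.2 | z <- t].
    by apply/eq_in_map => z zt /=; have [_ _ zN _] := bound z zt; rewrite inordK.
  rewrite sorted_pairwise ?pairwise_cat -?sorted_pairwise; try exact: ltn_trans.
  rewrite st andbT; apply/andP; split.
    apply/allrelP => _ _ /mapP[z zt ->] /mapP[z' zt' ->].
    have [z1 _ _ _] := bound z zt; have [_ z2 _ _] := bound z' zt'.
    exact: leq_trans z1 z2.
  by rewrite E rev_sorted; apply: path_sorted ps.
apply/existsPn => t; apply/negP => /andP[/allP at_].
rewrite sorted_pairwise ?pairwise_cat -?sorted_pairwise; try exact: ltn_trans.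
case/and3P => /allrelP rel s1 s2.
have sizet := size_tuple t.
case Et: (tval t) => [|z0 t']; first by rewrite /= in sizet; rewrite Et in sizet.
(* The first closer of the crossing: every opener is below it and every closer is at least it, so
   all arcs of the crossing are open there. *)
pose j := val z0.2.
have := h j; rewrite add0n (height_dsub _ (wf_drop j wa)) => /negP; apply.
pose p (z : 'I_N.+1 * 'I_N.+1) := (val z.1, val z.2).
apply/dsubP; exists (rev [seq z.1 | z <- map p t]).
have jle z : z \in tval t -> j <= z.2.
  move: s2; rewrite Et /= path_sortedE; last exact: ltn_trans.
  case/andP => /allP al _; rewrite inE => /orP[/eqP->//|zt]; apply: ltnW; apply: al.
  exact: (map_f (fun a : 'I_N.+1 * 'I_N.+1 => nat_of_ord a.2)).
have jgt z : z \in tval t -> z.1 < j.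
  move=> zt; apply: (rel z.1 j); first exact: (map_f (fun a : 'I_N.+1 * 'I_N.+1 => nat_of_ord a.1)).
  by apply: (map_f (fun a : 'I_N.+1 * 'I_N.+1 => nat_of_ord a.2)); rewrite Et mem_head.
split; last by rewrite size_rev !size_map.
  rewrite -subseq_rev revK; apply/(subseq_openers _ (wf_drop j wa)).
  exists (map p t); split=> //; first by rewrite -map_comp.
  rewrite all_map; apply/allP => z zt /=; rewrite jgt // jle //= nth_drop subnKC ?jle //.
  by have := at_ z zt; rewrite aE.
rewrite path_sortedE; last by move=> x y z /= h1 h2; apply: ltn_trans h2 h1.
rewrite rev_sorted all_rev -map_comp s1 andbT all_map.
by apply/allP => z zt /=; apply: jgt.
Qed.

Section Walks.
Variables K N : nat.

Lemma legit0 : legit K 0 [::]. Proof. by []. Qed.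

Lemma tab0 a : wf 0 a -> tab 0 a = [::].
Proof.
case/wf_openers/andP => _ /allP h; rewrite /tab.
by case: (openers 0 a) h => // y w /(_ y (mem_head _ _)).
Qed.

Lemma mem_walks0 a : (a \in walks K N.+1 N.+1 0 [::]) =
  [&& size a == N.+1, wf 0 a & narrow K 0 a].
Proof.
rewrite mem_walks ?legit0 //; case wa: (wf 0 a) => //=.
by rewrite tab0 // eqxx andbT.
Qed.

Lemma label_partition_inj a a' :
  size a = N.+1 -> size a' = N.+1 -> wf 0 a -> wf 0 a' ->
  label_partition N.+1 (labels a) = label_partition N.+1 (labels a') -> a = a'.
Proof.
move=> sa sa' wa wa' E; apply: (@eq_from_nth _ None); first by rewrite sa sa'.
move=> j; rewrite sa => jN.
have [hlt _] := (wfP _ _).1 wa; have [hlt' _] := (wfP _ _).1 wa'.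
case Ea: (nth None a j) => [y|].
  have yN := ltn_trans (hlt _ _ Ea) jN.
  have := arc_label (Ordinal yN) (Ordinal jN) sa wa; rewrite E arc_label // Ea eqxx.
  by move/eqP->.
case Ea': (nth None a' j) => [y|] //.
have yN := ltn_trans (hlt' _ _ Ea') jN.
by have := arc_label (Ordinal yN) (Ordinal jN) sa' wa'; rewrite -E arc_label // Ea' Ea eqxx.
Qed.

(** The only walk that can yield [P] is the one recording [arcs_of P], and it is narrow exactly when
    [P] is noncrossing. *)
Lemma count_walks (P : {set {set 'I_N.+1}}) :
  count (fun a => label_partition N.+1 (labels a) == P) (walks K N.+1 N.+1 0 [::])
  = (P \in noncrossing_partitions K.+1 N.+1).
Proof.
have uw : uniq (walks K N.+1 N.+1 0 [::]) by apply: walks_uniq.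
rewrite inE; have [/andP[pP nP]|np] := boolP (_ && _).
  have wP := wf_arcs_of pP; have sP := size_arcs_of P.
  have <- : count_mem (arcs_of P) (walks K N.+1 N.+1 0 [::]) = true.
    rewrite count_uniq_mem // mem_walks0 sP eqxx wP /=.
    rewrite -(noncrossing_narrow _ sP wP (P := P)) ?nP // => i j.
    by rewrite nth_arcs_of.
  apply: eq_in_count => a; rewrite mem_walks0 => /and3P[/eqP sa wa _] /=.
  apply/eqP/eqP => [E|->]; last exact: label_arcs_of.
  by apply: label_partition_inj; rewrite // label_arcs_of.
apply/eqP; rewrite -leqn0 leqNgt -has_count; apply/hasPn => a.
rewrite mem_walks0 => /and3P[/eqP sa wa na]; apply: contra np => /eqP <-.
rewrite label_partitionP (noncrossing_narrow _ sa wa) // => i j.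
exact: arc_label.
Qed.

Lemma size_walks :
  size (walks K N.+1 N.+1 0 [::]) = #|noncrossing_partitions K.+1 N.+1|.
Proof.
rewrite -sum1_size (partition_big (fun a => label_partition N.+1 (labels a)) predT) //=.
rewrite -sum1_card [RHS]big_mkcond /=; apply: eq_bigr => P _.
by rewrite sum1_count count_walks; case: (P \in _).
Qed.
End Walks.

Import Order.TTheory GRing.Theory Num.Theory.
Local Open Scope ring_scope.

(** * Execution of programs *)

Lemma dbind_dret (T U : Type) (x : T) (f : T -> dist U) : dbind (dret x) f = f x.
Proof.
rewrite /dbind /dret /= cats0; elim: (f x) => //= -[w y] d ->.
by rewrite mul1r.
Qed.

Lemma dbind_cat (T U : Type) (d1 d2 : dist T) (f : T -> dist U) :
  dbind (d1 ++ d2) f = dbind d1 f ++ dbind d2 f.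
Proof. by rewrite /dbind map_cat flatten_cat. Qed.

Definition dscale (U : Type) (w : rat) (d : dist U) : dist U :=
  [seq (w * b.1, b.2) | b <- d].

Lemma dbind_cons (T U : Type) a (d : dist T) (f : T -> dist U) :
  dbind (a :: d) f = dscale a.1 (f a.2) ++ dbind d f.
Proof. by []. Qed.

Lemma dbind_scale (T U : Type) w (d : dist T) (f : T -> dist U) :
  dbind (dscale w d) f = dscale w (dbind d f).
Proof.
elim: d => //= a d IH; rewrite !dbind_cons IH /dscale map_cat -map_comp /=.
by congr cat; apply: eq_map => b /=; rewrite mulrA.
Qed.

Lemma dbindA (T U V : Type) (d : dist T) (f : T -> dist U) (g : U -> dist V) :
  dbind (dbind d f) g = dbind d (fun x => dbind (f x) g).
Proof.
elim: d => //= a d IH.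
by rewrite !dbind_cons dbind_cat dbind_scale IH.
Qed.

Lemma prob_cat (T : Type) (d1 d2 : dist T) E : prob (d1 ++ d2) E = prob d1 E + prob d2 E.
Proof. exact: big_cat. Qed.

Lemma prob_scale (T : Type) w (d : dist T) E : prob (dscale w d) E = w * prob d E.
Proof. by rewrite /prob big_map mulr_sumr. Qed.

Lemma prob_dbind (T U : Type) (d : dist T) (f : T -> dist U) E :
  prob (dbind d f) E = \sum_(a <- d) a.1 * prob (f a.2) E.
Proof.
elim: d => [|a d IH]; first by rewrite /prob !big_nil.
by rewrite dbind_cons prob_cat prob_scale IH big_cons.
Qed.

Lemma In_map (T U : Type) (f : T -> U) (d : seq T) y :
  List.In y (map f d) <-> exists2 x, f x = y & List.In x d.
Proof.
elim: d => [|a d IH] /=; first by split=> // -[].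
split=> [[<-|/IH[x E xd]]|[x E [->|xd]]].
- by exists a; [|left].
- by exists x; [|right].
- by left.
- by right; apply/IH; exists x.
Qed.

Lemma In_cat (T : Type) (d1 d2 : seq T) y :
  List.In y (d1 ++ d2) <-> List.In y d1 \/ List.In y d2.
Proof. exact: List.in_app_iff. Qed.

Lemma In_dbind (T U : Type) (d : dist T) (f : T -> dist U) w y :
  List.In (w, y) (dbind d f) <->
  exists a b, [/\ List.In a d, List.In (b, y) (f a.2) & w = a.1 * b].
Proof.
elim: d => [|a d IH]; first by split=> // -[? [? []]].
rewrite dbind_cons In_cat IH /dscale In_map; split.
  case=> [[[b z] /= [<- <-] h]|[a' [b [h1 h2 h3]]]].
    by exists a, b; split=> //; left.
  by exists a', b; split=> //; right.
case=> a' [b [[<-|h1] h2 h3]]; last by right; exists a', b.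
by left; exists (b, y); rewrite //= h3.
Qed.

Definition nonneg (T : Type) (d : dist T) := forall w x, List.In (w, x) d -> 0 <= w.

Lemma nonneg_dbind (T U : Type) (d : dist T) (f : T -> dist U) :
  nonneg d -> (forall x, nonneg (f x)) -> nonneg (dbind d f).
Proof.
by move=> hd hf w y /In_dbind[[wa x] [b [/hd /= ha /hf hb ->]]]; apply: mulr_ge0.
Qed.

Lemma possible_dbind (T U : Type) (d : dist T) (f : T -> dist U) y :
  nonneg d -> (forall x, nonneg (f x)) -> possible (dbind d f) y ->
  exists2 x, possible d x & possible (f x) y.
Proof.
move=> hd hf [w w0 /In_dbind[[a x] [b [ha hb wE]]]].
rewrite wE /= in w0; have a0 := hd _ _ ha; have b0 := hf _ _ _ hb.
have {}a0 : 0 < a by rewrite lt0r a0 andbT; apply: contraTneq w0 => ->; rewrite mul0r ltxx.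
exists x; first by exists a.
exists b => //; by rewrite pmulr_rgt0 in w0.
Qed.

Local Notation space := Defs.space.

Section Machine.
Variable tb : store.

Definition exec_dist (n : nat) (c : config) : dist config :=
  iter n (fun d => dbind d (step tb)) (dret c).

(** Runs are defined by appending a last step, whereas correctness proofs peel off the first one;
    associativity of [dbind] makes the two agree. *)
Lemma exec_distS n c : exec_dist n.+1 c = dbind (step tb c) (exec_dist n).
Proof.
elim: n => [|n IH].
  rewrite /exec_dist /= dbind_dret.
  elim: (step tb c) => //= -[w x] d {1}->; by rewrite dbind_cons /dscale /= mulr1.
by rewrite {1}/exec_dist iterS -/(exec_dist _ _) IH dbindA.
Qed.

Lemma nonneg_step c : nonneg (step tb c).
Proof.
case: c => -[|i q] s w x; first by case=> // -[<-].
case: i => [y r|A i o|y ws|cmp a b p1 p2|cmp a b p1] /=.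
- by case=> // -[<-].
- by case=> // -[<-].
- case: ifP => [/andP[/allP h0 t0]|_]; last by case=> // -[<-].
  case/In_map => j [<- _] hj; apply: divr_ge0; last by rewrite ler0z ltW.
  rewrite ler0z; case: (ltnP j (size [seq eval_operand s o | o <- ws])) => hs.
    by apply: h0; apply: mem_nth.
  by rewrite nth_default.
- by case: ifP => _; case=> // -[<-].
- by case: ifP => _; case=> // -[<-].
Qed.

Lemma nonneg_exec n c : nonneg (exec_dist n c).
Proof.
elim: n c => [|n IH] c; first by move=> w x; case=> // -[<-].
by rewrite exec_distS; apply: nonneg_dbind => //; apply: nonneg_step.
Qed.

(* [ok Q E n c v]: from [c] the machine halts within [n] steps, using at most
   [n] new cells, in a store that satisfies [Q]; the event [E] has probability
   [v]. *)
Definition ok (Q : store -> Prop) (E : pred store) (n : nat) (c : config) (v : rat) :=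
  forall n', (n <= n')%N ->
    (forall c', possible (exec_dist n' c) c' ->
       [/\ halted c', (space c'.2 <= space c.2 + n)%N & Q c'.2]) /\
    prob (exec_dist n' c) (fun c' => E c'.2) = v.

Lemma ok_le Q E n n' c v : (n <= n')%N -> ok Q E n c v -> ok Q E n' c v.
Proof.
move=> le h m hm; have [h1 h2] := h m (leq_trans le hm); split=> // c' /h1[a b d].
by split=> //; apply: leq_trans b _; rewrite leq_add2l.
Qed.

Lemma possible_dret (T : Type) (x y : T) : possible (dret x) y -> y = x.
Proof. by case=> w _ [[_ ->]|[]]. Qed.

Lemma ok_halt Q (E : pred store) n s : Q s -> ok Q E n ([::], s) (E s)%:R.
Proof.
move=> hQ n' _.
have -> : exec_dist n' ([::], s) = dret ([::], s).
  by elim: n' => // n' IH; rewrite exec_distS /= dbind_dret.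
split; first by move=> c' hc; rewrite (possible_dret hc) /= leq_addr.
by rewrite /prob big_cons big_nil /=; case: (E s); rewrite ?addr0.
Qed.

(** A step creates at most one cell, which is why a single number can bound both time and space in
    [ok]. *)
Lemma ok_det Q E n c c' v : step tb c = dret c' -> (space c'.2 <= (space c.2).+1)%N ->
  ok Q E n c' v -> ok Q E n.+1 c v.
Proof.
move=> E1 sp h [|n'] // /h[h1 h2]; rewrite exec_distS E1 dbind_dret; split=> //.
by move=> x /h1[a b d]; split=> //; apply: leq_trans b _; lia.
Qed.

Lemma space_put s c v : (space (put s c v) <= (space s).+1)%N.
Proof.
rewrite /space /put dom_setf cardfsU1.
by case: (_ \notin _); rewrite ?add1n ?add0n.
Qed.

(** An outcome of weight zero is listed by the machine but is not possible and adds nothing to a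
    probability, so each branch need only be treated when its weight is positive. *)
Lemma ok_draw Q E n x a b q s (w0 w1 : nat) v0 v1 :
  eval_operand s a = w0%:Z -> eval_operand s b = w1%:Z -> (0 < w0 + w1)%N ->
  ((0 < w0)%N -> ok Q E n (q, put s (x, 0) 0) v0) ->
  ((0 < w1)%N -> ok Q E n (q, put s (x, 0) 1) v1) ->
  ok Q E n.+1 (Draw x [:: a; b] :: q, s)
    ((w0%:R * v0 + w1%:R * v1) / (w0 + w1)%:R).
Proof.
move=> Ea Eb wp h0 h1 [|n'] // nn'.
have Es : step tb (Draw x [:: a; b] :: q, s) =
    [:: (w0%:R / (w0 + w1)%:R, (q, put s (x, 0) 0));
        (w1%:R / (w0 + w1)%:R, (q, put s (x, 0) 1))].
  rewrite /= Ea Eb !big_cons big_nil addr0 /= -PoszD.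
  by rewrite (_ : (0 < (w0 + w1)%:Z) = true).
rewrite exec_distS Es; split; last first.
  rewrite prob_dbind !big_cons big_nil addr0 /= mulrDl.
  have -> : w0%:R * v0 / (w0 + w1)%:R = w0%:R / (w0 + w1)%:R * v0 by ring.
  have -> : w1%:R * v1 / (w0 + w1)%:R = w1%:R / (w0 + w1)%:R * v1 by ring.
  congr (_ + _).
    by case: w0 h0 {Ea wp Es} => [|w] h0; [rewrite !mul0r|have [//|_ ->] := h0 isT n'].
  by case: w1 h1 {Eb wp Es} => [|w] h1; [rewrite !mul0r|have [//|_ ->] := h1 isT n'].
rewrite -Es => c' pc0.
have [c] := possible_dbind (@nonneg_step _) (fun x => @nonneg_exec n' x) pc0.
rewrite Es => -[w wpos Hc] pc.
have wr0 m : 0 < (m%:R / (w0 + w1)%:R : rat) -> (0 < m)%N.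
  by case: m => // ; rewrite mul0r ltxx.
have fin v z : ok Q E n (q, put s (x, 0) z) v ->
    c = (q, put s (x, 0) z) ->
    [/\ halted c', (space c'.2 <= space s + n.+1)%N & Q c'.2].
  move=> h Ec; rewrite Ec in pc; have [//|h' _] := h n'; have [a1 a2 a3] := h' _ pc.
  split=> //; apply: leq_trans a2 _; rewrite addnS -addSn leq_add2r; exact: space_put.
case: Hc => [[Ew Ec]|[[Ew Ec]|//]]; rewrite -Ew in wpos.
  exact: fin (h0 (wr0 _ wpos)) (esym Ec).
exact: fin (h1 (wr0 _ wpos)) (esym Ec).
Qed.

(* Stated for all continuations [q], so that it composes with random draws. *)
Definition exec (t : nat) (p : program) (s s' : store) :=
  forall Q E n q v, ok Q E n (q, s') v -> ok Q E (t + n) (p ++ q, s) v.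

Lemma exec_nil s : exec 0 [::] s s.
Proof. by []. Qed.

Lemma exec_le t t' p s s' : (t <= t')%N -> exec t p s s' -> exec t' p s s'.
Proof. by move=> le h Q E n q v /h; apply: ok_le; rewrite leq_add2r. Qed.

Lemma exec_cat t1 t2 p1 p2 s s1 s2 :
  exec t1 p1 s s1 -> exec t2 p2 s1 s2 -> exec (t1 + t2) (p1 ++ p2) s s2.
Proof. by move=> h1 h2 Q E n q v /h2/h1; rewrite -addnA catA. Qed.

Lemma exec_assign t x r p s s' :
  exec t p (put s (x, 0) (eval_rvalue tb s r)) s' -> exec t.+1 (Assign x r :: p) s s'.
Proof.
move=> h Q E n q v /h h'; rewrite addSn; apply: ok_det h'; first by [].
exact: space_put.
Qed.

Lemma exec_write t A i o p s s' :
  exec t p (put s (A, eval_operand s i) (eval_operand s o)) s' ->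
  exec t.+1 (Write A i o :: p) s s'.
Proof.
move=> h Q E n q v /h h'; rewrite addSn; apply: ok_det h'; first by [].
exact: space_put.
Qed.

Lemma exec_if t cmp a b p1 p2 p s s' :
  exec t ((if eval_comparison cmp (eval_operand s a) (eval_operand s b)
           then p1 else p2) ++ p) s s' ->
  exec t.+1 (If cmp a b p1 p2 :: p) s s'.
Proof.
move=> h Q E n q v /h h'; rewrite addSn; rewrite -catA in h'.
by apply: ok_det h'; rewrite /= ?leqnSn //; case: ifP.
Qed.

Lemma exec_while_end cmp a b p s :
  eval_comparison cmp (eval_operand s a) (eval_operand s b) = false ->
  exec 1 [:: While cmp a b p] s s.
Proof.
move=> h Q E n q v h'; rewrite add1n; apply: ok_det h'; first by rewrite /= h.
exact: leqnSn.
Qed.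

Lemma exec_while_step t1 t2 cmp a b p s s1 s2 :
  eval_comparison cmp (eval_operand s a) (eval_operand s b) ->
  exec t1 p s s1 -> exec t2 [:: While cmp a b p] s1 s2 ->
  exec (t1 + t2).+1 [:: While cmp a b p] s s2.
Proof.
move=> c h1 h2 Q E n q v /h2/h1 h; rewrite addSn -addnA; apply: ok_det h.
  by rewrite /= c.
exact: leqnSn.
Qed.

(** The invariant is indexed by the number of iterations left, so termination and running time come
    from one induction; each round pays for one test, and the exit for a last one. *)
Lemma exec_while t cmp a b p (Inv : nat -> store -> Prop) :
  (forall s, Inv 0 s ->
     eval_comparison cmp (eval_operand s a) (eval_operand s b) = false) ->
  (forall m s, Inv m.+1 s ->
     eval_comparison cmp (eval_operand s a) (eval_operand s b) /\
     exists2 s', exec t p s s' & Inv m s') ->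
  forall m s, Inv m s ->
    exists2 s', exec (m * t.+1).+1 [:: While cmp a b p] s s' & Inv 0 s'.
Proof.
move=> h0 hS; elim=> [|m IH] s hI.
  by exists s => //; apply: exec_while_end; apply: h0.
have [c [s1 e1 /IH[s2 e2 I2]]] := hS _ _ hI.
by exists s2 => //; rewrite mulSn addSnnS; apply: exec_while_step e1 _.
Qed.

End Machine.

(** * Memory access and framing *)

Lemma get_put s c v c' : get (put s c v) c' = if c' == c then v else get s c'.
Proof. by rewrite /get /put fnd_set; case: ifP. Qed.

Lemma get_put_same s c v : get (put s c v) c = v.
Proof. by rewrite get_put eqxx. Qed.

Lemma get_put_array s A i v A' i' : (A == A') = false ->
  get (put s (A, i) v) (A', i') = get s (A', i').
Proof. by move=> h; rewrite get_put xpair_eqE eq_sym h. Qed.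

Lemma get_put_index s A i v i' : i' != i ->
  get (put s (A, i) v) (A, i') = get s (A, i').
Proof. by move=> /negbTE h; rewrite get_put xpair_eqE eqxx h. Qed.

Definition frame (X : seq nat) (s s' : store) :=
  forall A i, A \notin X -> get s' (A, i) = get s (A, i).

Lemma frame_sub X Y s s' : all (fun A => A \in Y) X -> frame X s s' -> frame Y s s'.
Proof. by move=> /allP XY f A i AY; apply: f; apply: contra AY => /XY. Qed.

Lemma frame_trans X s1 s2 s3 : frame X s1 s2 -> frame X s2 s3 -> frame X s1 s3.
Proof. by move=> f1 f2 A i AX; rewrite f2 ?f1. Qed.

Local Open Scope nat_scope.

(** * Counting completions *)

Definition digit (M code p : nat) := code %/ M ^ p %% M.

Definition encode (M n : nat) (d : nat -> nat) := \sum_(p < n) d p * M ^ p.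

Lemma encode_recr M n d : encode M n.+1 d = encode M n d + d n * M ^ n.
Proof. exact: big_ord_recr. Qed.

Lemma encode_ltn M n d : (forall p, p < n -> d p < M) -> encode M n d < M ^ n.
Proof.
elim: n => [|n IH] h; first by rewrite /encode big_ord0.
have := IH (fun p hp => h p (ltnW hp)); have := h n (ltnSn n).
rewrite encode_recr expnS; nia.
Qed.

Lemma digit_encode M n d p : (forall p, p < n -> d p < M) -> p < n ->
  digit M (encode M n d) p = d p.
Proof.
elim: n => // n IH h; have M0 : 0 < M by apply: leq_ltn_trans (h n (ltnSn n)).
have h' q : q < n -> d q < M by move=> qn; apply: h; apply: ltnW.
rewrite ltnS leq_eqVlt encode_recr => /orP[/eqP->|pn].
  rewrite /digit divnDMl ?expn_gt0 ?M0 // divn_small ?encode_ltn // add0n.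
  by rewrite modn_small // h.
rewrite -(IH h' pn) /digit.
have -> : d n * M ^ n = d n * M ^ (n - p.+1) * M * M ^ p.
  by rewrite -!mulnA -expnS -expnD; congr (_ * _ ^ _); lia.
by rewrite divnDMl ?expn_gt0 ?M0 // addnC modnMDl.
Qed.

Lemma digit_encode0 M n d p : (forall p, p < n -> d p < M) -> n <= p ->
  digit M (encode M n d) p = 0.
Proof.
case: n => [|n] h np; first by rewrite /digit /encode big_ord0 div0n mod0n.
rewrite /digit divn_small ?mod0n //; apply: leq_trans (encode_ltn h) _.
by apply: leq_pexp2l np; apply: leq_ltn_trans (h 0 _).
Qed.

Lemma encode_incr M n d d' p : p < n -> (forall q, d' q = d q + (q == p)) ->
  encode M n d' = encode M n d + M ^ p.
Proof.
move=> pn E; rewrite /encode; under eq_bigr => q _ do rewrite E mulnDl.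
rewrite big_split /=; congr (_ + _).
rewrite (bigD1 (Ordinal pn)) //= eqxx mul1n big1 ?addn0 // => q /negbTE.
by rewrite -val_eqE /= => ->.
Qed.

(* The half-step [e = 0] deletes and [e = 1] adds a cell in row [p - 1].  Since
   digit 0 is [M - 1], the first row needs no special treatment. *)
Definition admissible (M e code p : nat) : bool :=
  digit M code (p - e).+1 < digit M code (p - e).

Definition successor (M e code p : nat) : nat :=
  if e == 1 then code + M ^ p else code - M ^ p.

(* [completions K M m code] is the number of ways to complete a vacillating
   tableau in [m] more half-steps when [code] has the digits
   (M - 1, lambda_1, ..., lambda_K) in base [M]; the parity of [m] tells deletions
   from additions. *)
Fixpoint completions (K M m code : nat) : nat :=
  if m is m'.+1 then
    completions K M m' code +
    \sum_(1 <= p < K.+1) (if admissible M (odd m) code p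
                          then completions K M m' (successor M (odd m) code p) else 0)
  else code == M.-1.

Lemma completionsS K M m code : completions K M m.+1 code =
  completions K M m code +
  \sum_(1 <= p < K.+1) (if admissible M (odd m.+1) code p
                        then completions K M m (successor M (odd m.+1) code p) else 0).
Proof. by []. Qed.

Arguments completions : simpl never.

Definition shape (N : nat) (L : tableau) (p : nat) := if p is r.+1 then cnt L r else N.

Definition shape_code (K N : nat) (L : tableau) := encode N.+1 K.+1 (shape N L).

Lemma walksS K N n i L : walks K N n.+1 i L =
  [seq x.1 :: a | x <- steps K N i L, a <- walks K N n i.+1 x.2].
Proof. by []. Qed.

Section Completions.
Variables K N : nat.

Lemma shape_ltn i L : legit K i L -> i <= N -> forall p, shape N L p < N.+1.
Proof.
case/and4P => dL _ vL _ iN [|r] //=; rewrite ltnS.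
by apply: leq_trans (cnt_size _ _) (leq_trans (desc_size dL vL) iN).
Qed.

Lemma digit_shape i L p : legit K i L -> i <= N ->
  digit N.+1 (shape_code K N L) p = shape N L p.
Proof.
move=> lL iN; have h := shape_ltn lL iN.
have [pK|Kp] := ltnP p K.+1; first by rewrite digit_encode.
rewrite digit_encode0 //; case: p Kp => // p Kp /=.
by have /and4P[_ _ _ hL] := lL; rewrite (heightP _ _ hL).
Qed.

Lemma admissible_close i L r : legit K i L -> i <= N ->
  admissible N.+1 0 (shape_code K N L) r.+1 = (cnt L r.+1 < cnt L r).
Proof. by move=> lL iN; rewrite /admissible subn0 !(digit_shape _ lL). Qed.

Lemma admissible_open i L r : legit K i L -> i <= N ->
  admissible N.+1 1 (shape_code K N L) r.+1 = openable N L r.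
Proof. by move=> lL iN; rewrite /admissible subn1 !(digit_shape _ lL) //=; case: r. Qed.

Lemma successor_open i r L : r < K ->
  successor N.+1 1 (shape_code K N L) r.+1 = shape_code K N ((i, r) :: L).
Proof.
move=> rK; rewrite /successor eqxx; apply/esym/encode_incr => // -[|q] /=.
  by rewrite addn0.
by rewrite cnt_cons eqSS eq_sym addnC.
Qed.

Lemma successor_close L L1 r y : r < K -> del r L = Some (y, L1) ->
  successor N.+1 0 (shape_code K N L) r.+1 = shape_code K N L1.
Proof.
move=> rK E; rewrite /successor /=.
rewrite /shape_code (@encode_incr _ _ (shape N L1) (shape N L) r.+1) ?addnK // => -[|q] /=.
  by rewrite addn0.
by rewrite (del_cnt q E) eqSS.
Qed.

Lemma shape_code_nil : shape_code K N [::] = N.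
Proof.
rewrite /shape_code /encode big_ord_recl /= muln1 big1 ?addn0 // => q _.
Qed.

Lemma shape_code_eqN i L : legit K i L -> i <= N -> (shape_code K N L == N) = nilp L.
Proof.
move=> lL iN; apply/eqP/nilP => [E|->]; last exact: shape_code_nil.
case: L lL E => // -[v r] L lL E; have /and4P[_ _ _ /andP[/= rK _]] := lL.
have := digit_shape r.+1 lL iN; have := digit_shape r.+1 (legit0 K) (leq0n N).
by rewrite E shape_code_nil => ->; rewrite /= cnt_cons eqxx.
Qed.

Lemma sum_options (T : Type) (F : T -> nat) (x0 : T) (f : nat -> T) (P : pred nat) :
  \sum_(x <- x0 :: [seq f r | r <- iota 0 K & P r]) F x =
  F x0 + \sum_(1 <= p < K.+1) (if P p.-1 then F (f p.-1) else 0).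
Proof.
rewrite big_cons big_map big_filter; congr (_ + _).
by rewrite big_add1 /= /index_iota subn0 big_mkcond.
Qed.

Lemma sum_opens i L n : legit K i L -> i < N -> odd n = false ->
  \sum_(M <- opens K N i L) completions K N.+1 n (shape_code K N M) =
  completions K N.+1 n.+1 (shape_code K N L).
Proof.
move=> lL iN od; rewrite sum_options completionsS /= od; congr (_ + _).
apply: eq_big_nat => -[|r] // /andP[_ rK].
rewrite (admissible_open r lL (ltnW iN)) /=; case: ifP => // _.
by rewrite (successor_open i).
Qed.

Lemma sum_closes i L n : legit K i L -> i < N -> odd n ->
  \sum_(c <- closes K L) completions K N.+1 n (shape_code K N c.2) =
  completions K N.+1 n.+1 (shape_code K N L).
Proof.
move=> lL iN od; rewrite sum_options completionsS /= od; congr (_ + _).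
apply: eq_big_nat => -[|r] // /andP[_ rK].
rewrite (admissible_close r lL (ltnW iN)) /=; case: ifP => // gr.
have [y [L1 [E _ _ _]]] := legit_del lL gr.
by rewrite (successor_close rK E) /delete E.
Qed.

(** A vertex is two half-steps, whence [n.*2]. The tableau matters only through its shape, because
    every closing or opening is chosen by its row alone. *)
Lemma size_walks_completions n i L : legit K i L -> i + n = N ->
  size (walks K N n i L) = completions K N.+1 n.*2 (shape_code K N L).
Proof.
elim: n i L => [|n IH] i L lL iN.
  rewrite /completions /= (shape_code_eqN lL) ?(leq_trans _ (eq_leq iN)) ?leq_addr //.
  by case: L {lL}.
have iN' : i < N by lia.
rewrite doubleS -(sum_closes lL iN') ?walksS; last by rewrite /= odd_double.
rewrite size_allpairs_dep sumnE big_map /steps big_allpairs_dep /=.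
apply: eq_big_seq => -[x L1] hc /=.
have [l1 _ _] := closes_spec _ _ lL hc.
rewrite -(sum_opens l1 iN') ?odd_double //; apply: eq_big_seq => M.
rewrite (opens_legit _ l1 iN') => /andP[lM _]; apply: IH => //; lia.
Qed.

End Completions.

Section SuccessCounts.
Variables (K N : nat) (F : pred (seq nat)).

(** [l] is the list of labels already written. Divided by the number of walks, this is the
    conditional probability, given [l] and [L], that the final labels satisfy [F]. *)
Definition successes (l : seq nat) (n i : nat) (L : tableau) : nat :=
  count (fun a => F (foldl relabel l a)) (walks K N n i L).

Definition open_successes (l : seq nat) (n i : nat) (L : tableau) : nat :=
  \sum_(M <- opens K N i L) successes l n i.+1 M.

Lemma successesS l n i L : successes l n.+1 i L =
  \sum_(c <- closes K L) open_successes (relabel l c.1) n i c.2.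
Proof.
rewrite /successes walksS -sum1_count big_mkcond big_allpairs_dep /steps.
rewrite big_allpairs_dep; apply: eq_bigr => c _; apply: eq_bigr => M _.
by rewrite /successes -sum1_count [RHS]big_mkcond.
Qed.

Lemma successes_le l n i L : successes l n i L <= size (walks K N n i L).
Proof. exact: count_size. Qed.

End SuccessCounts.

(** * Rows of a tableau and their power sums *)

Definition trow (r : nat) (L : tableau) : seq nat := rev [seq z.1 | z <- L & z.2 == r].

Lemma trow_cons r z L : trow r (z :: L) = trow r L ++ (if z.2 == r then [:: z.1] else [::]).
Proof. by rewrite /trow /=; case: ifP => _ /=; rewrite ?cats0 // rev_cons cats1. Qed.

Lemma trow_cat r L1 L2 : trow r (L1 ++ L2) = trow r L2 ++ trow r L1.
Proof. by rewrite /trow filter_cat map_cat rev_cat. Qed.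

Lemma size_trow r L : size (trow r L) = cnt L r.
Proof. by rewrite size_rev size_map size_filter. Qed.

Lemma mem_trow r L v : v \in trow r L -> v \in vals L.
Proof.
by rewrite mem_rev => /mapP[z]; rewrite mem_filter => /andP[_ zL] ->; apply: map_f.
Qed.

Lemma trow_uniq r L : desc L -> uniq (trow r L).
Proof.
move/desc_uniq; rewrite rev_uniq; apply: subseq_uniq.
exact: map_subseq (filter_subseq _ _).
Qed.

Lemma trow_nil r L : all (fun z : nat * nat => z.2 != r) L -> trow r L = [::].
Proof.
elim: L => //= z L IH /andP[/negbTE zr /IH h]; by rewrite trow_cons h zr.
Qed.

Lemma del_trow r y L L1 q : del r L = Some (y, L1) -> r < q -> trow q L1 = trow q L.
Proof.
elim: L r L1 y => [|[v p] L IH] //= r L1 y; case: ifP => [/eqP->|pr].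
  case: r => [|r].
    by case=> _ <- q0; rewrite trow_cons /= ltn_eqF // cats0.
  case E: (del r L) => [[u M]|] //= [_ <-] rq.
  by rewrite !trow_cons (IH _ _ _ E) ?(ltnW rq) //= !ltn_eqF // ltnW.
case E: (del r L) => [[u M]|] //= [_ <-] rq.
by rewrite !trow_cons (IH _ _ _ E).
Qed.

Lemma del_split r y L L1 : del r L = Some (y, L1) ->
  exists A x D, [/\ L = A ++ (x, r) :: D, all (fun z => z.2 != r) A &
    if r is r'.+1 then
      exists2 D1, del r' D = Some (y, D1) & L1 = A ++ (x, r') :: D1
    else y = x /\ L1 = A ++ D].
Proof.
elim: L r L1 y => [|[v p] L IH] //= r L1 y; case: ifP => [/eqP->|pr].
  case: r => [|r]; first by case=> <- <-; exists [::], v, L.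
  case E: (del r L) => [[u M]|] //= [<- <-].
  by exists [::], v, L; split=> //; exists M.
case E: (del r L) => [[u M]|] //= [<- <-].
have [A [x [D [EL hA h]]]] := IH _ _ _ E; exists ((v, p) :: A), x, D.
split; rewrite /= ?pr ?EL //.
case: r {IH pr E EL hA} h => [[-> ->]//|r [D1 E1 ->]].
by exists D1.
Qed.

Lemma desc_cat A L : desc (A ++ L) ->
  [/\ desc A, desc L & forall u v, u \in vals A -> v \in vals L -> v < u].
Proof.
rewrite /desc /vals map_cat !sorted_pairwise; try by move=> a b c /= h1 h2; apply: ltn_trans h2 h1.
by rewrite pairwise_cat => /and3P[/allrelP h -> ->]; split=> // u v; apply: h.
Qed.

Definition weight_sum (B : nat) (R : seq nat) := \sum_(v <- R) B ^ v.

(* One bump: the row [r] that receives [x] from the row below gives up its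
   largest entry [x'] below [x]. *)
Lemma bump_step (A D D1 : tableau) r x y :
  desc (A ++ (x, r) :: D) -> del r D = Some (y, D1) ->
  exists (x' : nat) (D' : tableau) (R1 R2 : seq nat),
  [/\ trow r (A ++ D) = R1 ++ x' :: R2, trow r (A ++ (x, r) :: D1) = R1 ++ x :: R2,
      count (fun v => v < x) (trow r (A ++ D)) = (size R1).+1 &
      if r is r'.+1 then exists A2 D1',
        [/\ del r' D' = Some (y, D1'), A ++ (x, r) :: D1 = A2 ++ (x', r') :: D1',
            vals (A2 ++ (x', r') :: D') = vals (A ++ (x, r) :: D) &
            forall q, q < r -> trow q (A ++ D) = trow q (A2 ++ D')]
      else y = x'].
Proof.
move=> dL /del_split[A' [x' [D' [ED hA' h]]]].
have [dA dD lt1] := desc_cat dL.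
move: dD; rewrite desc_cons => /andP[/= /allP lt2 dD].
exists x', D', (trow r D'), (trow r A); split.
- by rewrite ED !trow_cat trow_cons /= eqxx (trow_nil hA') cats0 -catA.
- case: r dL ED hA' h lt1 => [|r] dL ED hA' h lt1.
    by case: h => _ ->; rewrite !trow_cat trow_cons trow_cat (trow_nil hA') /= cats0 -catA.
  case: h => D1' E' ->; rewrite trow_cat trow_cons /= eqxx trow_cat trow_cons /= ltn_eqF //.
  by rewrite (trow_nil hA') !cats0 (del_trow E') // -catA.
- rewrite ED !trow_cat trow_cons /= eqxx (trow_nil hA') cats0 !count_cat /=.
  have x'D : x' \in vals D by rewrite ED /vals map_cat mem_cat mem_head orbT.
  rewrite (lt2 _ x'D) addn0.
  have -> : count (fun v => v < x) (trow r D') = size (trow r D').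
    apply/eqP; rewrite -all_count; apply/allP => v /mem_trow vD; apply: lt2.
    by rewrite ED /vals map_cat mem_cat inE vD !orbT.
  rewrite size_trow addn1 -[RHS]addn0; congr (_ + _).
  apply/eqP; rewrite -leqn0 leqNgt -has_count; apply/hasPn => v /mem_trow vA.
  by rewrite -leqNgt ltnW // (lt1 v x) ?mem_head.
case: r dL ED hA' h lt1 => [|r] dL ED hA' h lt1; first by case: h.
case: h => D1' E' ED1; exists (A ++ (x, r.+1) :: A'), D1'; split=> //.
- by rewrite ED1 -catA.
- by rewrite ED /vals -catA /= !(map_cat, map_cons).
- move=> q qr; rewrite ED -catA cat_cons !(trow_cat, trow_cons) /= gtn_eqF //.
  by rewrite !cats0.
Qed.

Lemma weight_sum_cat B R1 R2 : weight_sum B (R1 ++ R2) = weight_sum B R1 + weight_sum B R2.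
Proof. exact: big_cat. Qed.

Lemma weight_sum_cons B v R : weight_sum B (v :: R) = B ^ v + weight_sum B R.
Proof. exact: big_cons. Qed.

Lemma weight_sum_ltn B x R : 1 < B -> uniq R -> all (fun v => v < x) R ->
  weight_sum B R < B ^ x.
Proof.
move=> B1; elim: x R => [|x IH] R uR aR.
  by case: R uR aR => //= *; rewrite /weight_sum big_nil.
rewrite /weight_sum; case xR: (x \in R).
  rewrite (perm_big _ (perm_to_rem xR)) big_cons /=.
  have := IH (rem x R) (rem_uniq _ uR); rewrite -/(weight_sum _ _) expnS.
  have -> : all (fun v => v < x) (rem x R).
    apply/allP => v; rewrite mem_rem_uniq // inE => /andP[vx /(allP aR)].
    by rewrite ltnS leq_eqVlt (negbTE vx).
  by move=> /(_ isT); nia.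
have := IH R uR; rewrite -/(weight_sum _ _) expnS.
have -> : all (fun v => v < x) R.
  apply/allP => v vR; move: (allP aR v vR); rewrite ltnS leq_eqVlt.
  by case/orP => // /eqP vx; rewrite -vx vR in xR.
by move=> /(_ isT); nia.
Qed.

Lemma weight_sum_mod M R : weight_sum M.+1 R = size R %[mod M].
Proof.
elim: R => [|v R IH]; first by rewrite /weight_sum big_nil.
rewrite weight_sum_cons -modnDm IH modnDm -modnDml -modnXm -addn1 modnDl modnXm exp1n.
by rewrite modnDml add1n.
Qed.

(* With [B > 1] the entries below [x] are cut out by a reduction modulo [B ^ x],
   and since [B = 1] modulo [B - 1] they are counted by a second reduction. *)
Lemma rank_mod M x R : 0 < M -> uniq R -> count (fun v => v < x) R < M ->
  (weight_sum M.+1 R %% M.+1 ^ x) %% M = count (fun v => v < x) R.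
Proof.
move=> M0 uR cR.
have -> : weight_sum M.+1 R %% M.+1 ^ x = weight_sum M.+1 [seq v <- R | v < x].
  rewrite -[RHS](@modn_small _ (M.+1 ^ x)); last first.
    by apply: weight_sum_ltn; rewrite ?filter_uniq ?filter_all.
  rewrite /weight_sum big_filter (bigID (fun v => v < x)) /=.
  rewrite -modnDmr [X in _ + X %% _](_ : _ = \sum_(v <- R | ~~ (v < x)) M.+1 ^ (v - x) * M.+1 ^ x).
    by rewrite -big_distrl /= modnMl addn0.
  by apply: eq_bigr => v; rewrite -leqNgt => xv; rewrite -expnD subnK.
by rewrite weight_sum_mod size_filter modn_small.
Qed.

Local Open Scope ring_scope.

(** * Pre-processing *)

Definition triple (tb : store) (t : nat) (p : program) (s : store) (Post : store -> Prop) :=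
  exists2 s', exec tb t p s s' & Post s'.

Section Triples.
Variable tb : store.
Implicit Types (p q : program) (s : store) (Post : store -> Prop).

Lemma triple_nil t s Post : Post s -> triple tb t [::] s Post.
Proof. by move=> h; exists s => //; apply: (exec_le (leq0n t)); apply: exec_nil. Qed.

Lemma triple_le t t' p s Post : (t <= t')%N -> triple tb t p s Post -> triple tb t' p s Post.
Proof. by move=> le [s' e h]; exists s' => //; apply: exec_le le e. Qed.

Lemma triple_impl t p s (Post Post' : store -> Prop) :
  (forall s', Post s' -> Post' s') -> triple tb t p s Post -> triple tb t p s Post'.
Proof. by move=> h [s' e hs]; exists s' => //; apply: h. Qed.

Lemma triple_assign v t x r p s Post : eval_rvalue tb s r = v ->
  triple tb t p (put s (x, 0) v) Post -> triple tb t.+1 (Assign x r :: p) s Post.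
Proof. by move=> <- [s' e h]; exists s' => //; apply: exec_assign. Qed.

Lemma triple_write i v t A oi o p s Post : eval_operand s oi = i -> eval_operand s o = v ->
  triple tb t p (put s (A, i) v) Post -> triple tb t.+1 (Write A oi o :: p) s Post.
Proof. by move=> <- <- [s' e h]; exists s' => //; apply: exec_write. Qed.

Lemma triple_if (b : bool) t cmp x y p1 p2 p s Post :
  eval_comparison cmp (eval_operand s x) (eval_operand s y) = b ->
  triple tb t ((if b then p1 else p2) ++ p) s Post ->
  triple tb t.+1 (If cmp x y p1 p2 :: p) s Post.
Proof. by move=> <- [s' e h]; exists s' => //; apply: exec_if. Qed.

Lemma triple_cat t1 t2 p1 p2 s (Mid Post : store -> Prop) :
  triple tb t1 p1 s Mid -> (forall s', Mid s' -> triple tb t2 p2 s' Post) ->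
  triple tb (t1 + t2) (p1 ++ p2) s Post.
Proof.
by case=> s1 e1 /[swap] h /h[s2 e2 h2]; exists s2 => //; apply: exec_cat e1 e2.
Qed.

Lemma triple_while (Inv : nat -> store -> Prop) m t t' cmp a b p q s Post :
  Inv m s ->
  (forall s', Inv 0%N s' ->
     eval_comparison cmp (eval_operand s' a) (eval_operand s' b) = false) ->
  (forall m s', Inv m.+1 s' ->
     eval_comparison cmp (eval_operand s' a) (eval_operand s' b)) ->
  (forall m s', Inv m.+1 s' -> triple tb t p s' (Inv m)) ->
  (forall s', Inv 0%N s' -> triple tb t' q s' Post) ->
  triple tb ((m * t.+1).+1 + t') (While cmp a b p :: q) s Post.
Proof.
move=> hI h0 hc hb hq; rewrite -cat1s; apply: (triple_cat _ hq).
apply: exec_while hI => // {}m {}s hI; split; first exact: hc hI.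
exact: hb.
Qed.

End Triples.

Definition reg (x : nat) (s : store) : int := get s (x, 0).

Lemma frame_put X s A i v : A \in X -> frame X s (put s (A, i) v).
Proof.
by move=> AX A' i' A'X; rewrite get_put_array //; apply: contraNF A'X => /eqP<-.
Qed.

Lemma frame_put_trans X s s' A i v : A \in X -> frame X s s' ->
  frame X s (put s' (A, i) v).
Proof. by move=> AX f; apply: frame_trans f (frame_put _ _ _ AX). Qed.

(* [vN] and [aOut] are imposed by the machine. *)
Definition vN := 0%N.
Definition aOut := 1%N.
Definition vM := 2%N.
Definition vY := 3%N.
Definition vH := 4%N.
Definition vC := 5%N.
Definition vP := 6%N.
Definition vW := 7%N.
Definition vE := 8%N.
Definition vA := 9%N.
Definition vU := 10%N.
Definition vV := 11%N.
Definition aPowM := 12%N.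
Definition aPowB := 13%N.
Definition aT := 14%N.

Definition fetch (b : bool) (A : nat) (i : operand) : rvalue :=
  if b then Lookup A i else Read A i.

Definition source (b : bool) (tb s : store) : store := if b then tb else s.

(* Sets [vW] to the number of completions that choose row [vP - 1] for the
   half-step [vH], from the table of half-step [vH + 1]; even half-steps close
   arcs and odd half-steps open arcs. *)
Definition weight (b : bool) : program :=
  [:: Assign vE (Bin Mod (Var vH) (Const 2));
      Assign vA (Bin Defs.Sub (Var vP) (Var vE));
      Assign vU (fetch b aPowM (Var vA));
      Assign vU (Bin Div (Var vC) (Var vU));
      Assign vU (Bin Mod (Var vU) (Var vM));
      Assign vA (Bin Add (Var vA) (Const 1));
      Assign vV (fetch b aPowM (Var vA));
      Assign vV (Bin Div (Var vC) (Var vV));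
      Assign vV (Bin Mod (Var vV) (Var vM));
      Assign vW (Atom (Const 0));
      If Defs.Lt (Var vV) (Var vU)
        [:: Assign vA (fetch b aPowM (Var vP));
            Assign vU (Bin Add (Var vE) (Var vE));
            Assign vU (Bin Defs.Sub (Var vU) (Const 1));
            Assign vA (Bin Mul (Var vA) (Var vU));
            Assign vA (Bin Add (Var vC) (Var vA));
            Assign vU (Bin Add (Var vH) (Const 1));
            Assign vU (Bin Mul (Var vU) (Var vY));
            Assign vA (Bin Add (Var vU) (Var vA));
            Assign vW (fetch b aT (Var vA))]
        [::]].

Lemma source_put b tb s A i v A' i' : (A == A') = false ->
  get (source b tb (put s (A, i) v)) (A', i') = get (source b tb s) (A', i').
Proof. by case: b => //= h; rewrite get_put_array. Qed.

Lemma eval_fetch b tb s A o :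
  eval_rvalue tb s (fetch b A o) = get (source b tb s) (A, eval_operand s o).
Proof. by case: b. Qed.

Ltac look := repeat first [rewrite get_put_same |
  rewrite get_put_array; [|reflexivity] | rewrite source_put; [|reflexivity]].

Lemma divzM_pow (code M a : nat) :
  ((code%:Z %/ (M ^ a)%:Z)%Z %% M%:Z)%Z = (digit M code a)%:Z.
Proof. by rewrite divz_nat modz_nat. Qed.

Definition weight_regs := [:: vE; vA; vU; vV; vW].

Lemma triple_weight b tb s K M h code p :
  (0 < p <= K)%N ->
  (forall j, (j <= K.+1)%N -> get (source b tb s) (aPowM, j%:Z) = (M ^ j)%:Z) ->
  reg vH s = h%:Z -> reg vC s = code%:Z -> reg vP s = p%:Z -> reg vM s = M%:Z ->
  reg vY s = (M ^ K.+1)%:Z ->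
  (admissible M (odd h) code p -> ~~ odd h -> M ^ p <= code)%N ->
  triple tb 20 (weight b) s (fun s' => frame weight_regs s s' /\
    reg vW s' = if admissible M (odd h) code p then
       get (source b tb s) (aT, (h.+1 * M ^ K.+1 + successor M (odd h) code p)%:Z)
     else 0).
Proof.
rewrite /reg => /andP[p0 pK] hP hH hC hp hM hY hle.
have hE : (h%:Z %% 2)%Z = (odd h : nat)%:Z by rewrite modz_nat modn2.
apply: (@triple_assign _ (odd h : nat)%:Z); first by rewrite /= hH.
apply: (@triple_assign _ (p - odd h)%N%:Z).
  rewrite /=; look; rewrite hp subzn //; by case: (odd h).
apply: triple_assign; first by rewrite eval_fetch /=; look; rewrite hP //; lia.
apply: triple_assign; first by rewrite /=; look; rewrite hC; reflexivity.
apply: triple_assign; first by rewrite /=; look; rewrite hM divzM_pow.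
apply: (@triple_assign _ (p - odd h).+1%:Z); first by rewrite /=; look; lia.
apply: triple_assign; first by rewrite eval_fetch /=; look; rewrite hP //; lia.
apply: triple_assign; first by rewrite /=; look; rewrite hC; reflexivity.
apply: triple_assign; first by rewrite /=; look; rewrite hM divzM_pow.
apply: triple_assign; first by rewrite /=; reflexivity.
apply: (@triple_if _ (admissible M (odd h) code p)).
  by rewrite /=; look; rewrite ltz_nat.
case: ifP => adm; rewrite /=; last first.
  apply: triple_nil; split; last by rewrite /reg; look.
  by do ![apply: frame_put_trans => //].
apply: triple_assign; first by rewrite eval_fetch /=; look; rewrite hp hP //; lia.
apply: triple_assign; first by rewrite /=; look; reflexivity.
apply: triple_assign; first by rewrite /=; look; reflexivity.
apply: triple_assign; first by rewrite /=; look; reflexivity.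
(* The factor [2 * vE - 1] is -1 for a closing and 1 for an opening, so one formula serves both. For
   a closing, [hle] ensures that the truncated subtraction of [successor] is the integer one. *)
apply: (@triple_assign _ (successor M (odd h) code p)%:Z).
  rewrite /=; look; rewrite hC /successor; case: (odd h) adm hle => /= adm hle; first by lia.
  by have := hle adm isT; lia.
apply: (@triple_assign _ h.+1%:Z); first by rewrite /=; look; rewrite hH; lia.
apply: (@triple_assign _ (h.+1 * M ^ K.+1)%N%:Z); first by rewrite /=; look; rewrite hY.
apply: (@triple_assign _ (h.+1 * M ^ K.+1 + successor M (odd h) code p)%N%:Z).
  by rewrite /=; look.
apply: triple_assign; first by rewrite eval_fetch /=; look; reflexivity.
apply: triple_nil; split; last by rewrite /reg; look.
by do ![apply: frame_put_trans => //].
Qed.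

Definition powers (A base : nat) (bound : operand) : program :=
  [:: Write A (Const 0) (Const 1);
      Assign vU (Atom (Const 1));
      Assign vA (Atom (Const 0));
      While Defs.Lt (Var vA) bound
        [:: Assign vU (Bin Mul (Var vU) (Var base));
            Assign vA (Bin Add (Var vA) (Const 1));
            Write A (Var vA) (Var vU)]].

Lemma triple_powers tb s A base bound (B n : nat) :
  vU == A = false -> vA == A = false -> A == base = false ->
  vU == base = false -> vA == base = false -> 
  reg base s = B%:Z ->
  (forall s', frame [:: vU; vA; A] s s' -> eval_operand s' bound = n%:Z) ->
  triple tb (3 + ((n * 4).+1 + 0)) (powers A base bound) s (fun s' =>
    [/\ frame [:: vU; vA; A] s s', reg vU s' = (B ^ n)%N%:Z &
     forall j : nat, (j <= n)%N -> get s' (A, j%:Z) = (B ^ j)%N%:Z]).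
Proof.
rewrite /reg => UA AA Ab Ub Ib hB hn.
have AU : A == vU = false by rewrite eq_sym. have AvA : A == vA = false by rewrite eq_sym.
apply: (@triple_write _ 0 1) => //.
apply: triple_assign; first by reflexivity.
apply: triple_assign; first by reflexivity.
rewrite /=.
pose Inv m s' := exists j : nat, [/\ (j + m = n)%N, frame [:: vU; vA; A] s s',
  reg vA s' = j%:Z, reg vU s' = (B ^ j)%N%:Z &
  forall j' : nat, (j' <= j)%N -> get s' (A, j'%:Z) = (B ^ j')%N%:Z].
apply: (@triple_while _ Inv).
- exists 0%N; split=> //.
  + by do ![apply: frame_put_trans; first by rewrite !inE eqxx ?orbT].
  + by rewrite /reg; look.
  + by rewrite /reg; look; rewrite expn0.
  + move=> j'; rewrite leqn0 => /eqP->.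
    by do 2 (rewrite get_put_array; last by []); rewrite get_put_same expn0.
- move=> s' [j [jn f hA hU hj]]; rewrite /= (hn _ f).
  by move: hA; rewrite /reg => ->; rewrite -jn addn0 ltxx.
- move=> m s' [j [jn f hA hU hj]]; rewrite /= (hn _ f).
  by move: hA; rewrite /reg => ->; rewrite ltz_nat; lia.
- move=> m s' [j [jn f hA hU hj]]; rewrite /reg in hA hU.
  have hb : get s' (base, 0) = B%:Z.
    by rewrite f // !inE ![base == _]eq_sym Ub Ib Ab.
  apply: (@triple_assign _ (B ^ j.+1)%N%:Z).
    by rewrite /= hU hb -PoszM expnSr.
  apply: (@triple_assign _ j.+1%:Z).
    by rewrite /=; look; rewrite hA; lia.
  apply: (@triple_write _ j.+1%:Z (B ^ j.+1)%N%:Z); try by rewrite /=; look.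
  apply: triple_nil; exists j.+1; split.
  + by rewrite addSnnS.
  + by do ![apply: frame_put_trans; first by rewrite !inE eqxx ?orbT].
  + by rewrite /reg get_put_array //; look.
  + by rewrite /reg get_put_array //; look.
  move=> j'; rewrite leq_eqVlt => /orP[/eqP->|j'j]; first by rewrite get_put_same.
  rewrite get_put_index; first by rewrite !get_put_array // hj.
  by rewrite eqz_nat ltn_eqF.
move=> s' [j [jn f hA hU hj]]; rewrite addn0 in jn.
by apply: triple_nil; split=> //; rewrite -jn.
Qed.

(** * The range of the shape codes *)

Section Range.
Variables K N : nat.
Let M := N.+1.

Lemma digit_affine x q : digit M (N + M * x) q.+1 = digit M x q.
Proof.
by rewrite /digit expnS divnMA [(M * x)%N]mulnC addnC divnMDl // (divn_small (ltnSn N)) addn0.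
Qed.

Lemma affine_ltn x : (x < M ^ K)%N -> (N + M * x < M ^ K.+1)%N.
Proof. by move=> xK; rewrite expnS; move: xK; rewrite /M; nia. Qed.

(** Admissibility makes the digit at place [p] positive for a closing and less than [M - 1] for an
    opening, so there is neither borrow nor carry. This holds for every digit sequence, hence table
    look-ups never leave the tabulated cells. *)
Lemma successor_range (e : bool) x p : (x < M ^ K)%N -> (0 < p <= K)%N ->
  admissible M e (N + M * x) p ->
  (~~ e -> (M ^ p <= N + M * x)%N) /\
  exists2 x', (x' < M ^ K)%N & successor M e (N + M * x) p = (N + M * x')%N.
Proof.
case: p => // q xK /= qK; rewrite /admissible /successor.
case: e => /=; rewrite ?subn1 ?subn0 /=; last first.
  rewrite (digit_affine x q) => /(leq_ltn_trans (leq0n _)); rewrite /digit => h.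
  have qx : (M ^ q <= x)%N.
    by rewrite leqNgt; apply/negP => lt; move: h; rewrite (divn_small lt) mod0n.
  split=> [_|]; first by rewrite expnS; nia.
  exists (x - M ^ q)%N; first by apply: leq_ltn_trans xK; apply: leq_subr.
  by rewrite expnS mulnBr addnBA // leq_mul2l qx orbT.
rewrite digit_affine => h; split=> //.
have {}h : (digit M x q < N)%N.
  by apply: leq_trans h _; rewrite /digit -ltnS ltn_pmod.
exists (x + M ^ q)%N; last by rewrite expnS; nia.
have Mq : (0 < M ^ q)%N by rewrite expn_gt0.
have EK : (M ^ K = M * M ^ (K - q.+1) * M ^ q)%N.
  by rewrite -expnS -expnD; congr (_ ^ _)%N; lia.
move: h; rewrite /digit; set a := (x %/ M ^ q)%N => h.
have xa : (x < a.+1 * M ^ q)%N; first exact: ltn_ceil.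
have aK : (a < M * M ^ (K - q.+1))%N by rewrite /a ltn_divLR // -EK.
(* Equality would make the last base-[M] digit of [a] equal to [N], contrary to [h]; so adding
   [M ^ q] does not overflow. *)
have aK' : (a.+1 < M * M ^ (K - q.+1))%N.
  rewrite ltn_neqAle aK andbT; apply: contraTneq h => Ea.
  have -> : (a = (M ^ (K - q.+1)).-1 * M + N)%N.
    have : (0 < M ^ (K - q.+1))%N by rewrite expn_gt0.
    move: Ea; rewrite /M; nia.
  by rewrite modnMDl modn_small // ltnn.
rewrite EK; nia.
Qed.

End Range.

Definition vX := 15%N.

(* Sets the cell of the half-step [vH] and of the code [vC] from the cells of
   the half-step [vH + 1], and moves on to the next code. *)
Definition fill (K : nat) : program :=
  [:: Assign vU (Bin Add (Var vH) (Const 1));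
      Assign vU (Bin Mul (Var vU) (Var vY));
      Assign vU (Bin Add (Var vU) (Var vC));
      Assign vX (Read aT (Var vU));
      Assign vP (Atom (Const K%:Z));
      While Defs.Lt (Const 0) (Var vP)
        (weight false ++
         [:: Assign vX (Bin Add (Var vX) (Var vW));
             Assign vP (Bin Defs.Sub (Var vP) (Const 1))]);
      Assign vU (Bin Mul (Var vH) (Var vY));
      Assign vU (Bin Add (Var vU) (Var vC));
      Write aT (Var vU) (Var vX);
      Assign vC (Bin Add (Var vC) (Var vM))].

(** Codes start at [N] and advance by [M], so the inner loop visits [M ^ K] codes out of a block of
    [M ^ K.+1] addresses. The half-steps go backwards, since each is computed from the next. *)
Definition precompute (K : nat) : program :=
  [:: Assign vM (Bin Add (Var vN) (Const 1));
      Assign vV (Bin Add (Var vN) (Const 2))] ++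
  (powers aPowM vM (Const K.+1%:Z) ++
  ([:: Assign vY (Atom (Var vU))] ++
  (powers aPowB vV (Var vN) ++
  [:: Assign vH (Bin Add (Var vN) (Var vN));
      Assign vU (Bin Mul (Var vH) (Var vY));
      Assign vU (Bin Add (Var vU) (Var vN));
      Write aT (Var vU) (Const 1);
      While Defs.Lt (Const 0) (Var vH)
        [:: Assign vH (Bin Defs.Sub (Var vH) (Const 1));
            Assign vC (Atom (Var vN));
            While Defs.Lt (Var vC) (Var vY) (fill K)]]))).

Section Precompute.
Variables K N : nat.
Let M := N.+1.

Definition tabulated (s : store) (h x : nat) : Prop :=
  get s (aT, (h * M ^ K.+1 + (N + M * x))%N%:Z) =
  (completions K M (N.*2 - h) (N + M * x))%N%:Z.

Definition settings (s : store) : Prop :=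
  [/\ reg vN s = N%:Z, reg vM s = M%:Z, reg vY s = (M ^ K.+1)%N%:Z &
   forall j : nat, (j <= K.+1)%N -> get s (aPowM, j%:Z) = (M ^ j)%N%:Z].

Lemma settings_frame X s s' : vN \notin X -> vM \notin X -> vY \notin X ->
  aPowM \notin X -> frame X s s' -> settings s -> settings s'.
Proof.
by rewrite /settings /reg => nN nM nY nP f [h1 h2 h3 h4]; rewrite !f //; split=> // j /h4; rewrite f.
Qed.

Definition option_weight (h code p : nat) : nat :=
  if admissible M (odd h) code p
  then completions K M (N.*2 - h.+1) (successor M (odd h) code p) else 0.

(** The total number [N.*2] of half-steps is even, so the elapsed and the remaining half-steps have
    the same parity. *)
Lemma completions_sum h code : (h < N.*2)%N ->
  completions K M (N.*2 - h) code =
  (completions K M (N.*2 - h.+1) code + \sum_(1 <= p < K.+1) option_weight h code p)%N.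
Proof.
move=> hN; have -> : (N.*2 - h = (N.*2 - h.+1).+1)%N by lia.
have oE : odd (N.*2 - h.+1).+1 = odd h.
  by rewrite -subSn // subSS oddB ?odd_double // ltnW.
by rewrite completionsS oE.
Qed.

Lemma triple_weight_table b tb s h x p :
  (0 < p <= K)%N -> (x < M ^ K)%N -> 
  (forall j : nat, (j <= K.+1)%N -> get (source b tb s) (aPowM, j%:Z) = (M ^ j)%N%:Z) ->
  (forall x, (x < M ^ K)%N -> tabulated (source b tb s) h.+1 x) ->
  reg vH s = h%:Z -> reg vC s = (N + M * x)%N%:Z -> reg vP s = p%:Z ->
  reg vM s = M%:Z -> reg vY s = (M ^ K.+1)%N%:Z ->
  triple tb 20 (weight b) s (fun s' => frame weight_regs s s' /\
    reg vW s' = (option_weight h (N + M * x) p)%:Z).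
Proof.
move=> pK xK hP hT hH hC hp hM hY.
apply: triple_impl (triple_weight pK hP hH hC hp hM hY _).
  move=> s' [f ->]; split=> //; rewrite /option_weight; case: ifP => // adm.
  have [_ [x' x'K ->]] := successor_range xK pK adm.
  exact: hT.
by move=> adm od; have [h1 _] := successor_range xK pK adm; apply: h1.
Qed.

Definition fill_regs := [:: vU; vX; vP; vE; vA; vV; vW].

Lemma triple_fill tb s h x :
  (h < N.*2)%N -> (x < M ^ K)%N -> settings s ->
  reg vH s = h%:Z -> reg vC s = (N + M * x)%N%:Z ->
  (forall x', (x' < M ^ K)%N -> tabulated s h.+1 x') ->
  triple tb (5 + ((K * 23).+1 + 4)) (fill K) s (fun s' =>
    [/\ frame (vC :: aT :: fill_regs) s s', reg vC s' = (N + M * x.+1)%N%:Z,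
     tabulated s' h x & forall i : int, i != (h * M ^ K.+1 + (N + M * x))%N%:Z ->
       get s' (aT, i) = get s (aT, i)]).
Proof.
move=> hN xK set0 hH hC hT; have [sN sM sY sP] := set0; rewrite /reg in hH hC sN sM sY.
set code := (N + M * x)%N in hC *.
apply: (@triple_assign _ h.+1%:Z); first by rewrite /= hH; lia.
apply: (@triple_assign _ (h.+1 * M ^ K.+1)%N%:Z); first by rewrite /=; look; rewrite sY.
apply: (@triple_assign _ (h.+1 * M ^ K.+1 + code)%N%:Z); first by rewrite /=; look; rewrite hC.
apply: (@triple_assign _ (completions K M (N.*2 - h.+1) code)%N%:Z).
  by rewrite /=; look; apply: hT.
apply: triple_assign; first by reflexivity.
pose Inv p s' := [/\ frame fill_regs s s', reg vP s' = p%:Z, (p <= K)%N &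
  reg vX s' = (completions K M (N.*2 - h.+1) code +
               \sum_(p.+1 <= q < K.+1) option_weight h code q)%N%:Z].
have set1 s' : frame fill_regs s s' -> settings s' /\ 
  [/\ get s' (vH, 0) = h%:Z, get s' (vC, 0) = code%:Z &
      forall i, get s' (aT, i) = get s (aT, i)].
  by move=> f; split; [apply: settings_frame f set0|split=> *; rewrite f].
apply: (@triple_while _ Inv).
- split=> //; first by do ![apply: frame_put_trans => //].
    by rewrite /reg; look.
  by rewrite /reg; look; rewrite big_geq // addn0.
- by move=> s' [_ hp _ _]; move: hp; rewrite /= /reg => ->.
- by move=> p s' [_ hp _ _]; move: hp; rewrite /= /reg => ->.
- move=> p s' [f hp pK hX]; have [[tN tM tY tP] [tH tC tT]] := set1 _ f.
  have pK' : (0 < p.+1 <= K)%N by [].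
  apply: (triple_cat (t1 := 20) (t2 := 2)).
    apply: (triple_weight_table (b := false) (h := h) pK' xK) => //.
    by move=> x' /hT; rewrite /tabulated /= tT.
  move=> s1 [f1 hW]; rewrite /reg in hW.
  have fX : get s1 (vX, 0) = get s' (vX, 0) by rewrite f1.
  have fP : get s1 (vP, 0) = get s' (vP, 0) by rewrite f1.
  rewrite /reg in hX hp.
  apply: (@triple_assign _ (completions K M (N.*2 - h.+1) code +
               \sum_(p.+1 <= q < K.+1) option_weight h code q)%N%:Z).
    by rewrite /= fX hX hW -PoszD -addnA [X in (_ + X)%N]addnC -big_ltn.
  apply: (@triple_assign _ p%:Z); first by rewrite /=; look; rewrite fP hp; lia.
  apply: triple_nil; split; last 1 first.
  + by rewrite /reg; look.
  + do 2![apply: frame_put_trans => //]; apply: frame_trans f _.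
    exact: frame_sub f1.
  + by rewrite /reg; look.
  + exact: ltnW.
move=> s' [f hp _ hX]; have [[tN tM tY tP] [tH tC tT]] := set1 _ f.
rewrite /reg in hX tM tY.
apply: (@triple_assign _ (h * M ^ K.+1)%N%:Z); first by rewrite /= tH tY.
apply: (@triple_assign _ (h * M ^ K.+1 + code)%N%:Z); first by rewrite /=; look; rewrite tC.
apply: (@triple_write _ (h * M ^ K.+1 + code)%N%:Z (completions K M (N.*2 - h) code)%N%:Z).
- by rewrite /=; look.
- by rewrite /=; look; rewrite hX (completions_sum code hN).
apply: (@triple_assign _ (N + M * x.+1)%N%:Z).
  by rewrite /=; look; rewrite tC tM /code; lia.
apply: triple_nil; split.
- do ![apply: frame_put_trans => //]; exact: frame_sub f.
- by rewrite /reg; look.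
- by rewrite /tabulated; look.
- by move=> i ine; look; rewrite get_put_index //; look; rewrite tT.
Qed.

Definition tables (tb : store) : Prop :=
  [/\ forall j : nat, (j <= K.+1)%N -> get tb (aPowM, j%:Z) = (M ^ j)%N%:Z,
      forall j : nat, (j <= N)%N -> get tb (aPowB, j%:Z) = (M.+1 ^ j)%N%:Z &
      forall h x, (h <= N.*2)%N -> (x < M ^ K)%N -> tabulated tb h x].

Lemma table_index_inj h h' x x' : (x < M ^ K)%N -> (x' < M ^ K)%N ->
  (h * M ^ K.+1 + (N + M * x) = h' * M ^ K.+1 + (N + M * x'))%N -> h = h' /\ x = x'.
Proof.
move=> /affine_ltn lx /affine_ltn lx' E.
have Y0 : (0 < M ^ K.+1)%N by rewrite expn_gt0.
have hh : h = h'.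
  move/(congr1 (divn^~ (M ^ K.+1)%N)): E => /=.
  by rewrite !divnMDl // !divn_small // !addn0.
split=> //; move: E; rewrite hh => /addnI/addnI/eqP; rewrite eqn_mul2l.
by move/eqP.
Qed.

Definition precompute_time : nat :=
  2 + ((3 + ((K.+1 * 4).+1 + 0)) + (1 + ((3 + ((N * 4).+1 + 0)) +
    (4 + ((N.*2 * (2 + ((M ^ K * (5 + ((K * 23).+1 + 4)).+1).+1 + 0)).+1).+1 + 0))))).

Lemma triple_precompute tb :
  triple tb precompute_time (precompute K) (put [fmap]%fmap (0%N, 0) N%:Z) tables.
Proof.
set s0 := put _ _ _.
have s0N : get s0 (vN, 0) = N%:Z by rewrite /s0 get_put_same.
have s0T i : get s0 (aT, i) = 0 by rewrite /s0 get_put_array // /get fnd_fmap0.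
clearbody s0; rewrite /precompute /precompute_time; apply: triple_cat.
  apply: (@triple_assign _ M%:Z); first by rewrite /= s0N /M; lia.
  apply: (@triple_assign _ M.+1%:Z); first by rewrite /=; look; rewrite s0N /M; lia.
  exact: triple_nil (erefl _).
move=> _ <-; set s1 := put _ _ _.
have s1N : get s1 (vN, 0) = N%:Z by rewrite /s1; look.
have s1M : reg vM s1 = M%:Z by rewrite /s1 /reg; look.
have s1V : reg vV s1 = M.+1%:Z by rewrite /s1 /reg; look.
have s1T i : get s1 (aT, i) = 0 by rewrite /s1; look.
clearbody s1.
apply: triple_cat.
  apply: (triple_powers (A := aPowM) (base := vM) (n := K.+1) _ _ _ _ _ _ s1M) => //.
move=> s2 [f2 U2 P2]; apply: triple_cat.
  apply: triple_assign; first by exact: U2.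
  exact: triple_nil (erefl _).
move=> _ <-; set s3 := put _ _ _.
have s3N : get s3 (vN, 0) = N%:Z by rewrite /s3; look; rewrite f2.
have s3M : get s3 (vM, 0) = M%:Z by rewrite /s3; look; rewrite f2.
have s3V : reg vV s3 = M.+1%:Z by rewrite /s3 /reg; look; rewrite f2.
have s3Y : get s3 (vY, 0) = (M ^ K.+1)%N%:Z by rewrite /s3; look.
have s3T i : get s3 (aT, i) = 0 by rewrite /s3; look; rewrite f2.
have s3P (j : nat) : (j <= K.+1)%N -> get s3 (aPowM, j%:Z) = (M ^ j)%N%:Z.
  by move=> jK; rewrite /s3; look; apply: P2.
clearbody s3.
apply: triple_cat.
  apply: (triple_powers (A := aPowB) (base := vV) (n := N) _ _ _ _ _ _ s3V) => //.
  by move=> s' f; rewrite /= f.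
move=> s4 [f4 _ P4].
have s4N : get s4 (vN, 0) = N%:Z by rewrite f4.
have s4Y : get s4 (vY, 0) = (M ^ K.+1)%N%:Z by rewrite f4.
apply: (@triple_assign _ N.*2%:Z); first by rewrite /= s4N -PoszD addnn.
apply: (@triple_assign _ (N.*2 * M ^ K.+1)%N%:Z); first by rewrite /=; look; rewrite s4Y.
apply: (@triple_assign _ (N.*2 * M ^ K.+1 + N)%N%:Z); first by rewrite /=; look; rewrite s4N.
apply: (@triple_write _ (N.*2 * M ^ K.+1 + N)%N%:Z 1); try by rewrite /=; look.
pose Inv h s' := [/\ settings s', reg vH s' = h%:Z, (h <= N.*2)%N,
  forall j : nat, (j <= N)%N -> get s' (aPowB, j%:Z) = (M.+1 ^ j)%N%:Z &
  forall h' x, (h <= h' <= N.*2)%N -> (x < M ^ K)%N -> tabulated s' h' x].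
apply: (@triple_while _ Inv).
- split=> //.
  + split; rewrite /reg; look => //; first by rewrite f4.
    by move=> j jK; look; rewrite f4 ?s3P.
  + by rewrite /reg; look.
  + by move=> j jN; look; apply: P4.
  (* After the last half-step only the code [N] of the empty shape counts; the other cells were
     never written and read as 0. *)
  move=> h' x hh xK; have -> : h' = N.*2 by lia.
  rewrite /tabulated subnn /completions /= -[X in (_ == X)%N]addn0 eqn_add2l muln_eq0 /=.
  have [->|x0] := eqVneq x 0%N; first by rewrite muln0 addn0 get_put_same.
  rewrite get_put_index; first by look; rewrite f4.
  apply: contraNneq x0 => /eqP; rewrite eqz_nat => /eqP E.
  have := @table_index_inj N.*2 N.*2 x 0%N xK; rewrite muln0 addn0 expn_gt0.
  by case/(_ isT E) => _ ->.
- by move=> s' [_ hH _ _ _]; move: hH; rewrite /reg /= => ->.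
- by move=> h s' [_ hH _ _ _]; move: hH; rewrite /reg /= => ->.
- move=> h s' [[tN tM tY tP] tH hN tB tT]; rewrite /reg in tH tN tM tY.
  apply: (@triple_assign _ h%:Z); first by rewrite /= tH; lia.
  apply: (@triple_assign _ N%:Z); first by rewrite /=; look.
  set s5 := put (put _ _ _) _ _.
  have s5T i : get s5 (aT, i) = get s' (aT, i) by rewrite /s5; look.
  have set5 : settings s5.
    by split; rewrite /s5 /reg; look => // j jK; look; apply: tP.
  have set5' s'' : frame (vC :: aT :: fill_regs) s5 s'' -> settings s''.
    by move=> f; apply: settings_frame f set5.
  have s5H : get s5 (vH, 0) = h%:Z by rewrite /s5; look.
  (* The half-steps beyond [h] are complete, and half-step [h] is complete up to [x]. *)
  pose J m s'' := exists x, [/\ (x + m = M ^ K)%N, frame (vC :: aT :: fill_regs) s5 s'',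
    reg vC s'' = (N + M * x)%N%:Z & forall h' x', (h <= h' <= N.*2)%N -> (x' < M ^ K)%N ->
      (h == h') ==> (x' < x)%N -> tabulated s'' h' x'].
  have cond x : ((N + M * x)%N%:Z < (M ^ K.+1)%N%:Z) = (x < M ^ K)%N.
    rewrite ltz_nat; apply/idP/idP; last exact: affine_ltn.
    by rewrite expnS; apply: contraTT; rewrite -!leqNgt => le; nia.
  apply: (@triple_while _ J).
  + exists 0%N; rewrite add0n; split=> //; first by rewrite /s5 /reg; look; rewrite muln0 addn0.
    move=> h' x'; rewrite implybF leq_eqVlt => /andP[/orP[->//|hh'] h'N] x'K _.
    by rewrite /tabulated s5T; apply: tT; rewrite ?hh'.
  + move=> s'' [x [xm f hC _]]; have [_ _ hY _] := set5' _ f.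
    by move: hC hY; rewrite /reg /= => -> ->; rewrite cond -xm addn0 ltnn.
  + move=> m s'' [x [xm f hC _]]; have [_ _ hY _] := set5' _ f.
    by move: hC hY; rewrite /reg /= => -> ->; rewrite cond -xm; lia.
  + move=> m s'' [x [xm f hC hT]]; have set6 := set5' _ f.
    have xK : (x < M ^ K)%N by rewrite -xm; lia.
    have h6 : reg vH s'' = h%:Z by rewrite /reg f.
    apply: triple_impl (triple_fill _ hN xK set6 h6 hC _); last first.
      move=> x' x'K; apply: hT; rewrite ?leqnSn //.
      by rewrite ltn_eqF.
    move=> s7 [f7 C7 T7 R7]; exists x.+1; split=> //.
    * by rewrite addSnnS.
    * exact: frame_trans f f7.
    move=> h' x' hh x'K imp; have [Eh|nh] := eqVneq (h * M ^ K.+1 + (N + M * x))%N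
        (h' * M ^ K.+1 + (N + M * x'))%N.
      by have [<- <-] := table_index_inj xK x'K Eh.
    rewrite /tabulated R7; last by rewrite eqz_nat eq_sym.
    apply: hT => //; apply/implyP => /eqP Eh.
    move: imp; rewrite Eh eqxx /= ltnS leq_eqVlt => /orP[/eqP Ex|//].
    by rewrite Eh Ex eqxx in nh.
  move=> s'' [x [xm f hC hT]]; apply: triple_nil; split.
  + exact: set5' f.
  + by rewrite /reg f.
  + exact: ltnW.
  + by move=> j jN; rewrite f // /s5; look; apply: tB.
  by move=> h' x' hh x'K; apply: hT => //; rewrite -xm addn0 in x'K *; rewrite x'K implybT.
move=> s' [[_ _ _ tP] _ _ tB tT]; apply: triple_nil; split=> // h x hN xK.
Qed.

End Precompute.

(** * Generation *)

Definition vR := 16%N.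
Definition vD := 17%N.
Definition vQ := 18%N.
Definition vI := 19%N.
Definition vL := 20%N.
Definition vZ := 21%N.
Definition vS := 22%N.
Definition vT := 23%N.
Definition vG := 24%N.
Definition aRow := 25%N.
Definition aSum := 26%N.

(* Draws one of the options for the half-step [vH] by a sequence of binary
   draws: [vQ] is set to 0 for no change, to [r + 1] for a change in row [r]. *)
Definition pick_body : program :=
  weight true ++
  [:: Assign vA (Bin Defs.Sub (Var vR) (Var vW));
      Draw vD [:: Var vW; Var vA];
      If Defs.Eq (Var vD) (Const 0)
        [:: Assign vQ (Atom (Var vP)); Assign vP (Atom (Const 0))]
        [:: Assign vR (Atom (Var vA)); Assign vP (Bin Defs.Sub (Var vP) (Const 1))]].

Definition pick_option (K : nat) : program :=
  [:: Assign vA (Bin Mul (Var vH) (Var vY));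
      Assign vA (Bin Add (Var vA) (Var vC));
      Assign vR (Lookup aT (Var vA));
      Assign vQ (Atom (Const 0));
      Assign vP (Atom (Const K%:Z))] ++
  [:: While Defs.Lt (Const 0) (Var vP) pick_body].

Lemma ok_triple tb Q E t n p q s Post v : triple tb t p s Post ->
  (forall s', Post s' -> ok tb Q E n (q, s') v) -> ok tb Q E (t + n) (p ++ q, s) v.
Proof. by case=> s' e h hq; apply: e; apply: hq. Qed.

Lemma ok_while_true tb Q E n cmp a b p q s v :
  eval_comparison cmp (eval_operand s a) (eval_operand s b) ->
  ok tb Q E n (p ++ While cmp a b p :: q, s) v ->
  ok tb Q E n.+1 (While cmp a b p :: q, s) v.
Proof. by move=> c h; apply: ok_det h => //; rewrite /= c. Qed.

Lemma ok_while_false tb Q E n cmp a b p q s v :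
  eval_comparison cmp (eval_operand s a) (eval_operand s b) = false ->
  ok tb Q E n (q, s) v -> ok tb Q E n.+1 (While cmp a b p :: q, s) v.
Proof. by move=> c h; apply: ok_det h => //; rewrite /= c. Qed.

Definition pick_regs := [:: vQ; vR; vD; vP; vE; vA; vU; vV; vW].

Section Pick.
Variables (K N : nat) (tb : store) (Q : store -> Prop) (E : pred store).
Let M := N.+1.
Hypothesis tbT : tables K N tb.
Variables (s : store) (h x n : nat) (q : program) (c : nat -> nat).
Hypotheses (hN : (h < N.*2)%N) (xK : (x < M ^ K)%N).
Hypotheses (sM : reg vM s = M%:Z) (sY : reg vY s = (M ^ K.+1)%N%:Z).
Hypotheses (sH : reg vH s = h%:Z) (sC : reg vC s = (N + M * x)%N%:Z).

Definition choice_weight (p : nat) : nat :=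
  if p is 0 then completions K M (N.*2 - h.+1) (N + M * x)
  else option_weight K N h (N + M * x) p.

Hypothesis c0 : forall p, (p <= K)%N -> choice_weight p = 0%N -> c p = 0%N.
Hypothesis cont : forall p s', (p <= K)%N -> (0 < choice_weight p)%N ->
  frame pick_regs s s' -> reg vQ s' = p%:Z ->
  ok tb Q E n (q, s') ((c p)%:R / (choice_weight p)%:R).

Lemma choice_weight_sum :
  (\sum_(p < K.+1) choice_weight p = completions K M (N.*2 - h) (N + M * x))%N.
Proof.
rewrite completions_sum // big_ord_recl /=; congr (_ + _)%N.
by rewrite big_add1 /= big_mkord.
Qed.

(** [vR] holds the total weight of the options [0, ..., p] not yet rejected. Option [p] is accepted
    in proportion to its share of that total, and mixing the quotients [c / choice_weight] in these
    proportions gives the quotient of the sums. *)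
Lemma ok_pick_loop p s' : (p <= K)%N -> frame pick_regs s s' ->
  reg vP s' = p%:Z -> reg vQ s' = 0 ->
  reg vR s' = (\sum_(j < p.+1) choice_weight j)%N%:Z ->
  (0 < \sum_(j < p.+1) choice_weight j)%N ->
  ok tb Q E (p * 26 + n.+1) (While Defs.Lt (Const 0) (Var vP) pick_body :: q, s')
    ((\sum_(j < p.+1) c j)%:R / (\sum_(j < p.+1) choice_weight j)%:R).
Proof.
elim: p s' => [|p IH] s' pK f hP hQ hR pos.
  rewrite mul0n add0n; apply: ok_while_false; first by move: hP; rewrite /reg /= => ->.
  rewrite !big_ord1 in pos *; exact: cont.
rewrite mulSn -addnA -[26%N]/(1 + (20 + (1 + (1 + 3))))%N -!addnA add1n.
apply: ok_while_true; first by move: hP; rewrite /reg /= => ->.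
rewrite -catA; have [tP tB tT] := tbT.
apply: ok_triple.
  apply: (triple_weight_table (b := true) (K := K) (N := N) (h := h) (x := x) (p := p.+1)) => //;
    try by rewrite /reg f.
  by move=> x' x'K; apply: tT.
move=> s1 [f1 hW].
have f1' : frame pick_regs s s1 by apply: frame_trans f _; apply: frame_sub f1.
have hP1 : get s1 (vP, 0) = p.+1%:Z by rewrite f1.
have hQ1 : get s1 (vQ, 0) = 0 by rewrite f1.
have hR1 : get s1 (vR, 0) = (\sum_(j < p.+2) choice_weight j)%N%:Z by rewrite f1.
rewrite /reg in hW; rewrite -/(choice_weight p.+1) in hW.
set R := (\sum_(j < p.+1) choice_weight j)%N.
set C := (\sum_(j < p.+1) c j)%N.
rewrite !(big_ord_recr p.+1) /= -/R -/C in pos hR1 *.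
apply: (ok_triple (t := 1) (p := [:: Assign _ _])).
  apply: (@triple_assign _ R%:Z); first by rewrite /= hR1 hW PoszD addrK.
  exact: triple_nil (erefl _).
move=> _ <-.
(* A quotient with denominator 0 has the value 0; when a weight vanishes, [c0] makes its numerator
   vanish as well, so the identity survives. *)
have -> : (C + c p.+1)%:R / (R + choice_weight p.+1)%:R =
  ((choice_weight p.+1)%:R * ((c p.+1)%:R / (choice_weight p.+1)%:R) + R%:R * (C%:R / R%:R))
   / (choice_weight p.+1 + R)%:R :> rat.
  rewrite addnC [(R + _)%N]addnC; congr (_ / _); rewrite natrD; congr (_ + _).
    case: (posnP (choice_weight p.+1)) => [w0|wpos]; first by rewrite w0 c0 // mul0r.
    by rewrite mulrC divfK // pnatr_eq0 -lt0n.
  case: (posnP R) => [R0|Rpos].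
    rewrite R0 mul0r /C big1 // => j _; apply: c0; first exact: leq_trans (leq_ord j) (ltnW pK).
    by move/eqP: R0; rewrite /R sum_nat_eq0 => /forallP/(_ j)/eqP.
  by rewrite mulrC divfK // pnatr_eq0 -lt0n.
rewrite [(1 + (3 + _))%N]add1n.
apply: ok_draw.
- by rewrite /=; look; rewrite hW.
- by rewrite /=; look.
- by rewrite addnC.
(* Acceptance sets [vP] to 0, so the loop ends early and the rest of the time budget is left
   over. *)
- move=> wpos; apply: (@ok_le _ _ _ (3 + n.+1)); first by lia.
  apply: (ok_triple (p := [:: If _ _ _ _ _]) (Post := fun s2 =>
    [/\ frame pick_regs s s2, reg vP s2 = 0 & reg vQ s2 = p.+1%:Z])) => [|s2]; last first.
    case=> f2 hP2 hQ2; apply: ok_while_false; last exact: (cont pK wpos) f2 hQ2.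
    by move: hP2; rewrite /reg /= => ->.
  apply: (@triple_if _ true); first by rewrite /=; look.
  rewrite /=; apply: triple_assign; first by rewrite /=; look; exact: hP1.
  apply: triple_assign; first by rewrite /=; reflexivity.
  apply: triple_nil; rewrite /reg; split; try by look.
  by do ![apply: frame_put_trans => //].
move=> Rpos.
apply: (ok_triple (p := [:: If _ _ _ _ _]) (Post := fun s2 =>
  [/\ frame pick_regs s s2, reg vP s2 = p%:Z, reg vQ s2 = 0 & reg vR s2 = R%:Z]))
  => [|s2]; last first.
  case=> f2 hP2 hQ2 hR2; exact: (IH s2 (ltnW pK) f2 hP2 hQ2 hR2 Rpos).
apply: (@triple_if _ false); first by rewrite /=; look.
rewrite /=; apply: (@triple_assign _ R%:Z); first by rewrite /=; look.
apply: (@triple_assign _ p%:Z); first by rewrite /=; look; rewrite hP1; lia.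
apply: triple_nil; rewrite /reg; split; try by look.
by do ![apply: frame_put_trans => //].
Qed.

Definition pick_time := (6 + K * 26)%N.

Lemma ok_pick : (0 < completions K M (N.*2 - h) (N + M * x))%N ->
  ok tb Q E (pick_time + n) (pick_option K ++ q, s)
    ((\sum_(p < K.+1) c p)%:R / (completions K M (N.*2 - h) (N + M * x))%:R).
Proof.
move=> pos; have [tP tB tT] := tbT.
rewrite -choice_weight_sum in pos *.
have -> : (pick_time + n = 5 + (K * 26 + n.+1))%N by rewrite /pick_time; lia.
rewrite /pick_option -catA.
apply: (ok_triple (Post := fun s1 => [/\ frame pick_regs s s1, reg vP s1 = K%:Z,
  reg vQ s1 = 0 & reg vR s1 = (\sum_(j < K.+1) choice_weight j)%N%:Z])) => [|s1]; last first.
  case=> f1 hP1 hQ1 hR1; exact: (ok_pick_loop (leqnn K) f1 hP1 hQ1 hR1 pos).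
move: (sM) (sY) (sH) (sC); rewrite /reg => tM tY tH tC.
apply: (@triple_assign _ (h * M ^ K.+1)%N%:Z); first by rewrite /= tH tY.
apply: (@triple_assign _ (h * M ^ K.+1 + (N + M * x))%N%:Z); first by rewrite /=; look; rewrite tC.
apply: (@triple_assign _ (\sum_(j < K.+1) choice_weight j)%N%:Z).
  by rewrite /=; look; rewrite tT ?(ltnW hN) // choice_weight_sum.
apply: triple_assign; first by reflexivity.
apply: triple_assign; first by reflexivity.
apply: triple_nil; rewrite /reg; split; try by look.
by do ![apply: frame_put_trans => //].
Qed.

End Pick.

(** [vX] moves up into the row with index [vZ - 1]. Its rank there, less one, is the position of the
    entry [vG] that it replaces, and the power sum is corrected by the same exchange. Then [vG]
    takes over the role of [vX]. *)
Definition bump_body : program :=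
  [:: Assign vA (Lookup aPowB (Var vX));
      Assign vS (Read aSum (Var vZ));
      Assign vT (Bin Mod (Var vS) (Var vA));
      Assign vT (Bin Mod (Var vT) (Var vM));
      Assign vT (Bin Defs.Sub (Var vT) (Const 1));
      Assign vU (Bin Mul (Var vZ) (Var vM));
      Assign vU (Bin Add (Var vU) (Var vT));
      Assign vG (Read aRow (Var vU));
      Write aRow (Var vU) (Var vX);
      Assign vS (Bin Add (Var vS) (Var vA));
      Assign vA (Lookup aPowB (Var vG));
      Assign vS (Bin Defs.Sub (Var vS) (Var vA));
      Write aSum (Var vZ) (Var vS);
      Assign vX (Atom (Var vG));
      Assign vZ (Bin Defs.Sub (Var vZ) (Const 1))].

(** Once the code is decreased, its digit at place [vQ] is the new length of the row, hence the
    position of the cell to vacate. When the loop ends, [vX] is the ejected opener; it is increased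
    by one because [aOut] is indexed from 1. *)
Definition close_arc : program :=
  [:: Assign vS (Lookup aPowM (Var vQ));
      Assign vC (Bin Defs.Sub (Var vC) (Var vS));
      Assign vT (Bin Div (Var vC) (Var vS));
      Assign vT (Bin Mod (Var vT) (Var vM));
      Assign vA (Bin Mul (Var vQ) (Var vM));
      Assign vA (Bin Add (Var vA) (Var vT));
      Assign vX (Read aRow (Var vA));
      Assign vS (Read aSum (Var vQ));
      Assign vA (Lookup aPowB (Var vX));
      Assign vS (Bin Defs.Sub (Var vS) (Var vA));
      Write aSum (Var vQ) (Var vS);
      Assign vZ (Bin Defs.Sub (Var vQ) (Const 1));
      While Defs.Lt (Const 0) (Var vZ) bump_body;
      Assign vX (Bin Add (Var vX) (Const 1));
      Assign vL (Read aOut (Var vX))].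

Definition open_arc : program :=
  [:: Assign vS (Lookup aPowM (Var vQ));
      Assign vT (Bin Div (Var vC) (Var vS));
      Assign vT (Bin Mod (Var vT) (Var vM));
      Assign vA (Bin Mul (Var vQ) (Var vM));
      Assign vA (Bin Add (Var vA) (Var vT));
      Write aRow (Var vA) (Var vI);
      Assign vC (Bin Add (Var vC) (Var vS));
      Assign vS (Read aSum (Var vQ));
      Assign vA (Lookup aPowB (Var vI));
      Assign vS (Bin Add (Var vS) (Var vA));
      Write aSum (Var vQ) (Var vS)].

Section Rows.
Variables K N : nat.
Let M := N.+1.

(* Row [r] is stored in the cells [(r + 1) M, (r + 1) M + 1, ...] of [aRow]. *)
Definition row_stored (s : store) (r : nat) (R : seq nat) : Prop :=
  (forall p, (p < size R)%N -> get s (aRow, (r.+1 * M + p)%N%:Z) = (nth 0%N R p)%:Z) /\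
  get s (aSum, r.+1%:Z) = (weight_sum M.+1 R)%:Z.

Lemma row_index_inj r r' p p' : (p < M)%N -> (p' < M)%N ->
  (r.+1 * M + p = r'.+1 * M + p')%N -> r = r' /\ p = p'.
Proof.
move=> pM pM' E; have Er : r = r'.
  move/(congr1 (divn^~ M)): E => /=.
  by rewrite !divnMDl // !divn_small // !addn0 => -[].
by split=> //; move: E; rewrite Er => /addnI.
Qed.

Definition row_update (s s' : store) (r p : nat) : Prop :=
  (forall i, i != (r.+1 * M + p)%N%:Z -> get s' (aRow, i) = get s (aRow, i)) /\
  (forall i, i != r.+1%:Z -> get s' (aSum, i) = get s (aSum, i)).

Lemma row_stored_other s s' r p q R : row_update s s' r p -> (p < M)%N ->
  q != r -> (size R <= N)%N -> row_stored s q R -> row_stored s' q R.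
Proof.
move=> [u1 u2] pM qr sR [h1 h2]; split.
  move=> j jR; rewrite u1 ?h1 //; rewrite eqz_nat; apply: contraNneq qr => E.
  by have [->] := row_index_inj (leq_trans jR (leqW sR)) pM E.
by rewrite u2 // eqz_nat eqSS.
Qed.

Lemma row_stored_set s s' r R1 R2 x x' : row_update s s' r (size R1) ->
  (size (R1 ++ x' :: R2) <= N)%N -> row_stored s r (R1 ++ x' :: R2) ->
  get s' (aRow, (r.+1 * M + size R1)%N%:Z) = x%:Z ->
  get s' (aSum, r.+1%:Z) = (weight_sum M.+1 (R1 ++ x :: R2))%:Z ->
  row_stored s' r (R1 ++ x :: R2).
Proof.
move=> [u1 _] sR [h1 _] E1 E2; split=> // j; rewrite size_cat /= => jR.
rewrite size_cat /= in sR.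
have [->|jn] := eqVneq j (size R1); first by rewrite E1 nth_cat ltnn subnn.
rewrite u1; last first.
  rewrite eqz_nat; apply: contraNneq jn => E.
  have jM : (j < M)%N by rewrite /M; lia.
  have RM : (size R1 < M)%N by rewrite /M; lia.
  by have [_ ->] := row_index_inj jM RM E.
rewrite h1 ?size_cat // !nth_cat; case: ifP => // jR1.
by case E: (j - size R1)%N => [|k] //=; move: jn jR1 E => /eqP; lia.
Qed.

Lemma row_stored_frame X s s' r R : aRow \notin X -> aSum \notin X ->
  frame X s s' -> row_stored s r R -> row_stored s' r R.
Proof.
move=> nR nS f [h1 h2]; split; last by rewrite f.
by move=> p pR; rewrite f ?h1.
Qed.

Definition bump_regs := [:: aRow; aSum; vA; vS; vT; vU; vG; vX; vZ].

(* [Lf] is the tableau at the end of the deletion; the rows above row [m] are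
   still those of the initial tableau. *)
Definition bumping (i y : nat) (Lf : tableau) (m x : nat) (s : store) : Prop :=
  if m is r.+1 then exists A D D1,
    [/\ desc (A ++ (x, r) :: D), all (fun v => (v < i)%N) (vals (A ++ (x, r) :: D)),
        del r D = Some (y, D1) /\ Lf = A ++ (x, r) :: D1,
        forall q, (q <= r)%N -> row_stored s q (trow q (A ++ D)) &
        forall q, (r < q < K)%N -> row_stored s q (trow q Lf)]
  else x = y /\ forall q, (q < K)%N -> row_stored s q (trow q Lf).

Lemma triple_bump tb s i y Lf r x : tables K N tb -> (i <= N)%N -> (r < K)%N ->
  reg vM s = M%:Z -> reg vZ s = r.+1%:Z -> reg vX s = x%:Z ->
  bumping i y Lf r.+1 x s ->
  triple tb 15 bump_body s (fun s' => [/\ frame bump_regs s s', reg vZ s' = r%:Z &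
    exists2 x' : nat, reg vX s' = x'%:Z & bumping i y Lf r x' s']).
Proof.
move=> [_ tB _] iN rK hM hZ hX [A [D [D1 [dL aL [E ELf] hlow hhigh]]]].
rewrite /reg in hM hZ hX.
have [x' [D' [R1 [R2 [ER ER' cR next]]]]] := bump_step dL E.
have [hR hS] := hlow r (leqnn r).
set R := trow r (A ++ D) in ER cR hR hS.
have sAD q : (size (trow q (A ++ D)) < i)%N.
  rewrite size_trow; apply: leq_ltn_trans (cnt_size _ _) _.
  by have := desc_size dL aL; rewrite !size_cat /= addnS.
have xi : (x < i)%N by apply: (allP aL); rewrite /vals map_cat mem_cat mem_head orbT.
have x'R : x' \in R by rewrite ER mem_cat mem_head orbT.
have x'i : (x' < i)%N.
  apply: (allP aL); have := mem_trow x'R.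
  by rewrite /vals !map_cat !mem_cat inE => /orP[->//|->]; rewrite !orbT.
have uR : uniq R.
  apply: trow_uniq; apply: subseq_sorted dL.
    by move=> a b c /= h1 h2; apply: ltn_trans h2 h1.
  by rewrite /vals !map_cat /=; apply: cat_subseq (subseq_refl _) (subseq_cons _ _).
have sR1 : (size R1 < N)%N.
  by have := sAD r; rewrite -/R ER size_cat /=; lia.
have cRM : (count (fun v => (v < x)%N) R < M)%N by rewrite cR /M ltnS.
apply: (@triple_assign _ (M.+1 ^ x)%N%:Z).
  by rewrite /= hX tB // ltnW // (leq_trans xi).
apply: (@triple_assign _ (weight_sum M.+1 R)%:Z); first by rewrite /=; look; rewrite hZ hS.
apply: (@triple_assign _ (weight_sum M.+1 R %% M.+1 ^ x)%N%:Z).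
  by rewrite /=; look; rewrite modz_nat.
apply: (@triple_assign _ (size R1).+1%:Z).
  by rewrite /=; look; rewrite hM modz_nat rank_mod // cR.
apply: (@triple_assign _ (size R1)%:Z); first by rewrite /=; look; lia.
apply: (@triple_assign _ (r.+1 * M)%N%:Z); first by rewrite /=; look; rewrite hZ hM.
apply: (@triple_assign _ (r.+1 * M + size R1)%N%:Z); first by rewrite /=; look.
apply: (@triple_assign _ x'%:Z).
  rewrite /=; look; rewrite hR ?ER ?nth_cat ?ltnn ?subnn // size_cat /=; lia.
apply: (@triple_write _ (r.+1 * M + size R1)%N%:Z x%:Z); try by rewrite /=; look.
apply: (@triple_assign _ (weight_sum M.+1 R + M.+1 ^ x)%N%:Z); first by rewrite /=; look.
apply: (@triple_assign _ (M.+1 ^ x')%N%:Z).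
  by rewrite /=; look; rewrite tB // ltnW // (leq_trans x'i).
apply: (@triple_assign _ (weight_sum M.+1 (trow r Lf))%:Z).
  rewrite /=; look; rewrite ELf ER' ER !weight_sum_cat !weight_sum_cons; lia.
apply: (@triple_write _ r.+1%:Z (weight_sum M.+1 (trow r Lf))%:Z); try by rewrite /=; look.
apply: (@triple_assign _ x'%:Z); first by rewrite /=; look.
apply: (@triple_assign _ r%:Z); first by rewrite /=; look; rewrite hZ; lia.
set s' := put _ _ _.
have upd : row_update s s' r (size R1).
  by split=> j jn; rewrite /s'; look; rewrite get_put_index //; look.
have sL q : (size (trow q (A ++ D)) <= N)%N by apply: leq_trans (ltnW (sAD q)) iN.
have sLf q : (r < q)%N -> (size (trow q Lf) <= N)%N.
  move=> rq; rewrite ELf trow_cat trow_cons /= ltn_eqF // cats0 (del_trow E rq).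
  by rewrite -trow_cat; apply: sL.
have new : row_stored s' r (trow r Lf).
  rewrite ELf ER'; apply: (row_stored_set (x' := x') upd).
  - by rewrite -ER; apply: sL.
  - by rewrite -ER; split.
  - by rewrite /s'; look.
  by rewrite /s'; look; rewrite ELf ER'.
have R1M : (size R1 < M)%N by rewrite /M; lia.
have old q : (r <= q < K)%N -> row_stored s' q (trow q Lf).
  case/andP; rewrite leq_eqVlt => /orP[/eqP<- //|rq qK].
  apply: (row_stored_other upd) => //; first by rewrite gtn_eqF.
    exact: sLf.
  by apply: hhigh; rewrite rq.
apply: triple_nil; split.
- by do ![apply: frame_put_trans => //].
- by rewrite /s' /reg; look.
exists x'; first by rewrite /s' /reg; look.
case: r rK hZ hlow hhigh dL aL E ELf R ER ER' cR next hR hS sL uR {xi x'i x'R sR1 cRM}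
  s' upd sLf new R1M old {sAD}
  => [|r] rK hZ hlow hhigh dL aL E ELf R ER ER' cR next hR hS sL uR s' upd sLf new R1M old /=.
  by split.
have [A2 [D1' [E' ELf' EV EQ]]] := next.
exists A2, D', D1'; split.
- by rewrite /desc EV.
- by rewrite EV.
- by rewrite ELf.
- move=> q qr; rewrite -EQ //; apply: (row_stored_other upd) => //.
    by rewrite ltn_eqF.
  by apply: hlow; apply: leqW.
- by move=> q /old.
Qed.

End Rows.

Section Generate.
Variables K N : nat.
Let M := N.+1.

Definition constants (s : store) : Prop :=
  [/\ reg vN s = N%:Z, reg vM s = M%:Z & reg vY s = (M ^ K.+1)%N%:Z].

Definition represents (s : store) (h i : nat) (L : tableau) (l : seq nat) : Prop :=
  [/\ constants s,
      [/\ reg vH s = h%:Z, reg vI s = i%:Z & reg vC s = (shape_code K N L)%:Z],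
      forall r, (r < K)%N -> row_stored N s r (trow r L) &
      forall j, (j < size l)%N -> get s (aOut, j.+1%:Z) = (nth 0%N l j)%:Z].

Lemma represents_frame X s s' h i L l :
  all (fun A => A \notin X) [:: vN; vM; vY; vH; vI; vC; aRow; aSum; aOut] ->
  frame X s s' -> represents s h i L l -> represents s' h i L l.
Proof.
move=> /and5P[xN xM xY xH /and5P[xI xC xR xS /andP[xO _]]] f.
case=> [[cN cM cY] [cH cI cC] hR hO]; split.
- by split; rewrite /reg f.
- by split; rewrite /reg f.
- by move=> r /hR; apply: row_stored_frame f.
- by move=> j /hO; rewrite f.
Qed.

(** The first move of a deletion differs from the later bumps: the row gives up its last entry and
    receives nothing in exchange. *)
Lemma trow_del_last r y L L1 : del r L = Some (y, L1) ->
  exists x, trow r L = trow r L1 ++ [:: x] /\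
    if r is r'.+1 then exists A D D1,
      [/\ vals (A ++ (x, r') :: D) = vals L, del r' D = Some (y, D1),
          L1 = A ++ (x, r') :: D1 & forall q, (q <= r')%N -> trow q (A ++ D) = trow q L]
    else y = x.
Proof.
move=> E; have [A [x [D [-> hA h]]]] := del_split E; exists x.
rewrite trow_cat trow_cons /= eqxx (trow_nil hA) cats0.
case: r {E} hA h => [|r] hA.
  by case=> -> ->; rewrite trow_cat (trow_nil hA) cats0.
case=> D1 E ->; split.
  by rewrite trow_cat trow_cons /= ltn_eqF // (trow_nil hA) !cats0 (del_trow E).
exists A, D, D1; split=> // [|q qr]; first by rewrite /vals !map_cat.
by rewrite !trow_cat trow_cons /= gtn_eqF // cats0.
Qed.

Lemma bumping_start s i L r y L1 x : legit K i L -> del r L = Some (y, L1) -> (r < K)%N ->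
  (if r is r'.+1 then exists A D D1,
      [/\ vals (A ++ (x, r') :: D) = vals L, del r' D = Some (y, D1),
          L1 = A ++ (x, r') :: D1 & forall q, (q <= r')%N -> trow q (A ++ D) = trow q L]
    else y = x) ->
  row_stored N s r (trow r L1) ->
  (forall q, q != r -> (q < K)%N -> row_stored N s q (trow q L)) ->
  bumping K N i y L1 r x s.
Proof.
case/and4P=> dL _ vL _; case: r => [|r] E rK /=.
  move=> -> row_r row_q; split=> // q qK; have [->//|q0] := eqVneq q 0%N.
  by rewrite (del_trow E) ?lt0n //; apply: row_q.
case=> A [D [D1 [EV ED EL1 EQ]]] row_r row_q; exists A, D, D1; split=> //.
- by rewrite /desc EV.
- by rewrite EV.
- by move=> q qr; rewrite EQ //; apply: row_q; [rewrite ltn_eqF | apply: leq_trans rK; apply: leqW].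
- move=> q /andP[]; rewrite leq_eqVlt => /orP[/eqP<- //|rq qK].
  by rewrite (del_trow E) //; apply: row_q; rewrite ?gtn_eqF.
Qed.

Definition close_regs := [:: aRow; aSum; vA; vS; vT; vU; vG; vX; vZ; vC; vL].

Definition close_time := (15 + K * 16)%N.

Lemma triple_close tb s h i L l r y L1 : tables K N tb -> (i <= N)%N ->
  legit K i L -> (r < K)%N -> (cnt L r.+1 < cnt L r)%N -> del r L = Some (y, L1) ->
  size l = i -> represents s h i L l -> reg vQ s = r.+1%:Z ->
  triple tb close_time close_arc s (fun s' =>
    [/\ frame close_regs s s', represents s' h i L1 l & reg vL s' = (nth 0%N l y)%:Z]).
Proof.
move=> tbT iN lL rK gr E sl rep hQ; have [tP tB _] := tbT.
have [y' [L1' [E' yi _ lL1]]] := legit_del lL gr.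
move: E' yi lL1; rewrite E => -[<- <-] {y' L1'} yi lL1.
have [[cN cM cY] [cH cI cC] hR hO] := rep.
have /and4P[dL _ vL _] := lL.
have szL : (size L <= i)%N := desc_size dL vL.
have EC : shape_code K N L = (shape_code K N L1 + M ^ r.+1)%N.
  apply: encode_incr => // -[|q] /=; first by rewrite addn0.
  by rewrite (del_cnt q E) eqSS.
have dC : digit M (shape_code K N L1) r.+1 = cnt L1 r by rewrite (digit_shape r.+1 lL1 iN).
have [x [Er next]] := trow_del_last E.
have xi : (x < i)%N.
  by apply: (allP vL); apply: (@mem_trow r); rewrite Er mem_cat mem_head orbT.
have [hr1 hr2] := hR r rK.
rewrite /reg in hQ cN cM cY cH cI cC.
apply: (@triple_le _ (12 + ((r * 16).+1 + 2))); first by rewrite /close_time; lia.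
apply: (@triple_assign _ (M ^ r.+1)%N%:Z); first by rewrite /= hQ (tP _ (leqW rK)).
apply: (@triple_assign _ (shape_code K N L1)%:Z).
  by rewrite /=; look; rewrite cC EC PoszD addrK.
apply: triple_assign; first by rewrite /=; look; reflexivity.
apply: (@triple_assign _ (cnt L1 r)%:Z); first by rewrite /=; look; rewrite cM divzM_pow dC.
apply: (@triple_assign _ (r.+1 * M)%N%:Z); first by rewrite /=; look; rewrite hQ cM.
apply: (@triple_assign _ (r.+1 * M + cnt L1 r)%N%:Z); first by rewrite /=; look.
apply: (@triple_assign _ x%:Z).
  rewrite /=; look; rewrite hr1 Er -size_trow ?size_cat ?addn1 //.
  by rewrite nth_cat ltnn subnn.
apply: (@triple_assign _ (weight_sum M.+1 (trow r L))%:Z).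
  by rewrite /=; look; rewrite hQ hr2.
apply: (@triple_assign _ (M.+1 ^ x)%N%:Z).
  by rewrite /=; look; rewrite tB // ltnW // (leq_trans xi).
apply: (@triple_assign _ (weight_sum M.+1 (trow r L1))%:Z).
  rewrite /=; look; rewrite Er weight_sum_cat PoszD.
  by rewrite /weight_sum big_seq1 addrK.
apply: (@triple_write _ r.+1%:Z (weight_sum M.+1 (trow r L1))%:Z); try by rewrite /=; look.
apply: (@triple_assign _ r%:Z); first by rewrite /=; look; rewrite hQ; lia.
set s1 := put _ _ _.
have f1 : frame close_regs s s1 by do ![apply: frame_put_trans => //].
have C1 : get s1 (vC, 0) = (shape_code K N L1)%:Z by rewrite /s1; look.
have Z1 : reg vZ s1 = r%:Z by rewrite /s1 /reg; look.
have X1 : reg vX s1 = x%:Z by rewrite /s1 /reg; look.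
(* The removed entry is not erased: its cell now lies beyond the end of the row, where [row_stored]
   imposes nothing. *)
have row_r : row_stored N s1 r (trow r L1).
  split; last by rewrite /s1; look.
  move=> p pR; rewrite /s1; look; rewrite hr1 Er ?nth_cat ?pR // size_cat.
  exact: leq_trans pR (leq_addr _ _).
have row_q q R : q != r -> row_stored N s q R -> row_stored N s1 q R.
  move=> qr [g1 g2]; split; first by move=> p /g1 <-; rewrite /s1; look.
  by rewrite /s1; look; rewrite get_put_index ?eqz_nat ?eqSS //; look.
have b1 : bumping K N i y L1 r x s1.
  by apply: (bumping_start lL E rK next row_r) => q qr qK; apply/row_q/hR.
clearbody s1.
pose Inv m s' := [/\ (m <= r)%N, frame close_regs s1 s', reg vZ s' = m%:Z,
  get s' (vC, 0) = (shape_code K N L1)%:Z & 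
  exists2 x, reg vX s' = x%:Z & bumping K N i y L1 m x s'].
apply: (@triple_while _ Inv).
- by split=> //; exists x.
- by move=> s' [_ _ hZ _ _]; move: hZ; rewrite /reg /= => ->.
- by move=> m s' [_ _ hZ _ _]; move: hZ; rewrite /reg /= => ->.
- move=> m s' [mr f hZ hC [x' hX b]].
  have hM : reg vM s' = M%:Z by rewrite /reg f // f1.
  apply: triple_impl (triple_bump tbT iN (leq_trans mr (ltnW rK)) hM hZ hX b).
  move=> s2 [f2 Z2 b2]; split=> //; first exact: ltnW.
    by apply: frame_trans f _; apply: frame_sub f2.
  by rewrite f2.
move=> s' [_ f _ hC [x' hX [Exy rows]]].
rewrite /reg in hX; rewrite Exy in hX.
have f' : frame close_regs s s' := frame_trans f1 f.
apply: (@triple_assign _ y.+1%:Z); first by rewrite /= hX; lia.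
apply: (@triple_assign _ (nth 0%N l y)%:Z); first by rewrite /=; look; rewrite f' // hO // sl.
apply: triple_nil; split; last by rewrite /reg; look.
  by do ![apply: frame_put_trans => //].
split.
- by split; rewrite /reg; look; rewrite f'.
- by split; rewrite /reg; look; [rewrite f'|rewrite f'|exact: hC].
- move=> q /rows [g1 g2]; split; last by look.
  by move=> p /g1 <-; look.
- by move=> j jl; look; rewrite f' // hO.
Qed.

Definition open_regs := [:: aRow; aSum; vA; vS; vT; vC].

Lemma triple_open tb s h i L l r : tables K N tb -> (i < N)%N ->
  legit K i L -> (r < K)%N -> represents s h i L l -> reg vQ s = r.+1%:Z ->
  triple tb 11 open_arc s (fun s' =>
    frame open_regs s s' /\ represents s' h i ((i, r) :: L) l).
Proof.
move=> tbT iN lL rK rep hQ; have [tP tB _] := tbT.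
have [[cN cM cY] [cH cI cC] hR hO] := rep.
have /and4P[dL _ vL _] := lL.
have szL : (size L <= i)%N := desc_size dL vL.
have EC : shape_code K N ((i, r) :: L) = (shape_code K N L + M ^ r.+1)%N.
  apply: encode_incr => // -[|q] /=; first by rewrite addn0.
  by rewrite cnt_cons eqSS eq_sym addnC.
have dC : digit M (shape_code K N L) r.+1 = cnt L r by rewrite (digit_shape r.+1 lL (ltnW iN)).
have [hr1 hr2] := hR r rK.
rewrite /reg in hQ cN cM cY cH cI cC.
apply: (@triple_assign _ (M ^ r.+1)%N%:Z); first by rewrite /= hQ (tP _ (leqW rK)).
apply: triple_assign; first by rewrite /=; look; rewrite cC; reflexivity.
apply: (@triple_assign _ (cnt L r)%:Z); first by rewrite /=; look; rewrite cM divzM_pow dC.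
apply: (@triple_assign _ (r.+1 * M)%N%:Z); first by rewrite /=; look; rewrite hQ cM.
apply: (@triple_assign _ (r.+1 * M + cnt L r)%N%:Z); first by rewrite /=; look.
apply: (@triple_write _ (r.+1 * M + cnt L r)%N%:Z i%:Z); try by rewrite /=; look.
apply: (@triple_assign _ (shape_code K N ((i, r) :: L))%:Z).
  by rewrite /=; look; rewrite cC EC.
apply: (@triple_assign _ (weight_sum M.+1 (trow r L))%:Z).
  by rewrite /=; look; rewrite hQ hr2.
apply: (@triple_assign _ (M.+1 ^ i)%N%:Z); first by rewrite /=; look; rewrite cI tB // ltnW.
apply: (@triple_assign _ (weight_sum M.+1 (trow r ((i, r) :: L)))%:Z).
  rewrite /=; look; rewrite trow_cons /= eqxx weight_sum_cat PoszD.
  by rewrite {3}/weight_sum big_seq1.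
apply: (@triple_write _ r.+1%:Z (weight_sum M.+1 (trow r ((i, r) :: L)))%:Z); try by rewrite /=; look.
set s1 := put _ _ _.
have f1 : frame open_regs s s1 by do ![apply: frame_put_trans => //].
have upd : row_update N s s1 r (cnt L r).
  by split=> j jn; rewrite /s1; look; rewrite get_put_index //; look.
have C1 : get s1 (vC, 0) = (shape_code K N ((i, r) :: L))%:Z by rewrite /s1; look.
have row_r : row_stored N s1 r (trow r ((i, r) :: L)).
  split; last by rewrite /s1; look.
  rewrite trow_cons /= eqxx => p; rewrite size_cat addn1 ltnS leq_eqVlt => /orP[/eqP->|pR].
    by rewrite nth_cat ltnn subnn /= size_trow /s1; look.
  rewrite nth_cat pR -hr1 //; apply: upd.1; rewrite eqz_nat eqn_add2l.
  by rewrite -size_trow ltn_eqF.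
clearbody s1; apply: triple_nil; split=> //; split.
- by split; rewrite /reg f1.
- by split; rewrite /reg; [rewrite f1|rewrite f1|exact: C1].
- move=> q qK; have [->//|qr] := eqVneq q r.
  have -> : trow q ((i, r) :: L) = trow q L by rewrite trow_cons /= eq_sym (negbTE qr) cats0.
  apply: (row_stored_other upd) (hR q qK) => //.
    by rewrite ltnS; apply: leq_trans (cnt_size _ _) _; apply: leq_trans szL (ltnW iN).
  by rewrite size_trow; apply: leq_trans (cnt_size _ _) _; apply: leq_trans szL (ltnW iN).
- by move=> j jl; rewrite f1 // hO.
Qed.

End Generate.

(** * The sampling loop and its distribution *)

Definition close_phase : program :=
  [:: Assign vL (Atom (Var vI));
      If Defs.Lt (Const 0) (Var vQ) close_arc [::];
      Assign vA (Bin Add (Var vI) (Const 1));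
      Write aOut (Var vA) (Var vL);
      Assign vH (Bin Add (Var vH) (Const 1))].

Definition open_phase : program :=
  [:: If Defs.Lt (Const 0) (Var vQ) open_arc [::];
      Assign vH (Bin Add (Var vH) (Const 1));
      Assign vI (Bin Add (Var vI) (Const 1))].

Definition vertex (K : nat) : program :=
  pick_option K ++ (close_phase ++ (pick_option K ++ open_phase)).

Definition generate (K : nat) : program :=
  [:: Assign vM (Bin Add (Var vN) (Const 1));
      Assign vY (Lookup aPowM (Const K.+1%:Z));
      Assign vC (Atom (Var vN))] ++
  [:: While Defs.Lt (Var vI) (Var vN) (vertex K)].

Section Generation.
Variables K N : nat.
Let M := N.+1.

Definition chosen (p : nat) (L : tableau) (c : option nat * tableau) : Prop :=
  if p is r.+1 then
    [/\ (r < K)%N, (cnt L r.+1 < cnt L r)%N & exists2 y, c.1 = Some y & del r L = Some (y, c.2)]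
  else c = (None, L).

Lemma triple_close_phase tb s h i L l p c : tables K N tb -> (i < N)%N ->
  legit K i L -> size l = i -> represents K N s h i L l -> reg vQ s = p%:Z ->
  chosen p L c ->
  triple tb (5 + close_time K) close_phase s (fun s' =>
    represents K N s' h.+1 i c.2 (relabel l c.1)).
Proof.
move=> tbT iN lL sl rep hQ hc.
rewrite /close_phase -[_ :: _]/([:: _] ++ ([:: _] ++ [:: _; _; _])).
have fin s1 L1 lab : represents K N s1 h i L1 l -> reg vL s1 = lab%:Z ->
  triple tb 3 [:: Assign vA (Bin Add (Var vI) (Const 1)); Write aOut (Var vA) (Var vL);
      Assign vH (Bin Add (Var vH) (Const 1))] s1
    (fun s' => represents K N s' h.+1 i L1 (rcons l lab)).
  case=> [[cN cM cY] [cH cI cC] hR hO] hL; rewrite /reg in cN cM cY cH cI cC hL.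
  apply: (@triple_assign _ i.+1%:Z); first by rewrite /= cI; lia.
  apply: (@triple_write _ i.+1%:Z lab%:Z); try by rewrite /=; look.
  apply: (@triple_assign _ h.+1%:Z); first by rewrite /=; look; rewrite cH; lia.
  apply: triple_nil; split.
  - by split; rewrite /reg; look.
  - by split; rewrite /reg; look.
  - move=> q /hR; apply: (@row_stored_frame _ [:: vA; aOut; vH]) => //.
    by do ![apply: frame_put_trans => //].
  - move=> j; rewrite size_rcons ltnS nth_rcons sl.
    case: ltngtP => // [ji _|-> _]; last by look.
    look; rewrite get_put_index; last by rewrite eqz_nat eqSS ltn_eqF.
    by look; rewrite hO // sl.
have cI : get s (vI, 0) = i%:Z by have [_ [_ hI _] _ _] := rep.
apply: (@triple_le _ (1 + ((1 + close_time K) + 3))); first by lia.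
apply: triple_cat.
  apply: (@triple_assign _ i%:Z); first exact: cI.
  exact: triple_nil (erefl _).
move=> _ <-; set s1 := put _ _ _.
have rep1 : represents K N s1 h i L l.
  by apply: (represents_frame (X := [:: vL])) rep => //; apply: frame_put.
have L1 : reg vL s1 = i%:Z by rewrite /s1 /reg; look.
have Q1 : reg vQ s1 = p%:Z by rewrite /s1 /reg; look.
clearbody s1; case: p hQ Q1 hc => [|r] hQ Q1 hc.
  apply: (triple_cat (Mid := fun s' => s' = s1)).
    apply: (@triple_if _ false); first by move: Q1; rewrite /reg /= => ->.
    exact: triple_nil.
  (* No arc closes, so [vL] keeps its default, the index of the vertex itself, which is the label of
     a new block. *)
  by move=> _ ->; rewrite hc /relabel /= sl; apply: fin.
case: hc => rK gr [y Ey E]; rewrite Ey /relabel.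
apply: (triple_cat (Mid := fun s' => represents K N s' h i c.2 l /\ reg vL s' = (nth 0%N l y)%:Z)).
  apply: (@triple_if _ true); first by move: Q1; rewrite /reg /= => ->.
  rewrite cats0; apply: triple_impl (triple_close tbT (ltnW iN) lL rK gr E sl rep1 Q1).
  by move=> s' [].
by move=> s' [rep' hL]; apply: fin.
Qed.

Lemma triple_open_phase tb s h i L l r0 : tables K N tb -> (i < N)%N ->
  legit K i L -> represents K N s h i L l ->
  (if r0 is Some r then (r < K)%N /\ reg vQ s = r.+1%:Z else reg vQ s = 0) ->
  triple tb 14 open_phase s (fun s' =>
    represents K N s' h.+1 i.+1 (if r0 is Some r then (i, r) :: L else L) l).
Proof.
move=> tbT iN lL rep hQ; rewrite /open_phase -cat1s.
have fin s1 L1 : represents K N s1 h i L1 l ->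
  triple tb 2 [:: Assign vH (Bin Add (Var vH) (Const 1)); Assign vI (Bin Add (Var vI) (Const 1))]
    s1 (fun s' => represents K N s' h.+1 i.+1 L1 l).
  case=> [[cN cM cY] [cH cI cC] hR hO]; rewrite /reg in cN cM cY cH cI cC.
  apply: (@triple_assign _ h.+1%:Z); first by rewrite /= cH; lia.
  apply: (@triple_assign _ i.+1%:Z); first by rewrite /=; look; rewrite cI; lia.
  apply: triple_nil; split.
  - by split; rewrite /reg; look.
  - by split; rewrite /reg; look.
  - move=> q /hR; apply: (@row_stored_frame _ [:: vI; vH]) => //.
    by do ![apply: frame_put_trans => //].
  - by move=> j jl; look; apply: hO.
apply: (@triple_le _ (12 + 2)) => //.
case: r0 hQ => [r [rK hQ]|hQ].
  apply: (triple_cat (Mid := fun s' => represents K N s' h i ((i, r) :: L) l)); last by move=> s1 /fin.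
  apply: (@triple_if _ true); first by move: hQ; rewrite /reg /= => ->.
  rewrite cats0; apply: triple_impl (triple_open tbT iN lL rK rep hQ).
  by move=> s' [].
apply: (triple_cat (Mid := fun s' => s' = s)); last by move=> _ ->; apply: fin.
apply: (@triple_if _ false); first by move: hQ; rewrite /reg /= => ->.
exact: triple_nil.
Qed.

Lemma shape_code_affine i L : legit K i L -> (i <= N)%N ->
  exists2 x, (x < M ^ K)%N & shape_code K N L = (N + M * x)%N.
Proof.
move=> lL iN; exists (shape_code K N L %/ M)%N.
  rewrite ltn_divLR // -expnSr; apply: encode_ltn => p _; exact: shape_ltn lL iN p.
have := digit_shape 0 lL iN; rewrite /digit expn0 divn1 /= => E0.
by rewrite [LHS](divn_eq _ M) E0 addnC mulnC.
Qed.

Variables (tb : store) (Q : store -> Prop) (E : pred store) (F : pred (seq nat)).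
Hypothesis tbT : tables K N tb.
Hypothesis QT : forall s, Q s.
Hypothesis EF : forall s l, size l = N ->
  (forall j, (j < N)%N -> get s (aOut, j.+1%:Z) = (nth 0%N l j)%:Z) -> E s = F l.

Notation rate a b := ((a%N)%:R / (b%N)%:R : rat).

Lemma sum_options_ord (T : Type) (G : T -> nat) (x0 : T) (f : nat -> T) (P : pred nat) :
  (\sum_(p < K.+1) (if nat_of_ord p is r.+1 then if P r then G (f r) else 0 else G x0) =
   \sum_(x <- x0 :: [seq f r | r <- iota 0 K & P r]) G x)%N.
Proof.
rewrite sum_options big_ord_recl; congr (_ + _)%N.
by rewrite big_add1 /= big_mkord.
Qed.

Lemma open_successes_le l n i L : legit K i L -> (i.+1 + n = N)%N ->
  (open_successes K N F l n i L <= completions K M n.*2.+1 (shape_code K N L))%N.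
Proof.
move=> lL iN; have iN' : (i < N)%N by lia.
rewrite -(sum_opens lL iN') ?odd_double // /open_successes big_seq [X in (_ <= X)%N]big_seq.
apply: leq_sum => L2; rewrite (opens_legit _ lL iN') => /andP[l2 _].
by rewrite -(size_walks_completions l2 iN) successes_le.
Qed.

Definition open_time (t : nat) := (pick_time K + (14 + t))%N.

(** The second half of a vertex: an odd number of half-steps remains, and the probability of success
    is again a quotient of two counts, now summed over the possible openings. *)
Lemma ok_open_half s n i L l t q : legit K i L -> (i.+1 + n = N)%N ->
  represents K N s i.*2.+1 i L l ->
  (0 < completions K M n.*2.+1 (shape_code K N L))%N ->
  (forall L2 s', legit K i.+1 L2 -> represents K N s' i.+1.*2 i.+1 L2 l ->
     (0 < size (walks K N n i.+1 L2))%N ->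
     ok tb Q E t (q, s')
       (rate (successes K N F l n i.+1 L2) (size (walks K N n i.+1 L2)))) ->
  ok tb Q E (open_time t) (pick_option K ++ (open_phase ++ q), s)
    (rate (open_successes K N F l n i L) (completions K M n.*2.+1 (shape_code K N L))).
Proof.
move=> lL iN rep pos IH; have iN' : (i < N)%N by lia.
have [[cN cM cY] [cH cI cC] hR hO] := rep.
have [x xK Ex] := shape_code_affine lL (ltnW iN').
have h2 : (i.*2.+1 < N.*2)%N by lia.
have Em : (N.*2 - i.*2.+1 = n.*2.+1)%N by lia.
have Em' : (N.*2 - i.*2.+2 = n.*2)%N by lia.
rewrite /open_successes /opens -sum_options_ord Ex -Em in pos *.
rewrite Ex in cC.
have sW M2 : M2 \in opens K N i L ->
  completions K M n.*2 (shape_code K N M2) = size (walks K N n i.+1 M2).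
  by rewrite (opens_legit _ lL iN') => /andP[l2 _]; rewrite -(size_walks_completions l2 iN).
have wE p : (p <= K)%N -> choice_weight K N i.*2.+1 x p =
  if p is r.+1 then if openable N L r then size (walks K N n i.+1 ((i, r) :: L)) else 0%N
  else size (walks K N n i.+1 L).
  case: p => [|r] rK; rewrite /choice_weight /option_weight -Ex Em'.
    by apply: sW; apply: mem_head.
  rewrite /= odd_double (admissible_open r lL (ltnW iN')); case: ifP => // op.
  rewrite (successor_open N i) //; apply: sW; rewrite inE; apply/orP; right.
  by apply/mapP; exists r => //; rewrite mem_filter op mem_iota.
apply: (ok_pick tbT h2 xK cM cY cH cC (c := fun p => if p is r.+1 then
   if openable N L r then successes K N F l n i.+1 ((i, r) :: L) else 0%N
   else successes K N F l n i.+1 L)) => //.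
- move=> p pK; rewrite wE //; case: p pK => [|r] rK.
    by move=> w0; apply/eqP; rewrite -leqn0 -w0 successes_le.
  by case: ifP => // _ w0; apply/eqP; rewrite -leqn0 -w0 successes_le.
move=> p s' pK wpos f hQ; rewrite wE // in wpos *.
pose r0 := if p is r.+1 then Some r else None.
have rep' : represents K N s' i.*2.+1 i L l by apply: represents_frame f rep.
have op : (if p is r.+1 then openable N L r else true).
  by case: (p) wpos => // r; case: ifP.
set L2 := if r0 is Some r then (i, r) :: L else L.

have l2 : legit K i.+1 L2.
  have : L2 \in opens K N i L.
    rewrite /L2 /r0; case: (p) pK op => [|r] rK op; first exact: mem_head.
    by rewrite inE; apply/orP; right; apply/mapP; exists r; rewrite // mem_filter op mem_iota.
  by rewrite (opens_legit _ lL iN') => /andP[].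
apply: ok_triple.
  apply: (triple_open_phase (r0 := r0) tbT iN' lL rep').
  by rewrite /r0; case: (p) pK hQ.
move=> s2; rewrite -/L2 => rep2.
have := IH L2 s2 l2 rep2; rewrite /L2 /r0; case: (p) wpos op => [|r] wpos op; first exact.
by rewrite op in wpos *; apply.
Qed.

Definition vertex_time := (1 + (pick_time K + ((5 + close_time K) + (pick_time K + 14))))%N.

(** Both counts are sums over the choices of the next half-step, and each choice is drawn in
    proportion to its completions. So the conditional probabilities combine, through [ok_pick], to
    the fraction of successful walks. *)
Lemma ok_generate_loop n i L l s : (i + n = N)%N -> legit K i L -> size l = i ->
  represents K N s i.*2 i L l -> (0 < size (walks K N n i L))%N ->
  ok tb Q E (n * vertex_time + 1) ([:: While Defs.Lt (Var vI) (Var vN) (vertex K)], s)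
    (rate (successes K N F l n i L) (size (walks K N n i L))).
Proof.
elim: n i L l s => [|n IH] i L l s iN lL sl rep pos.
  have [[cN _ _] [_ cI _] _ hO] := rep; rewrite addn0 in iN.
  rewrite mul0n add0n; apply: ok_while_false.
    by move: cN cI; rewrite /reg /= iN => -> ->; rewrite ltxx.
  case: L lL rep pos => // _ _ _; rewrite /successes /= divr1 addn0.
  rewrite -(EF (s := s)) ?sl //; last by move=> j; rewrite -{1}iN -{1}sl; apply: hO.
  exact: ok_halt.
have iN1 : (i < N)%N by lia.
have iN2 : (i.+1 + n = N)%N by lia.
set t := (n * vertex_time + 1)%N.
have [[cN cM cY] [cH cI cC] hR hO] := rep.
have [x xK Ex] := shape_code_affine lL (ltnW iN1).
have h2 : (i.*2 < N.*2)%N by lia.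
have Em : (N.*2 - i.*2 = n.*2.+2)%N by lia.
have Em' : (N.*2 - i.*2.+1 = n.*2.+1)%N by lia.
rewrite (size_walks_completions lL iN) doubleS successesS in pos *.
rewrite /closes -sum_options_ord Ex -Em in pos *; rewrite Ex in cC.
have -> : (n.+1 * vertex_time + 1 =
    (pick_time K + ((5 + close_time K) + (pick_time K + (14 + t)))).+1)%N.
  by rewrite mulSn /t; set w := (n * vertex_time)%N; rewrite /vertex_time; lia.
apply: ok_while_true; first by move: cN cI; rewrite /reg /= => -> ->; rewrite ltz_nat.
rewrite /vertex -!catA.
have wE p : (p <= K)%N -> choice_weight K N i.*2 x p =
  if p is r.+1 then if (cnt L r.+1 < cnt L r)%N
    then completions K M n.*2.+1 (shape_code K N (delete r L).2) else 0%N
  else completions K M n.*2.+1 (shape_code K N L).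
  case: p => [|r] rK; rewrite /choice_weight /option_weight -Ex Em' //.
  rewrite odd_double (admissible_close r lL (ltnW iN1)); case: ifP => // gr.
  have [y [L1 [EL _ _ _]]] := legit_del lL gr.
  by rewrite (successor_close N rK EL) /delete EL.
apply: (ok_pick tbT h2 xK cM cY cH cC (c := fun p => if p is r.+1 then
   if (cnt L r.+1 < cnt L r)%N then
     open_successes K N F (relabel l (Some (delete r L).1)) n i (delete r L).2 else 0%N
   else open_successes K N F (relabel l None) n i L)) => //.
- move=> p pK; rewrite wE //; case: p pK => [|r] rK.
    by move=> w0; apply/eqP; rewrite -leqn0 -w0 open_successes_le.
  case: ifP => // gr w0; apply/eqP; rewrite -leqn0 -w0.
  have [y [L1 [EL _ _ l1]]] := legit_del lL gr.
  by rewrite open_successes_le // /delete EL.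
move=> p s' pK wpos f hQ; rewrite wE // in wpos *.
have rep' : represents K N s' i.*2 i L l by apply: represents_frame f rep.
have [c [hc lc cE]] : exists c, [/\ chosen p L c, legit K i c.2 &
    rate (if p is r.+1 then
      if (cnt L r.+1 < cnt L r)%N then
        open_successes K N F (relabel l (Some (delete r L).1)) n i (delete r L).2 else 0%N
      else open_successes K N F (relabel l None) n i L)
     (if p is r.+1 then if (cnt L r.+1 < cnt L r)%N
       then completions K M n.*2.+1 (shape_code K N (delete r L).2) else 0%N
       else completions K M n.*2.+1 (shape_code K N L)) =
    rate (open_successes K N F (relabel l c.1) n i c.2)
         (completions K M n.*2.+1 (shape_code K N c.2)) /\
    (0 < completions K M n.*2.+1 (shape_code K N c.2))%N].
  case: p pK wpos {hQ} => [|r] rK; first by move=> wpos; exists (None, L).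
  case: ifP => // gr wpos; have [y [L1 [EL _ _ l1]]] := legit_del lL gr.
  rewrite /delete EL /= in wpos *; exists (Some y, L1); split=> //.
  by split=> //; exists y.
have [{}cE cpos] := cE; rewrite cE.
apply: ok_triple (triple_close_phase tbT iN1 lL sl rep' hQ hc) _ => s2 rep2.
apply: (ok_open_half lc iN2 rep2 cpos) => L2 s3 l2 rep3 pos3.
apply: IH => //; by rewrite size_rcons sl.
Qed.

Definition generate_time := (3 + (N * vertex_time + 1))%N.

Lemma ok_generate : ok tb Q E generate_time (generate K, put [fmap]%fmap (0%N, 0) N%:Z)
  (rate (successes K N F [::] N 0 [::]) (size (walks K N N 0 [::]))).
Proof.
(* The walk that never changes the shape is always available, so the first draw has positive total
   weight. *)
have pos : (0 < size (walks K N N 0 [::]))%N.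
  rewrite (size_walks_completions (legit0 K) (add0n N)) shape_code_nil.
  by elim: (N.*2) => [|m IH]; [rewrite /completions /= eqxx|rewrite completionsS ltn_addr].
set s0 := put _ _ _.
have s0N : get s0 (vN, 0) = N%:Z by rewrite /s0 get_put_same.
have s00 A i : A != vN -> get s0 (A, i) = 0.
  by move=> AN; rewrite /s0 get_put_array 1?eq_sym ?(negbTE AN) // /get fnd_fmap0.
clearbody s0; have [tP _ _] := tbT.
apply: (ok_triple (Post := fun s => represents K N s 0 0 [::] [::])); last first.
  by move=> s rep; apply: ok_generate_loop.
apply: (@triple_assign _ M%:Z); first by rewrite /= s0N; lia.
apply: (@triple_assign _ (M ^ K.+1)%N%:Z); first by rewrite /= tP.
apply: (@triple_assign _ N%:Z); first by rewrite /=; look.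
(* Unwritten cells read 0, which is right for [vH], [vI] and the power sums of the empty rows; the
   code of the empty shape is [N] and had to be set. *)
apply: triple_nil; split=> //.
- by split; rewrite /reg; look.
- by split; rewrite /reg; look; rewrite ?s00 // shape_code_nil.
- by move=> r rK; split=> //; look; rewrite s00 // /weight_sum big_nil.
Qed.

End Generation.

(** * Output, time bounds and conclusion *)

Lemma output_label_partition N s l :
  (forall j, (j < N)%N -> get s (aOut, j.+1%:Z) = (nth 0%N l j)%:Z) ->
  output N s = label_partition N l.
Proof.
move=> h; rewrite /output /label_partition /preim_partition /equivalence_partition.
apply: eq_imset => x; apply/setP => y; rewrite !inE /=.
by rewrite -/aOut !h ?ltn_ord // eqz_nat.
Qed.

Lemma run_exec_dist p tb N t : run p tb N t = exec_dist tb t (initial p N).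
Proof. by []. Qed.

(** The successor accounts for the cell that holds the input before the first step. The dominant
    term is [2 N] half-steps times [N.+1 ^ K] codes times [23 * K + 11] instructions, and
    [N.+1 <= 2 * N] yields the factor [2 ^ K.+1]. *)
Lemma precompute_time_bound K N : (0 < N)%N ->
  ((precompute_time K N).+1 <= (4 * K + 50 + 2 ^ K.+1 * (23 * K + 13)) * N ^ K.+1)%N.
Proof.
move=> N0; have pK : (N.+1 ^ K <= 2 ^ K * N ^ K)%N.
  by rewrite -expnMn; case: K => // K'; rewrite leq_exp2r //; lia.
have {pK} : (N * N.+1 ^ K * (23 * K + 11) <= 2 ^ K * N ^ K.+1 * (23 * K + 11))%N.
  by rewrite leq_mul2r expnS mulnCA leq_mul2l pK !orbT.
have X1 : (N <= N ^ K.+1)%N by rewrite -{1}[N]expn1 leq_pexp2l.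
have -> : ((precompute_time K N).+1 =
    4 * K + 21 + 12 * N + 2 * (N * N.+1 ^ K * (23 * K + 11)))%N.
  by rewrite /precompute_time; set P := (N.+1 ^ K)%N; rewrite -mul2n; lia.
have X0 : (0 < N ^ K.+1)%N by rewrite expn_gt0 N0.
rewrite [(2 ^ K.+1)%N]expnS; move: X1 X0.
set X := (N ^ K.+1)%N; set D := (2 ^ K)%N; set V := (N * _ * _)%N => X1 X0 hV.
have hK := leq_pmulr (4 * K + 21) X0.
apply: (@leq_trans ((4 * K + 21 + 12 + 2 * (D * (23 * K + 11))) * X)); first by lia.
by rewrite leq_mul2r; apply/orP; right; lia.
Qed.

Lemma generate_time_bound K N : (0 < N)%N ->
  ((generate_time K N).+1 <= (vertex_time K + 5) * N)%N.
Proof. by rewrite /generate_time; nia. Qed.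

Theorem theorem3p2 (k : nat) (hk : (2 <= k)%N) :
  exists (pre gen : program) (C : nat), forall N : nat, (1 <= N)%N ->
    runs_within pre [fmap] N (C * N ^ k) (C * N ^ k) /\
    (forall c : config, possible (run pre [fmap] N (C * N ^ k)) c ->
       let tables := c.2 in
       runs_within gen tables N (C * N) (C * N) /\
       (forall P : {set {set 'I_N}},
          prob (run gen tables N (C * N)) (fun c' => output N c'.2 == P) =
          (P \in noncrossing_partitions k N)%:R /
          #|noncrossing_partitions k N|%:R)).
Proof.
case: k hk => // K _.
pose C1 := (4 * K + 50 + 2 ^ K.+1 * (23 * K + 13))%N.
pose C2 := (vertex_time K + 5)%N.
exists (precompute K), (generate K), (C1 + C2)%N => N N0.
have t1 : ((precompute_time K N).+1 <= (C1 + C2) * N ^ K.+1)%N.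
  by apply: leq_trans (precompute_time_bound K N0) _; rewrite leq_mul2r leq_addr orbT.
have t2 : ((generate_time K N).+1 <= (C1 + C2) * N)%N.
  by apply: leq_trans (generate_time_bound K N0) _; rewrite leq_mul2r leq_addl orbT.
have space0 : space (put [fmap] (0%N, 0) N%:Z) = 1%N.
  by rewrite /space /put dom_setf domf0 fsetU0 cardfs1.
have okP : ok [fmap] (tables K N) pred0 (precompute_time K N) (initial (precompute K) N) 0.
  have [s e hs] := triple_precompute K N [fmap].
  have := e _ _ _ _ _ (@ok_halt [fmap] (tables K N) pred0 0 s hs).
  by rewrite addn0 cats0.
rewrite /runs_within !run_exec_dist.
have [hP _] := okP _ (ltnW t1).
have hP' c : possible (exec_dist [fmap] ((C1 + C2) * N ^ K.+1) (initial (precompute K) N)) c ->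
    [/\ halted c, (space c.2 <= (C1 + C2) * N ^ K.+1)%N & tables K N c.2].
  move=> /hP[h1 h2 h3]; split=> //; apply: leq_trans t1.
  by move: h2; rewrite [space (initial _ _).2]space0 add1n.
split; first by move=> c /hP'[].
move=> c /hP'[_ _]; move: c.2 => tb tbT {hP hP' okP}.
have okG P : ok tb (fun _ => True) (fun s => output N s == P) (generate_time K N)
    (initial (generate K) N)
    ((P \in noncrossing_partitions K.+1 N)%:R / #|noncrossing_partitions K.+1 N|%:R).
  case: N N0 {t1 t2 space0} P tb tbT => // N _ P tb tbT.
  have := @ok_generate K N.+1 tb (fun _ => True) (fun s => output N.+1 s == P)
    (fun l => label_partition N.+1 l == P) tbT (fun _ => I).
  rewrite /successes count_walks size_walks; apply => s l _ hl.
  by rewrite (output_label_partition hl).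
rewrite run_exec_dist; split=> [c' pc'|P].
  (* Halting and space do not depend on the event, so any choice of [P] serves. *)
  have [h _] := okG set0 _ (ltnW t2); have [h1 h2 _] := h _ pc'.
  split=> //; apply: leq_trans t2.
  by move: h2; rewrite [space (initial _ _).2]space0 add1n.
by have [_ <-] := okG P _ (ltnW t2).
Qed.
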